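(* Let $\mathcal K$ be a multiplicative valued difference field with parameter $\rho$ satisfying Axiom 2, with value group $\Gamma$. (1) Suppose $\mathcal K'$ is a proper immediate $\sigma$-henselian extension of $\mathcal K$ and $a\in K'\setminus K$. Let $\mathcal K_1$ be a $\sigma$-henselian extension of $\mathcal K$ satisfying Axiom 2 such that every pc-sequence in $K_1$ of length at most $\mathrm{card}(\Gamma)$ has a pseudo-limit in $K_1$. Then $\mathcal K\langle a\rangle$ embeds in $\mathcal K_1$ over $\mathcal K$. (2) Suppose $\mathcal K'$ is a proper immediate $\sigma$-henselian $\sigma$-algebraic extension of $\mathcal K$ and $a\in K'\setminus K$. Let $\mathcal K_1$ be a $\sigma$-henselian extension of $\mathcal K$ satisfying Axiom 2 such that every pc-sequence in $K_1$ of $\sigma$-algebraic type over $K_1$ and of length at most $\mathrm{card}(\Gamma)$ has a pseudo-limit in $K_1$. Then $\mathcal K\langle a\rangle$ embeds in $\mathcal K_1$ over $\mathcal K$.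
   Context: A valued difference field $\mathcal K=(K,\Gamma,k;v,\pi)$ is a valued field with a field automorphism $\sigma$ of $K$ preserving the valuation ring $\mathcal O$; $\sigma$ induces automorphisms $\sigma(v(x)):=v(\sigma(x))$ of $\Gamma$ and $\bar\sigma$ of $k$. It is multiplicative with parameter $\rho$ if $\mathrm{char}\,K=\mathrm{char}\,k=0$ and (Axiom 1), writing $\rho\cdot\gamma:=\sigma(\gamma)$ and $L\cdot\gamma:=\sum m_i\sigma^i(\gamma)$ for $L=\sum m_i\rho^i\in\mathbb Z[\rho]$: each $L$ is either positive on all $\gamma>0$, zero on all $\gamma>0$, or negative on all $\gamma>0$; and $\rho\cdot\gamma\ge\gamma$ for $\gamma>0$. All extensions considered are of this kind with the same $\rho$. Axiom 2: for each integer $d>0$ there is $y\in k$ with $\bar\sigma^d(y)\ne y$. $\mathcal K\langle a\rangle$ is the valued difference subfield generated by $K$ and $a$ (underlying field $K(\sigma^i(a):i\in\mathbb Z)$); embeddings are embeddings of valued difference fields. An extension is immediate if it has the same value group and residue field; it is $\sigma$-algebraic if every element satisfies a nonzero $\sigma$-polynomial over the base. $\sigma$-polynomials: $P(x)=F(x,\sigma(x),\dots,\sigma^n(x))$ with $F$ a polynomial over $K$; Taylor coefficients $P_{(\vec I)}$ are defined by $P(x+y)=\sum_{\vec I\in\mathbb N^{n+1}}P_{(\vec I)}(x)\prod_j\sigma^j(y)^{i_j}$; $P_{(i)}$ denotes $P_{(\vec e_i)}$; $|\vec I|_\rho\cdot\gamma:=\sum_j i_j\rho^j\cdot\gamma$.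 $(P,a)$ with $P\notin K$, $a\in K$ is in $\sigma$-hensel configuration if there are $0\le i\le n$ and $\gamma\in\Gamma$ with (i) $v(P(a))=v(P_{(i)}(a))+\rho^i\cdot\gamma\le v(P_{(j)}(a))+\rho^j\cdot\gamma$ for all $0\le j\le n$, and (ii) $v(P_{(\vec J)}(a))+|\vec J|_\rho\cdot\gamma<v(P_{(\vec L)}(a))+|\vec L|_\rho\cdot\gamma$ whenever $\vec0\ne\vec J<\vec L$ (componentwise order) and $P_{(\vec J)}\neq0$; such $\gamma$ is unique and denoted $\gamma(P,a)$. $\mathcal K$ is $\sigma$-henselian if for every $(P,a)$ in $\sigma$-hensel configuration there is $b\in K$ with $v(b-a)=\gamma(P,a)$ and $P(b)=0$. A pc-sequence is a sequence $\{a_\eta\}_{\eta<\lambda}$, $\lambda$ a limit ordinal (its length), with $v(a_{\eta''}-a_{\eta'})>v(a_{\eta'}-a_\eta)$ for $\eta''>\eta'>\eta\ge\eta_0$ (some $\eta_0$); $a$ is a pseudo-limit if $v(a-a_{\eta'})>v(a-a_\eta)$ for $\eta'>\eta\ge\eta_0$. Two pc-sequences are equivalent if they have the same pseudo-limits in all valued field extensions. A pc-sequence $\{a_\eta\}$ in $K$ is of $\sigma$-algebraic type over $K$ if $P(b_\eta)$ pseudo-converges to $0$ for some $\sigma$-polynomial $P$ over $K$ and some pc-sequence $\{b_\eta\}$ in $K$ equivalent to $\{a_\eta\}$. *)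

(* Defs.v *)
From HB Require Import structures.
From mathcomp Require Import all_boot all_order all_algebra.
From mathcomp Require Import boolp wochoice.
From mathcomp Require Import mpoly.

Set Implicit Arguments.
Unset Strict Implicit.
Unset Printing Implicit Defensive.

Import Order.TTheory GRing.Theory Num.Theory.
Local Open Scope ring_scope.

(** * Valued fields *)

(* Totality is an axiom here rather than inherited from [Order.Total], since a
   join of [Order.Total] and [GRing.Zmodule] would lie strictly between existing
   structures, which Hierarchy Builder rejects. *)
HB.mixin Record isOrderedAbGroup G of Num.POrderedZmodule G := {
  oag_lerD2r : forall z x y : G, x <= y -> x + z <= y + z;
  oag_le_total : total (<=%R : rel G)
}.

#[short(type="oagType")]
HB.structure Definition OrderedAbGroup :=
  { G of Num.POrderedZmodule G & isOrderedAbGroup G }.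

(* [option G] stands for the extended group [G \cup {oo}], with [None] as the
   top element [oo]. *)
Section Extended.
Variable G : oagType.
Implicit Types x y : option G.

Definition ele x y : bool :=
  if y is Some b then (if x is Some a then a <= b else false) else true.
Definition elt x y : bool := ~~ ele y x.
Definition eadd x y : option G :=
  if x is Some a then (if y is Some b then Some (a + b) else None) else None.
End Extended.

(* [vres] is only meaningful on the valuation ring: no axiom constrains
   it elsewhere. *)
Record valuedField := ValuedField {
  vf_field :> fieldType;
  vf_group : oagType;
  vf_residue : fieldType;
  vval : vf_field -> option vf_group;
  vres : vf_field -> vf_residue;
  vf_val_eq0 : forall x, vval x = None <-> x = 0;
  vf_valM : forall x y, vval (x * y) = eadd (vval x) (vval y);
  vf_valD : forall x y,
    ele (vval x) (vval y) -> ele (vval x) (vval (x + y));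
  vf_val_surj : forall g, exists x, vval x = Some g;
  vf_res1 : vres 1 = 1;
  vf_resD : forall x y, ele (Some 0) (vval x) -> ele (Some 0) (vval y) ->
    vres (x + y) = vres x + vres y;
  vf_resM : forall x y, ele (Some 0) (vval x) -> ele (Some 0) (vval y) ->
    vres (x * y) = vres x * vres y;
  vf_res_eq0 : forall x, ele (Some 0) (vval x) ->
    (vres x = 0 <-> elt (Some 0) (vval x));
  vf_res_surj : forall c, exists2 x, ele (Some 0) (vval x) & vres x = c
}.

Definition in_valring (K : valuedField) (x : K) : bool := ele (Some 0) (vval x).

Record vf_embedding (K L : valuedField) := VfEmbedding {
  emb_field :> {rmorphism K -> L};
  emb_group : {additive vf_group K -> vf_group L};
  emb_residue : {rmorphism vf_residue K -> vf_residue L};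
  emb_group_mono : {mono emb_group : g h / g <= h};
  emb_val : forall x : K, vval (emb_field x) = omap emb_group (vval x);
  emb_res : forall x : K, in_valring x ->
    vres (emb_field x) = emb_residue (vres x)
}.

(** * Valued difference fields *)

(* The last two axioms say that [vdf_sigma_group] and [vdf_sigma_residue] are
   the maps that sigma induces on the value group and on the residue field;
   they determine both of them, since [vval] and [vres] are surjective. *)
Record vdField := VdField {
  vdf_vf :> valuedField;
  vdf_sigma : {rmorphism vdf_vf -> vdf_vf};
  vdf_sigma_group : vf_group vdf_vf -> vf_group vdf_vf;
  vdf_sigma_residue : vf_residue vdf_vf -> vf_residue vdf_vf;
  vdf_sigma_bij : bijective vdf_sigma;
  vdf_sigma_valring : forall x, in_valring (vdf_sigma x) = in_valring x;
  vdf_sigma_val : forall x, vval (vdf_sigma x) = omap vdf_sigma_group (vval x);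
  vdf_sigma_res : forall x, in_valring x ->
    vres (vdf_sigma x) = vdf_sigma_residue (vres x)
}.

Notation sigma := (@vdf_sigma _).

Record vdf_embedding (K L : vdField) := VdfEmbedding {
  vde_emb :> vf_embedding K L;
  vde_sigma : forall x : K, vde_emb (sigma x) = sigma (vde_emb x)
}.

(* [rho^i . g] *)
Definition rho_pow (K : vdField) (i : nat) (g : vf_group K) : vf_group K :=
  iter i (@vdf_sigma_group K) g.

(* [L . g] for [L = \sum_i m_i rho^i], where [L] is given by the integer
   polynomial [\sum_i m_i 'X^i]. *)
Definition rho_act (K : vdField) (L : {poly int}) (g : vf_group K) :
    vf_group K :=
  \sum_(i < size L) rho_pow i g *~ L`_i.

Definition axiom1 (K : vdField) : Prop :=
  (forall L : {poly int},
     [\/ forall g : vf_group K, 0 < g -> 0 < rho_act L g,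
         forall g : vf_group K, 0 < g -> rho_act L g = 0
       | forall g : vf_group K, 0 < g -> rho_act L g < 0])
  /\ (forall g : vf_group K, 0 < g -> g <= rho_pow 1 g).

(* The parameter rho is an element of a real closed field: the sign of
   [L . g] for [g > 0] is the sign of the real [L(rho)]. By [axiom1], some such
   rho always exists. Sharing rho is what it means for two structures to have
   the same parameter. *)
Definition has_parameter (R : rcfType) (rho : R) (K : vdField) : Prop :=
  forall (L : {poly int}) (g : vf_group K), 0 < g ->
    let r := (map_poly (intr : int -> R) L).[rho] in
    [/\ 0 < r -> 0 < rho_act L g,
        r = 0 -> rho_act L g = 0
      & r < 0 -> rho_act L g < 0].

Record multiplicative (R : rcfType) (rho : R) (K : vdField) : Prop :=
  Multiplicative {
    mult_pchar_field : [pchar K] =i pred0;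
    mult_pchar_residue : [pchar (vf_residue K)] =i pred0;
    mult_axiom1 : axiom1 K;
    mult_parameter : has_parameter rho K
  }.

Definition axiom2 (K : vdField) : Prop :=
  forall d : nat, (0 < d)%N ->
    exists y : vf_residue K, iter d (@vdf_sigma_residue K) y <> y.

(** * Difference polynomials *)

(* A sigma-polynomial [P(x) = F(x, sigma x, ..., sigma^n x)] over [K] is given
   by [F : {mpoly K[n.+1]}]. *)
Definition sp_eval (K : vdField) n (F : {mpoly K[n.+1]}) (x : K) : K :=
  F.@[fun i : 'I_n.+1 => iter i sigma x].

(* The coefficient of [Y^I] in [F(X + Y)], seen as a polynomial in [Y] with
   coefficients in [K[X]]. *)
Definition sp_taylor (K : vdField) n (F : {mpoly K[n.+1]})
    (I : 'X_{1..n.+1}) : {mpoly K[n.+1]} :=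
  (mmap (fun c : K => (c%:MP_[n.+1])%:MP_[n.+1])
        (fun i : 'I_n.+1 => ('X_i)%:MP_[n.+1] + 'X_i) F)@_I.

Definition mnm_rho (K : vdField) n (I : 'X_{1..n.+1}) (g : vf_group K) :
    vf_group K :=
  \sum_(j < n.+1) rho_pow j g *+ I j.

(* [(P, a)] is in sigma-hensel configuration, witnessed by [g]; then [g] is
   [gamma(P, a)]. [(J < L)%MM] is the componentwise order. *)
Definition hensel_config_at (K : vdField) n (F : {mpoly K[n.+1]}) (a : K)
    (g : vf_group K) : Prop :=
  let v_at I := vval (sp_eval (sp_taylor F I) a) in
  [/\ forall c : K, F <> c%:MP,
      exists i : 'I_n.+1,
        vval (sp_eval F a) = eadd (v_at U_(i)%MM) (Some (rho_pow i g))
        /\ forall j : 'I_n.+1,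
             ele (eadd (v_at U_(i)%MM) (Some (rho_pow i g)))
                 (eadd (v_at U_(j)%MM) (Some (rho_pow j g)))
    & forall J L : 'X_{1..n.+1},
        J <> 0%MM -> (J < L)%MM -> sp_taylor F J <> 0 ->
        elt (eadd (v_at J) (Some (mnm_rho J g)))
            (eadd (v_at L) (Some (mnm_rho L g)))].

(* Quantifying over every witness [g] is quantifying over [gamma(P, a)], as
   the witness is unique. *)
Definition sigma_henselian (K : vdField) : Prop :=
  forall n (F : {mpoly K[n.+1]}) (a : K) (g : vf_group K),
    hensel_config_at F a g ->
    exists b : K, vval (b - a) = Some g /\ sp_eval F b = 0.

(** * Pseudo-convergence *)

(* A limit ordinal, presented by a well-ordered set of that order type. *)
Record limit_ordinal := LimitOrdinal {
  lo_idx :> Type;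
  lo_le : rel lo_idx;
  lo_wo : well_order lo_le;
  lo_inh : inhabited lo_idx;
  lo_lim : forall i, exists j, ~~ lo_le j i
}.

Definition strict (T : Type) (R : rel T) : rel T := fun x y => ~~ R y x.
Definition lo_lt (I : limit_ordinal) : rel I := strict (@lo_le I).

(* The cardinal of [T] is the least order type of the well-orders of [T]; and
   an ordinal is at most another one iff it maps to it in a strictly
   increasing way. *)
Definition length_le_card (I : limit_ordinal) (T : Type) : Prop :=
  forall R : rel T, well_order R ->
    exists f : I -> T, forall i j, lo_lt i j -> strict R (f i) (f j).

Section PseudoConvergence.
Variables (K : valuedField) (I : limit_ordinal).
Implicit Types (s t : I -> K) (b : K).

Definition pc_seq s : Prop :=
  exists i0 : I, forall i j k : I, lo_le i0 i -> lo_lt i j -> lo_lt j k ->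
    elt (vval (s j - s i)) (vval (s k - s j)).

Definition pseudo_limit s b : Prop :=
  exists i0 : I, forall i j : I, lo_le i0 i -> lo_lt i j ->
    elt (vval (b - s i)) (vval (b - s j)).
End PseudoConvergence.

Definition pc_equiv (K : valuedField) (I J : limit_ordinal)
    (s : I -> K) (t : J -> K) : Prop :=
  forall (L : valuedField) (f : vf_embedding K L) (b : L),
    pseudo_limit (fun i => f (s i)) b <-> pseudo_limit (fun j => f (t j)) b.

Definition sigma_alg_type (K : vdField) (I : limit_ordinal) (s : I -> K) :
    Prop :=
  exists n (F : {mpoly K[n.+1]}) (t : I -> K),
    [/\ pc_seq t, pc_equiv s t & pseudo_limit (fun i => sp_eval F (t i)) 0].

(** * Extensions *)

Section Extensions.
Variables (K L : vdField) (f : vdf_embedding K L).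

Definition proper_ext : Prop := exists y : L, forall x : K, f x <> y.

Definition immediate : Prop :=
  (forall g : vf_group L, exists h : vf_group K, emb_group f h = g) /\
  (forall c : vf_residue L, exists d : vf_residue K, emb_residue f d = c).

Definition sigma_algebraic : Prop :=
  forall y : L, exists n (F : {mpoly K[n.+1]}),
    F <> 0 /\ sp_eval (map_mpoly f F) y = 0.
End Extensions.

(** ** The valued difference subfield generated by an element *)

Section ValuationTheory.
Variable K : valuedField.
Implicit Types x y : K.

Lemma val0 : vval (0 : K) = None. Proof. exact/vf_val_eq0. Qed.

Lemma val_neq0 x : x <> 0 -> exists g, vval x = Some g.
Proof.
by move=> x0; case E: (vval x) => [g|]; [exists g | case: x0; exact/vf_val_eq0].
Qed.

Lemma val1 : vval (1 : K) = Some 0.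
Proof.
have [|g Eg] := @val_neq0 1; first exact/eqP/oner_neq0.
have := @vf_valM K 1 1; rewrite mulr1 Eg /= => -[/eqP].
by rewrite -subr_eq0 opprD addNKr oppr_eq0 => /eqP ->.
Qed.

Lemma oag_mulr2_eq0 (G : oagType) (g : G) : g + g = 0 -> g = 0.
Proof.
move=> gg; apply/eqP; rewrite eq_le; apply/andP; split.
  have /orP[//|g0] := oag_le_total g 0.
  by have := oag_lerD2r g _ _ g0; rewrite add0r gg.
have /orP[//|g0] := oag_le_total 0 g.
by have := oag_lerD2r g _ _ g0; rewrite add0r gg.
Qed.

Lemma valN x : vval (- x) = vval x.
Proof.
suff vN1 : vval (-1 : K) = Some 0.
  by rewrite -mulN1r vf_valM vN1; case: (vval x) => //= g; rewrite add0r.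
have [|g Eg] := @val_neq0 (-1); first by apply/eqP; rewrite oppr_eq0 oner_neq0.
have := @vf_valM K (-1) (-1); rewrite mulrNN mulr1 val1 Eg /= => -[E].
by rewrite (@oag_mulr2_eq0 _ g).
Qed.

Lemma valV x : vval x^-1 = omap -%R (vval x).
Proof.
have [->|/eqP x0] := eqVneq x 0; first by rewrite invr0 val0.
have [g Eg] := val_neq0 x0.
have [|h Eh] := @val_neq0 x^-1; first by apply/eqP; rewrite invr_eq0; apply/eqP.
have := vf_valM x x^-1; rewrite divff; last exact/eqP.
rewrite val1 Eg Eh /= => -[E]; congr Some.
by apply/eqP; rewrite -addr_eq0 addrC -E.
Qed.

Lemma valring0 : in_valring (0 : K). Proof. by rewrite /in_valring val0. Qed.
Lemma valring1 : in_valring (1 : K).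
Proof. by rewrite /in_valring val1 /= lexx. Qed.
Lemma valringN x : in_valring (- x) = in_valring x.
Proof. by rewrite /in_valring valN. Qed.

Lemma ele_trans (G : oagType) (x y z : option G) :
  ele x y -> ele y z -> ele x z.
Proof. by case: x y z => [a|] [b|] [c|] //=; apply: le_trans. Qed.
Lemma ele_total (G : oagType) (x y : option G) : ele x y || ele y x.
Proof. by case: x y => [a|] [b|] //=; apply: oag_le_total. Qed.

Lemma valringD x y : in_valring x -> in_valring y -> in_valring (x + y).
Proof.
rewrite /in_valring => Ox Oy.
have /orP[xy|yx] := ele_total (vval x) (vval y).
  exact: ele_trans Ox (vf_valD xy).
by rewrite addrC; apply: ele_trans Oy (vf_valD yx).
Qed.

Lemma valringM x y : in_valring x -> in_valring y -> in_valring (x * y).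
Proof.
rewrite /in_valring vf_valM; case: (vval x) (vval y) => [a|] [b|] //= a0 b0.
by apply: le_trans b0 _; have := oag_lerD2r b _ _ a0; rewrite add0r.
Qed.

Lemma res0 : vres (0 : K) = 0.
Proof. by apply/(vf_res_eq0 valring0); rewrite val0. Qed.

Lemma resN x : in_valring x -> vres (- x) = - vres x.
Proof.
move=> Ox; apply/eqP; rewrite -addr_eq0 -vf_resD ?addNr ?res0 //.
by move: Ox; rewrite -valringN.
Qed.

Lemma resV x : in_valring x -> vres x <> 0 ->
  in_valring x^-1 /\ vres x^-1 = (vres x)^-1.
Proof.
move=> Ox rx; have vx : vval x = Some 0.
  have: ~ elt (Some 0) (vval x) by move/(vf_res_eq0 Ox).
  move: Ox; rewrite /in_valring /elt; case: (vval x) => [g|] /= g0; last first.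
    by case.
  move=> /negP; rewrite negbK => g0'; congr Some.
  by apply: le_anti; rewrite g0 g0'.
have Ov : in_valring x^-1 by rewrite /in_valring valV vx /= oppr0 lexx.
split=> //; have x0 : x != 0.
  by apply/eqP => x0; move: vx; rewrite x0 val0.
apply: (@mulfI _ (vres x)); first exact/eqP.
by rewrite -vf_resM // !divff ?vf_res1 //; apply/eqP.
Qed.
End ValuationTheory.

Section Adjoin.
Variables (K L : vdField) (f : vdf_embedding K L) (a : L).

(* The smallest subfield of [L] containing the image of [K] and the
   [sigma^i(a)], [i \in Z]. *)
Inductive adjoined : L -> Prop :=
| adj_base x : adjoined (f x)
| adj_iter m : adjoined (iter m sigma a)
| adj_iterV m y : iter m sigma y = a -> adjoined y
| adjB x y : adjoined x -> adjoined y -> adjoined (x - y)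
| adjM x y : adjoined x -> adjoined y -> adjoined (x * y)
| adjV x : adjoined x -> adjoined x^-1.

Lemma adjoined0 : adjoined 0.
Proof. by rewrite -(rmorph0 f); apply: adj_base. Qed.
Lemma adjoined1 : adjoined 1.
Proof. by rewrite -(rmorph1 f); apply: adj_base. Qed.

Lemma adjoined_sigma x : adjoined x -> adjoined (sigma x).
Proof.
elim=> {x} [x|m|m y ya|x y _ ? _ ?|x y _ ? _ ?|x _ ?].
- by rewrite -vde_sigma; apply: adj_base.
- exact: (adj_iter m.+1).
- case: m ya => [/= ->|m ya]; first exact: (adj_iter 1).
  by apply: (@adj_iterV m); rewrite -iterSr.
- by rewrite rmorphB; apply: adjB.
- by rewrite rmorphM; apply: adjM.
- by rewrite fmorphV; apply: adjV.
Qed.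

Lemma adjoined_sigmaV x : adjoined x -> exists2 y, adjoined y & sigma y = x.
Proof.
have [tau tauK sigK] := vdf_sigma_bij L.
elim=> {x} [x|m|m y ya|x y _ [x' ? <-] _ [y' ? <-]|x y _ [x' ? <-] _ [y' ? <-]
  |x _ [x' ? <-]].
- have [tau' _ sigK'] := vdf_sigma_bij K.
  by exists (f (tau' x)); [apply: adj_base | rewrite -vde_sigma sigK'].
- case: m => [|m]; last by exists (iter m sigma a); [apply: adj_iter|].
  by exists (tau a); [apply: (@adj_iterV 1); apply: sigK | apply: sigK].
- by exists (tau y); [apply: (@adj_iterV m.+1); rewrite iterSr sigK|].
- by exists (x' - y'); [apply: adjB | rewrite rmorphB].
- by exists (x' * y'); [apply: adjM | rewrite rmorphM].
- by exists x'^-1; [apply: adjV | rewrite fmorphV].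
Qed.

Definition adj_field_pred : {pred L} := fun x => `[< adjoined x >].
Definition adj_group_pred : {pred vf_group L} :=
  fun g => `[< exists2 x, adjoined x & vval x = Some g >].
Definition adj_residue_pred : {pred vf_residue L} :=
  fun c => `[< exists2 x, adjoined x & in_valring x /\ vres x = c >].

Lemma adj_fieldP x : reflect (adjoined x) (x \in adj_field_pred).
Proof. exact: asboolP. Qed.
Lemma adj_groupP g :
  reflect (exists2 x, adjoined x & vval x = Some g) (g \in adj_group_pred).
Proof. exact: asboolP. Qed.
Lemma adj_residueP c :
  reflect (exists2 x, adjoined x & in_valring x /\ vres x = c)
          (c \in adj_residue_pred).
Proof. exact: asboolP. Qed.

Lemma adj_field_closed : GRing.divring_closed adj_field_pred.
Proof.
split=> [|x y /adj_fieldP ax /adj_fieldP ay|x y /adj_fieldP ax /adj_fieldP ay];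
  apply/adj_fieldP; [exact: adjoined1 | exact: adjB |].
by apply: adjM => //; apply: adjV.
Qed.

Lemma adj_group_closed : zmod_closed adj_group_pred.
Proof.
split=> [|g h /adj_groupP[x ax vx] /adj_groupP[y ay vy]]; apply/adj_groupP.
  by exists 1; [exact: adjoined1 | rewrite val1].
exists (x / y); first by apply: adjM => //; apply: adjV.
by rewrite vf_valM valV vx vy.
Qed.

Lemma adj_residue_closed : GRing.divring_closed adj_residue_pred.
Proof.
split=> [|_ _ /adj_residueP[x ax [Ox <-]] /adj_residueP[y ay [Oy <-]]|
         _ _ /adj_residueP[x ax [Ox <-]] /adj_residueP[y ay [Oy <-]]];
  apply/adj_residueP.
- by exists 1; [exact: adjoined1 | rewrite valring1 vf_res1].
- exists (x - y); first exact: adjB.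
  have ONy : in_valring (- y) by rewrite valringN.
  by split; [exact: valringD | rewrite vf_resD // resN].
have [ry0|/eqP ry0] := eqVneq (vres y) 0.
  exists 0; first exact: adjoined0.
  by rewrite valring0 res0 ry0 invr0 mulr0.
have [OV rV] := resV Oy ry0.
exists (x / y); first by apply: adjM => //; apply: adjV.
by split; [exact: valringM | rewrite vf_resM // rV].
Qed.

HB.instance Definition _ :=
  GRing.isDivringClosed.Build L adj_field_pred adj_field_closed.
HB.instance Definition _ :=
  GRing.isZmodClosed.Build (vf_group L) adj_group_pred adj_group_closed.
HB.instance Definition _ :=
  GRing.isDivringClosed.Build (vf_residue L) adj_residue_pred
    adj_residue_closed.

Record adj_field := AdjField {
  adj_field_val : L; _ : adj_field_val \in adj_field_pred }.
HB.instance Definition _ := [isSub for adj_field_val].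
HB.instance Definition _ := [Choice of adj_field by <:].
HB.instance Definition _ := [SubChoice_isSubIntegralDomain of adj_field by <:].
HB.instance Definition _ := [SubIntegralDomain_isSubField of adj_field by <:].

Record adj_group := AdjGroup {
  adj_group_val : vf_group L; _ : adj_group_val \in adj_group_pred }.
HB.instance Definition _ := [isSub for adj_group_val].
HB.instance Definition _ := [Choice of adj_group by <:].
HB.instance Definition _ := [SubChoice_isSubZmodule of adj_group by <:].
HB.instance Definition _ :=
  [SubChoice_isSubPOrder of adj_group by <: with ring_display].

Lemma adj_group_lerD2r (z x y : adj_group) : x <= y -> x + z <= y + z.
Proof. exact: oag_lerD2r. Qed.
Lemma adj_group_le_total : total (<=%R : rel adj_group).
Proof. by move=> x y; apply: oag_le_total. Qed.
HB.instance Definition _ :=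
  isOrderedAbGroup.Build adj_group adj_group_lerD2r adj_group_le_total.

Record adj_residue := AdjResidue {
  adj_residue_val : vf_residue L; _ : adj_residue_val \in adj_residue_pred }.
HB.instance Definition _ := [isSub for adj_residue_val].
HB.instance Definition _ := [Choice of adj_residue by <:].
HB.instance Definition _ :=
  [SubChoice_isSubIntegralDomain of adj_residue by <:].
HB.instance Definition _ :=
  [SubIntegralDomain_isSubField of adj_residue by <:].

Definition adj_val (x : adj_field) : option adj_group :=
  obind insub (vval (adj_field_val x)).
Definition adj_res (x : adj_field) : adj_residue :=
  insubd 0 (vres (adj_field_val x)).

Lemma adj_valE x : omap adj_group_val (adj_val x) = vval (adj_field_val x).
Proof.
case: x => x ax; rewrite /adj_val /=; case vx : (vval x) => [g|//] /=.
rewrite insubT /=; last by [].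
by apply/adj_groupP; exists x => //; apply/adj_fieldP.
Qed.

Lemma adj_group_inj : injective (omap adj_group_val).
Proof. by apply: inj_omap; apply: val_inj. Qed.

Lemma adj_eleE (x y : option adj_group) :
  ele x y = ele (omap adj_group_val x) (omap adj_group_val y).
Proof. by case: x y => [g|] [h|]. Qed.

Lemma adj_valringE x :
  ele (Some 0) (adj_val x) = in_valring (adj_field_val x).
Proof. by rewrite adj_eleE adj_valE. Qed.

Lemma adj_resE x : in_valring (adj_field_val x) ->
  adj_residue_val (adj_res x) = vres (adj_field_val x).
Proof.
case: x => x ax /= Ox; rewrite /adj_res /= insubdK //.
by apply/adj_residueP; exists x => //; apply/adj_fieldP.
Qed.

Lemma adj_val_eq0 x : adj_val x = None <-> x = 0.
Proof.
split=> [vx|->]; last by rewrite /adj_val /= val0.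
by apply: val_inj; apply/vf_val_eq0; rewrite -adj_valE vx.
Qed.

Lemma adj_valM x y : adj_val (x * y) = eadd (adj_val x) (adj_val y).
Proof.
apply: adj_group_inj; rewrite adj_valE vf_valM -!adj_valE.
by case: (adj_val x) (adj_val y) => [g|] [h|].
Qed.

Lemma adj_valD x y :
  ele (adj_val x) (adj_val y) -> ele (adj_val x) (adj_val (x + y)).
Proof. by rewrite !adj_eleE !adj_valE; apply: vf_valD. Qed.

Lemma adj_val_surj g : exists x, adj_val x = Some g.
Proof.
case: g => g ag; have /adj_groupP[x /adj_fieldP ax vx] := ag.
by exists (AdjField ax); apply: adj_group_inj; rewrite adj_valE.
Qed.

Lemma adj_res1 : adj_res 1 = 1.
Proof. by apply: val_inj; rewrite /= adj_resE ?valring1 // vf_res1. Qed.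

Lemma adj_resD x y : ele (Some 0) (adj_val x) -> ele (Some 0) (adj_val y) ->
  adj_res (x + y) = adj_res x + adj_res y.
Proof.
rewrite !adj_valringE => Ox Oy; apply: val_inj => /=.
by rewrite !adj_resE ?valringD //= vf_resD.
Qed.

Lemma adj_resM x y : ele (Some 0) (adj_val x) -> ele (Some 0) (adj_val y) ->
  adj_res (x * y) = adj_res x * adj_res y.
Proof.
rewrite !adj_valringE => Ox Oy; apply: val_inj => /=.
by rewrite !adj_resE ?valringM //= vf_resM.
Qed.

Lemma adj_res_eq0 x : ele (Some 0) (adj_val x) ->
  (adj_res x = 0 <-> elt (Some 0) (adj_val x)).
Proof.
rewrite adj_valringE => Ox; rewrite /elt adj_eleE adj_valE /=.
rewrite -[~~ _]/(elt (Some 0) _) -(vf_res_eq0 Ox) -(adj_resE Ox).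
by split=> [->|r0] //; apply: val_inj.
Qed.

Lemma adj_res_surj c :
  exists2 x, ele (Some 0) (adj_val x) & adj_res x = c.
Proof.
case: c => c ac; have /adj_residueP[x /adj_fieldP ax [Ox rx]] := ac.
exists (AdjField ax); first by rewrite adj_valringE.
by apply: val_inj; rewrite /= adj_resE.
Qed.

Definition adjoin_vf : valuedField :=
  ValuedField adj_val_eq0 adj_valM adj_valD adj_val_surj adj_res1 adj_resD
    adj_resM adj_res_eq0 adj_res_surj.

Lemma adj_sigma_subproof (x : adj_field) :
  sigma (adj_field_val x) \in adj_field_pred.
Proof. by apply/adj_fieldP/adjoined_sigma/adj_fieldP; case: x. Qed.
Definition adj_sigma (x : adj_field) : adj_field :=
  AdjField (adj_sigma_subproof x).

Lemma adj_sigma_is_zmod_morphism : zmod_morphism adj_sigma.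
Proof. by move=> x y; apply: val_inj; rewrite /= rmorphB. Qed.
Lemma adj_sigma_is_monoid_morphism : monoid_morphism adj_sigma.
Proof.
by split=> [|x y]; apply: val_inj; rewrite /= ?rmorph1 ?rmorphM.
Qed.
HB.instance Definition _ := GRing.isZmodMorphism.Build adj_field adj_field
  adj_sigma adj_sigma_is_zmod_morphism.
HB.instance Definition _ := GRing.isMonoidMorphism.Build adj_field adj_field
  adj_sigma adj_sigma_is_monoid_morphism.

Definition adj_sigma_group (g : adj_group) : adj_group :=
  insubd 0 (@vdf_sigma_group L (adj_group_val g)).
Definition adj_sigma_residue (c : adj_residue) : adj_residue :=
  insubd 0 (@vdf_sigma_residue L (adj_residue_val c)).

Lemma adj_sigma_bij : bijective adj_sigma.
Proof.
have sigS (x : adj_field) : exists y, adj_sigma y = x.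
  case: x => x ax; have /adj_fieldP/adjoined_sigmaV[y /adj_fieldP ay syx] := ax.
  by exists (AdjField ay); apply: val_inj.
have [tau tauK] := boolp.choice sigS.
exists tau => // x; apply: val_inj; apply: (bij_inj (vdf_sigma_bij L)).
by have /(congr1 adj_field_val) := tauK (adj_sigma x).
Qed.

Lemma adj_sigma_valring (x : adjoin_vf) :
  in_valring (adj_sigma x : adjoin_vf) = in_valring x.
Proof. by rewrite /in_valring !adj_valringE vdf_sigma_valring. Qed.

Lemma adj_sigma_val (x : adjoin_vf) :
  vval (adj_sigma x : adjoin_vf) = omap adj_sigma_group (vval x).
Proof.
apply: adj_group_inj; rewrite [LHS]adj_valE vdf_sigma_val -adj_valE /=.
case E : (adj_val x) => [g|] //=; rewrite insubdK //.
apply/adj_groupP; exists (adj_field_val (adj_sigma x)).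
  by apply/adj_fieldP; case: (adj_sigma x).
by rewrite /= vdf_sigma_val -adj_valE E.
Qed.

Lemma adj_sigma_res (x : adjoin_vf) : in_valring x ->
  vres (adj_sigma x : adjoin_vf) = adj_sigma_residue (vres x).
Proof.
rewrite /in_valring adj_valringE => Ox; apply: val_inj => /=.
have OSx : in_valring (adj_field_val (adj_sigma x)).
  by rewrite /= vdf_sigma_valring.
rewrite [LHS](adj_resE OSx) /= vdf_sigma_res // insubdK adj_resE //.
apply/adj_residueP; exists (adj_field_val (adj_sigma x)).
  by apply/adj_fieldP; case: (adj_sigma x).
by rewrite /= vdf_sigma_valring vdf_sigma_res.
Qed.

Definition adjoin : vdField :=
  @VdField adjoin_vf adj_sigma adj_sigma_group adj_sigma_residue
    adj_sigma_bij adj_sigma_valring adj_sigma_val adj_sigma_res.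

(* The inclusion of [K<a>] in [L]. *)
Lemma adj_incl_group_mono :
  {mono (\val : adj_group -> vf_group L) : g h / g <= h}.
Proof. by []. Qed.
Lemma adj_incl_val (x : adjoin) :
  vval (adj_field_val x) = omap adj_group_val (vval x).
Proof. by rewrite [RHS]adj_valE. Qed.
Lemma adj_incl_res (x : adjoin) : in_valring x ->
  vres (adj_field_val x) = adj_residue_val (vres x).
Proof. by rewrite /in_valring adj_valringE => Ox; rewrite [RHS]adj_resE. Qed.
Lemma adj_incl_sigma (x : adjoin) :
  adj_field_val (sigma x) = sigma (adj_field_val x).
Proof. by []. Qed.

Definition adjoin_incl : vdf_embedding adjoin L :=
  @VdfEmbedding adjoin L
    (@VfEmbedding adjoin L (\val : adj_field -> L)
       (\val : adj_group -> vf_group L) (\val : adj_residue -> vf_residue L)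
       adj_incl_group_mono adj_incl_val adj_incl_res)
    adj_incl_sigma.
End Adjoin.

(* [K<a>] embeds in [M] over [K], for [a] in the extension [f : K -> L] of [K]
   and for the extension [g : K -> M]. *)
Definition adjoin_embeds_over (K L M : vdField) (f : vdf_embedding K L) (a : L)
    (g : vdf_embedding K M) : Prop :=
  let i := adjoin_incl f a in
  exists e : vdf_embedding (adjoin f a) M,
    [/\ forall x y, i y = f x -> e y = g x,
        forall x y, emb_group i y = emb_group f x ->
                    emb_group e y = emb_group g x
      & forall x y, emb_residue i y = emb_residue f x ->
                    emb_residue e y = emb_residue g x].

(* Main.v *)
(* Let E be a valued difference field between K and K', embedded in K1, and let
   b be in K' but not in E. Since K' is immediate, the balls v(x - c) >= v(b - c),
   c in E, have no smallest one. A sigma-polynomial Q over E is stable if its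
   constant Taylor term dominates on one of these balls; then v(Q) is the same at
   all the points, of K' or of K1, lying in every ball. If all Q are stable, any
   point y of K1 in the image cut gives an embedding of E<b>.

   Otherwise let P be an unstable polynomial of least complexity. Its Taylor
   coefficients are stable, and on small balls the linear Taylor terms dominate
   the higher ones because (P_(I))_(J) is a nonzero integer multiple of P_(I+J).
   Instability then says exactly that (P, x) is in sigma-hensel configuration,
   with gamma(P, x) beyond the cut, at each x in the cut. This gives roots of P
   in the cut of K' and in that of K1, and all lower polynomials take matching
   values at them. The image cut is realized in K1 because Axiom 2 (through
   Dedekind's independence of the powers of sigma on the residue field) yields
   points e of E with v(P(e)) increasing along the cut, so that the pc-sequence
   is of sigma-algebraic type.

   The same argument in order 0, where no compatibility with sigma is needed,
   shows that an embedding extends uniquely to relative algebraic closures; this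
   replaces henselizations when extending the embedding from the elements
   sigma^i(x) below the order of P to E<x>. Zorn's lemma then embeds all of K'. *)

From Pilot Require Import Defs.
From HB Require Import structures.
From mathcomp Require Import all_boot all_order all_algebra.
From mathcomp Require Import boolp wochoice mpoly.
From mathcomp Require Import zify ring.

Set Implicit Arguments.
Unset Strict Implicit.
Unset Printing Implicit Defensive.

Import Order.TTheory GRing.Theory Num.Theory.
Local Open Scope ring_scope.

(** * Ordered abelian groups and their extension by infinity *)

(** Immediacy forces all embeddings over the base to induce one and the same map [h] of value
    groups. So [h] is fixed beforehand, and a partial embedding is a subfield of [M * L] on which
    values correspond under [h]; no residue map has to be carried along. The element adjoined at an
    algebraic step is in general not the given [b] but a root, in the same cut, of the polynomial of
    least complexity; [b] is reached only through maximality. Uniqueness of such a root is obtained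
    only in order 0, where there is a single linear Taylor term; in higher order the linear terms
    may cancel, which is also why Axiom 2 is needed to find points where they do not. Hence
    compatibility with sigma cannot be read off from the root and has to come from uniqueness in
    order 0, over a subfield that sigma need not preserve. This is why the base of a cut is a bare
    field with only finitely many operators on it. *)

Section OrderedGroup.
Variable G : oagType.
Implicit Types a b c d z : G.

Lemma oag_leD2r z a b : (a + z <= b + z) = (a <= b).
Proof.
apply/idP/idP => [|/oag_lerD2r//].
by move/(oag_lerD2r (- z) _ _); rewrite !addrK.
Qed.

Lemma oag_leD2l z a b : (z + a <= z + b) = (a <= b).
Proof. by rewrite ![z + _]addrC oag_leD2r. Qed.

Lemma oag_leD a b c d : a <= b -> c <= d -> a + c <= b + d.
Proof.
move=> ab cd; apply: (@le_trans _ _ (b + c)); first by rewrite oag_leD2r.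
by rewrite oag_leD2l.
Qed.

Lemma oag_ltNge a b : (a < b) = ~~ (b <= a).
Proof.
rewrite lt_neqAle; have /orP[ab|ba] := oag_le_total a b.
  rewrite ab andbT; congr (~~ _); apply/eqP/idP => [->//|ba].
  by apply: le_anti; rewrite ab.
by rewrite ba /=; apply/negP => /andP[/eqP nab ab]; apply: nab; apply: le_anti;
   rewrite ab.
Qed.

Lemma oag_ltD2r z a b : (a + z < b + z) = (a < b).
Proof. by rewrite !oag_ltNge oag_leD2r. Qed.

Lemma oag_ltD2l z a b : (z + a < z + b) = (a < b).
Proof. by rewrite !oag_ltNge oag_leD2l. Qed.

Lemma oag_leMn a b m : a <= b -> a *+ m <= b *+ m.
Proof.
by move=> ab; elim: m => [|m IH]; rewrite ?mulr0n // !mulrS oag_leD.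
Qed.

Lemma oag_leB a b : (a <= b) = (0 <= b - a).
Proof. by rewrite -(oag_leD2r (- a)) subrr. Qed.

End OrderedGroup.

Section ExtendedGroup.
Variable G : oagType.
Implicit Types (x y z : option G) (a b g : G).

Lemma elt_Some a b : elt (Some a) (Some b) = (a < b).
Proof. by rewrite /elt /= oag_ltNge. Qed.

Lemma eleNlt x y : ele x y = ~~ elt y x. Proof. by rewrite /elt negbK. Qed.

Lemma ele_refl x : ele x x. Proof. by case: x => [a|] /=. Qed.

Lemma elt_irr x : elt x x = false. Proof. by rewrite /elt ele_refl. Qed.

Lemma eltW x y : elt x y -> ele x y.
Proof. by rewrite /elt => nyx; have := ele_total x y; rewrite (negbTE nyx) orbF. Qed.

Lemma ele_anti x y : ele x y -> ele y x -> x = y.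
Proof. by case: x y => [a|] [b|] //= ab ba; congr Some; apply: le_anti; rewrite ab. Qed.

Lemma ele_elt_trans y x z : ele x y -> elt y z -> elt x z.
Proof. by rewrite /elt => xy; apply: contra => zx; apply: ele_trans zx xy. Qed.

Lemma elt_ele_trans y x z : elt x y -> ele y z -> elt x z.
Proof. by rewrite /elt => xy yz; apply: contra xy; apply: ele_trans yz. Qed.

Lemma elt_None x y : elt x y -> exists a, x = Some a.
Proof. by case: x => [a|]; [exists a | case: y]. Qed.

Lemma eaddC x y : eadd x y = eadd y x.
Proof. by case: x y => [a|] [b|] //=; rewrite addrC. Qed.

Lemma eaddA x y z : eadd x (eadd y z) = eadd (eadd x y) z.
Proof. by case: x y z => [a|] [b|] [c|] //=; rewrite addrA. Qed.

Lemma eadd0 x : eadd x (Some 0) = x.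
Proof. by case: x => [a|] //=; rewrite addr0. Qed.

Lemma ele_add x y x' y' : ele x y -> ele x' y' -> ele (eadd x x') (eadd y y').
Proof. by case: x y x' y' => [a|] [b|] [c|] [d|] //=; apply: oag_leD. Qed.

Lemma ele_addS g x y : ele (eadd x (Some g)) (eadd y (Some g)) = ele x y.
Proof. by case: x y => [a|] [b|] //=; rewrite oag_leD2r. Qed.

Lemma elt_addS g x y : elt (eadd x (Some g)) (eadd y (Some g)) = elt x y.
Proof. by rewrite /elt ele_addS. Qed.

Lemma ele_addl x a b : a <= b -> ele (eadd x (Some a)) (eadd x (Some b)).
Proof. by move=> ab; apply: ele_add => //; apply: ele_refl. Qed.

Lemma elt_addl x a b : x <> None -> a < b ->
  elt (eadd x (Some a)) (eadd x (Some b)).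
Proof. by case: x => [c|] // _ ab /=; rewrite elt_Some oag_ltD2l. Qed.

Lemma elt_add x y x' y' : elt x y -> ele x' y' -> x' <> None ->
  elt (eadd x x') (eadd y y').
Proof.
case: x' => [c|] // xy cy' _; apply: (@elt_ele_trans (eadd y (Some c))).
  by rewrite elt_addS.
by apply: ele_add => //; apply: ele_refl.
Qed.

End ExtendedGroup.

Section OptionMap.
Variables (G H : oagType) (h : G -> H).
Hypothesis h_mono : {mono h : a b / a <= b}.

Lemma omap_ele x y : ele (omap h x) (omap h y) = ele x y.
Proof. by case: x y => [a|] [b|] //=. Qed.

Lemma omap_elt x y : elt (omap h x) (omap h y) = elt x y.
Proof. by rewrite /elt omap_ele. Qed.

Lemma oag_mono_inj : injective h.
Proof. by move=> a b ab; apply: le_anti; rewrite -!h_mono ab lexx. Qed.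

Lemma oag_mono_lt a b : (h a < h b) = (a < b).
Proof. by rewrite !oag_ltNge h_mono. Qed.

End OptionMap.

(** * Valuations *)

Section Valuation.
Variable K : valuedField.
Implicit Types (x y : K) (b : option (vf_group K)).

Lemma valDge b x y : ele b (vval x) -> ele b (vval y) -> ele b (vval (x + y)).
Proof.
move=> bx b_y; have /orP[xy|yx] := ele_total (vval x) (vval y).
  exact: ele_trans bx (vf_valD xy).
by rewrite addrC; apply: ele_trans b_y (vf_valD yx).
Qed.

Lemma valDgt b x y : elt b (vval x) -> elt b (vval y) -> elt b (vval (x + y)).
Proof.
move=> bx b_y; have /orP[xy|yx] := ele_total (vval x) (vval y).
  exact: elt_ele_trans bx (vf_valD xy).
by rewrite addrC; apply: elt_ele_trans b_y (vf_valD yx).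
Qed.

Lemma valBC x y : vval (x - y) = vval (y - x).
Proof. by rewrite -valN opprB. Qed.

Lemma valBge b x y : ele b (vval x) -> ele b (vval y) -> ele b (vval (x - y)).
Proof. by move=> bx b_y; apply: valDge => //; rewrite valN. Qed.

Lemma valBgt b x y : elt b (vval x) -> elt b (vval y) -> elt b (vval (x - y)).
Proof. by move=> bx b_y; apply: valDgt => //; rewrite valN. Qed.

Lemma valD_lt x y : elt (vval x) (vval y) -> vval (x + y) = vval x.
Proof.
move=> xy; apply: ele_anti; last exact: vf_valD (eltW xy).
rewrite eleNlt; apply/negP => lt.
have: elt (vval x) (vval x).
  by rewrite -{2}(addrK y x); apply: valBgt.
by rewrite elt_irr.
Qed.

Lemma valB_lt x y : elt (vval x) (vval (x - y)) -> vval y = vval x.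
Proof.
by move=> lt; rewrite -[y](subKr x) valD_lt ?valN.
Qed.

Lemma val_sum_ge (I : eqType) (r : seq I) (P : pred I) (F : I -> K) b :
  (forall i, i \in r -> P i -> ele b (vval (F i))) ->
  ele b (vval (\sum_(i <- r | P i) F i)).
Proof.
move=> bF; rewrite big_seq_cond; apply: (big_ind (fun z => ele b (vval z))).
- by rewrite val0; case: b {bF}.
- by move=> x y; apply: valDge.
- by move=> i /andP[ri Pi]; apply: bF.
Qed.

Lemma val_sum_gt (I : eqType) (r : seq I) (P : pred I) (F : I -> K) b :
  b <> None -> (forall i, i \in r -> P i -> elt b (vval (F i))) ->
  elt b (vval (\sum_(i <- r | P i) F i)).
Proof.
move=> b_fin bF; rewrite big_seq_cond; apply: (big_ind (fun z => elt b (vval z))).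
- by rewrite val0; case: b b_fin {bF}.
- by move=> x y; apply: valDgt.
- by move=> i /andP[ri Pi]; apply: bF.
Qed.

Lemma valX_ge x g m : ele (Some g) (vval x) -> ele (Some (g *+ m)) (vval (x ^+ m)).
Proof.
move=> vx; elim: m => [|m IH]; first by rewrite expr0 Defs.val1 mulr0n ele_refl.
by rewrite exprS vf_valM mulrS -[Some _]/(eadd (Some g) (Some _)) ele_add.
Qed.

Lemma val_fin x : x != 0 -> exists g, vval x = Some g.
Proof. by move/eqP/val_neq0. Qed.

Lemma val_neq0_Some x g : vval x = Some g -> x != 0.
Proof. by move=> vx; apply/eqP => x0; rewrite x0 val0 in vx. Qed.

Lemma val_res_neq0 x : in_valring x -> vres x <> 0 -> vval x = Some 0.
Proof.
move=> Ox rx; have : ~ elt (Some 0) (vval x) by move/(vf_res_eq0 Ox).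
by rewrite /elt => /negP; rewrite negbK => le; apply: ele_anti.
Qed.

Lemma val_div_ge x y : y != 0 -> ele (vval y) (vval x) -> in_valring (x / y).
Proof.
move=> /val_fin[g vy]; rewrite /in_valring vf_valM valV vy.
by case: (vval x) => //= a; rewrite -oag_leB.
Qed.

(** Positive integers have nonzero residue; the binomial factors of iterated Taylor coefficients
    therefore leave values unchanged. *)
Lemma val_natr m : [pchar (vf_residue K)] =i pred0 -> (0 < m)%N ->
  vval (m%:R : K) = Some 0.
Proof.
move=> pchar0 m_gt0; have O_nat k : in_valring (k%:R : K) /\ vres (k%:R : K) = k%:R.
  elim: k => [|k [Ok rk]]; first by rewrite valring0 res0.
  rewrite !mulrS; split; first by apply: valringD => //; apply: valring1.
  by rewrite vf_resD ?vf_res1 ?rk //; apply: valring1.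
have [Om rm] := O_nat m.
apply: val_res_neq0 => //.
by rewrite rm => /eqP; rewrite (pcharf0P _).1 // eqn0Ngt m_gt0.
Qed.

End Valuation.

(** * The action of sigma on values *)

Section SigmaAction.
Variable K : vdField.
Implicit Types (x y z : K) (a b g : vf_group K).

(** The order is recovered from the valuation ring: if [x], [y] have values [a], [b], then [a <= b]
    means that [y / x] lies in the ring. *)
Lemma sigma_group_mono : {mono @vdf_sigma_group K : a b / a <= b}.
Proof.
move=> a b; have [x vx] := vf_val_surj a; have [y vy] := vf_val_surj b.
have x0 : x != 0 := val_neq0_Some vx.
have: in_valring (sigma (y / x)) = in_valring (y / x) by apply: vdf_sigma_valring.
rewrite rmorphM fmorphV /in_valring !vf_valM !valV !vdf_sigma_val vx vy /=.
by rewrite -!oag_leB.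
Qed.

Lemma sigma_groupD : {morph @vdf_sigma_group K : a b / a + b}.
Proof.
move=> a b; have [x vx] := vf_val_surj a; have [y vy] := vf_val_surj b.
have := vdf_sigma_val (x * y).
by rewrite rmorphM !vf_valM !vdf_sigma_val vx vy /= => -[->].
Qed.

Lemma sigma_group_surj g : exists a, @vdf_sigma_group K a = g.
Proof.
have [tau tauK sigK] := vdf_sigma_bij K; have [x vx] := vf_val_surj g.
have := vdf_sigma_val (tau x); rewrite sigK vx.
by case: (vval (tau x)) => //= a [->]; exists a.
Qed.

Lemma rho_powS i g : rho_pow i.+1 g = vdf_sigma_group (rho_pow i g).
Proof. by []. Qed.

Lemma rho_pow_mono i : {mono @rho_pow K i : a b / a <= b}.
Proof.
by elim: i => // i IH a b; rewrite !rho_powS sigma_group_mono IH.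
Qed.

Lemma rho_pow_lt i a b : (rho_pow i a < rho_pow i b) = (a < b).
Proof. by rewrite !oag_ltNge rho_pow_mono. Qed.

Lemma rho_pow_surj i g : exists a, rho_pow i a = g.
Proof.
elim: i g => [|i IH] g; first by exists g.
have [a <-] := sigma_group_surj g; have [b <-] := IH a; by exists b.
Qed.

Lemma val_iter_sigma i x : vval (iter i sigma x) = omap (@rho_pow K i) (vval x).
Proof.
elim: i => [|i IH]; first by case: (vval x).
by rewrite iterS vdf_sigma_val IH; case: (vval x).
Qed.

Lemma iter_sigmaD i : {morph iter i (@vdf_sigma K) : x y / x + y}.
Proof. by elim: i => // i IH x y; rewrite !iterS IH rmorphD. Qed.
Lemma iter_sigmaB i : {morph iter i (@vdf_sigma K) : x y / x - y}.
Proof. by elim: i => // i IH x y; rewrite !iterS IH rmorphB. Qed.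
Lemma iter_sigmaM i : {morph iter i (@vdf_sigma K) : x y / x * y}.
Proof. by elim: i => // i IH x y; rewrite !iterS IH rmorphM. Qed.

Lemma mnm_rhoD n (I J : 'X_{1..n.+1}) g :
  mnm_rho (I + J)%MM g = mnm_rho I g + mnm_rho J g.
Proof.
rewrite /mnm_rho -big_split /=; apply: eq_bigr => j _.
by rewrite mnmDE mulrnDr.
Qed.

Lemma mnm_rhoU n (i : 'I_n.+1) g : mnm_rho U_(i)%MM g = rho_pow i g.
Proof.
rewrite /mnm_rho (bigD1 i) //= mnm1E eqxx mulr1n big1 ?addr0 // => j ji.
by rewrite mnm1E eq_sym (negbTE ji) mulr0n.
Qed.

Lemma mnm_rho_le n (I : 'X_{1..n.+1}) a b :
  a <= b -> mnm_rho I a <= mnm_rho I b.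
Proof.
move=> ab; rewrite /mnm_rho; elim/big_rec2: _ => // j x y _ xy.
by apply: oag_leD => //; apply: oag_leMn; rewrite rho_pow_mono.
Qed.

Lemma mnm_neq0 n (I : 'X_{1..n}) : I <> 0%MM -> exists i, (U_(i) <= I)%MM.
Proof.
move=> I0; have /existsP[i Ii] : [exists i, I i != 0%N].
  rewrite -negb_forall; apply/negP => /forallP I_eq0; apply: I0.
  by apply/mnmP => i; rewrite mnm0E; apply/eqP.
by exists i; rewrite lep1mP.
Qed.

Lemma val_monomial_ge n (I : 'X_{1..n.+1}) z g : ele (Some g) (vval z) ->
  ele (Some (mnm_rho I g)) (vval (\prod_(i < n.+1) iter i sigma z ^+ I i)).
Proof.
move=> vz; rewrite /mnm_rho; elim/big_rec2: _ => [|i x a _ vx].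
  by rewrite Defs.val1 ele_refl.
rewrite vf_valM -[Some _]/(eadd (Some _) (Some _)); apply: ele_add => //.
apply: valX_ge; rewrite val_iter_sigma.
by rewrite -[Some _]/(omap (@rho_pow K i) (Some g)) omap_ele //; apply: rho_pow_mono.
Qed.

End SigmaAction.

Lemma mnm_rho_morph (K L : vdField) (h : {additive vf_group K -> vf_group L}) :
  (forall g, h (vdf_sigma_group g) = vdf_sigma_group (h g)) ->
  forall n (I : 'X_{1..n.+1}) g, h (mnm_rho I g) = mnm_rho I (h g).
Proof.
move=> h_sigma n I g; rewrite /mnm_rho raddf_sum; apply: eq_bigr => j _.
rewrite raddfMn; congr (_ *+ _); elim: (nat_of_ord j) => // i IH.
by rewrite !rho_powS h_sigma IH.
Qed.

(** * The action of sigma on residues *)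

Section SigmaResidue.
Variable K : vdField.
Local Notation tau := (@vdf_sigma_residue K).
Implicit Types (c d r : vf_residue K).

Lemma vres_sum (m : nat) (F : 'I_m -> K) : (forall i, in_valring (F i)) ->
  in_valring (\sum_(i < m) F i) /\ vres (\sum_(i < m) F i) = \sum_(i < m) vres (F i).
Proof.
move=> OF; elim/big_rec2: _ => [|i y x _ [Ox rx]]; first by rewrite valring0 res0.
by split; [apply: valringD | rewrite vf_resD ?rx //; apply: OF].
Qed.

Lemma iter_sigma_res i (x : K) : in_valring x ->
  in_valring (iter i sigma x) /\ vres (iter i sigma x) = iter i tau (vres x).
Proof.
move=> Ox; elim: i => //= i [Oi ri]; split; first by rewrite vdf_sigma_valring.
by rewrite vdf_sigma_res // ri.
Qed.

Lemma iter_residueM i : {morph iter i tau : c d / c * d}.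
Proof.
move=> c d; have [x Ox <-] := vf_res_surj c; have [y Oy <-] := vf_res_surj d.
rewrite -vf_resM //; have [_ <-] := iter_sigma_res i (valringM Ox Oy).
have [Oix rx] := iter_sigma_res i Ox; have [Oiy ry] := iter_sigma_res i Oy.
by rewrite iter_sigmaM vf_resM // rx ry.
Qed.

Lemma iter_residue1 i : iter i tau 1 = 1.
Proof.
have [_] := iter_sigma_res i (valring1 K); rewrite vf_res1 => <-.
by rewrite (_ : iter i sigma 1 = 1) ?vf_res1 //; elim: i => //= i ->; rewrite rmorph1.
Qed.

Lemma iter_residue0 i : iter i tau 0 = 0.
Proof.
have [_] := iter_sigma_res i (valring0 K); rewrite res0 => <-.
by rewrite (_ : iter i sigma 0 = 0) ?res0 //; elim: i => //= i ->; rewrite rmorph0.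
Qed.

Lemma iter_residue_inj i : injective (iter i tau).
Proof.
suff inj : injective tau by elim: i => //= i IH c d /inj /IH.
move=> c d; have [x Ox <-] := vf_res_surj c; have [y Oy <-] := vf_res_surj d.
have ONy : in_valring (- y) by rewrite valringN.
rewrite -!vdf_sigma_res // => e; have Oxy := valringD Ox ONy.
have OSy : in_valring (sigma y) by rewrite vdf_sigma_valring.
have : vres (sigma (x - y)) = 0.
  have OSx : in_valring (sigma x) by rewrite vdf_sigma_valring.
  have OSNy : in_valring (- sigma y) by rewrite valringN.
  by rewrite rmorphB (vf_resD OSx OSNy) resN // e subrr.
move/(vf_res_eq0 (etrans (vdf_sigma_valring _) Oxy)).
rewrite /elt => lt; apply/eqP; rewrite -subr_eq0 -resN // -vf_resD //; apply/eqP.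
apply/(vf_res_eq0 Oxy); apply: contra lt; rewrite vdf_sigma_val.
have s0 : vdf_sigma_group (0 : vf_group K) = 0.
  by apply: (addrI (vdf_sigma_group 0)); rewrite -sigma_groupD !addr0.
by case: (vval (x - y)) => //= g g0; rewrite -s0 sigma_group_mono.
Qed.

(* Dedekind's independence of the characters [tau^j], which are distinct by
   Axiom 2. *)
Lemma residue_independent (m : nat) (u : nat -> vf_residue K) : axiom2 K ->
  (forall r, \sum_(j < m) u j * iter j tau r = 0) -> forall j, (j < m)%N -> u j = 0.
Proof.
move=> ax2; elim: m u => [//|m IH] u u0.
have ltm j : (j < m)%N -> u j = 0.
  (* With [s] moved by [tau^(m - j)], subtracting [tau^m(s)] times the relation at [r] from the
     relation at [s * r] kills the last term and leaves a shorter relation, with coefficients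
     [u i * (tau^i(s) - tau^m(s))]. *)
  move=> jm; have [s sm] := ax2 (m - j)%N (etrans (subn_gt0 _ _) jm).
  have : u j * (iter j tau s - iter m tau s) = 0.
    apply: (IH (fun j => u j * (iter j tau s - iter m tau s))) jm => r; have := u0 (s * r); have := u0 r; rewrite !big_ord_recr /= => e1 e2.
    have : \sum_(i < m) u i * iter i tau (s * r) + u m * iter m tau (s * r)
       - iter m tau s * (\sum_(i < m) u i * iter i tau r + u m * iter m tau r) = 0.
      by rewrite e1 e2 mulr0 subr0.
    rewrite iter_residueM mulrDr opprD addrACA [X in _ + X](_ : _ = 0); last first.
      by rewrite mulrCA subrr.
    rewrite addr0 mulr_sumr -sumrB => e; rewrite -[RHS]e; apply: eq_bigr => i _.
    by rewrite iter_residueM mulrBr mulrBl mulrA mulrA [_ * u i]mulrC.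
  move/eqP; rewrite mulf_eq0 => /orP[/eqP //|].
  rewrite subr_eq0 -[in iter m](subnKC (ltnW jm)) iterD => /eqP /iter_residue_inj e.
  by case: sm.
move=> j; rewrite ltnS leq_eqVlt => /predU1P[->|/ltm //].
have := u0 1; rewrite big_ord_recr /= big1 ?add0r ?iter_residue1 ?mulr1 //.
by move=> i _; rewrite ltm // mul0r.
Qed.

End SigmaResidue.

(** * Taylor coefficients *)

Section Taylor.
Variable n : nat.
Implicit Types I J m : 'X_{1..n}.

Definition mbin m I : nat := (\prod_(i < n) 'C(m i, I i))%N.

Section Ring.
Variable R : comNzRingType.
Implicit Types F : {mpoly R[n]}.

Definition taylor_poly F : {mpoly {mpoly R[n]}[n]} :=
  mmap (fun c : R => (c%:MP_[n])%:MP_[n])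
       (fun i : 'I_n => ('X_i)%:MP_[n] + 'X_i) F.

Definition taylor F I : {mpoly R[n]} := (taylor_poly F)@_I.

Lemma taylor_polyX m I :
  (mmap1 (fun i : 'I_n => ('X_i : {mpoly R[n]})%:MP_[n] + 'X_i) m)@_I
  = (mbin m I)%:R *: 'X_[m - I].
Proof.
(* A common bound for the exponents of [m] and [I], so that all binomial expansions run over one
   index type and their product can be distributed. *)
pose B := (mdeg m + mdeg I).+1.
have deg_lt (J : 'X_{1..n}) (i : 'I_n) : (J i <= mdeg J)%N.
  by rewrite mdegE (bigD1 i) //= leq_addr.
rewrite /mmap1; under eq_bigr => i _.
  have -> : (('X_i : {mpoly R[n]})%:MP_[n] + 'X_i) ^+ m i =
     \sum_(j < B) ((('X_i : {mpoly R[n]})%:MP_[n]) ^+ (m i - j) * 'X_i ^+ j) *+ 'C(m i, j).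
    rewrite exprDn (big_ord_widen B (fun j => ((('X_i : {mpoly R[n]})%:MP_[n]) ^+ (m i - j)
       * 'X_i ^+ j) *+ 'C(m i, j))); last by rewrite ltnS (leq_trans (deg_lt m i)) ?leq_addr.
    rewrite big_mkcond; apply: eq_bigr => j _.
    by case: ltnP => // lt; rewrite bin_small.
  over.
rewrite bigA_distr_bigA /= raddf_sum /=.
pose mf (f : {ffun 'I_n -> 'I_B}) : 'X_{1..n} := [multinom (f i : nat) | i < n].
have termE (f : {ffun 'I_n -> 'I_B}) :
    (\prod_(i < n) ((('X_i : {mpoly R[n]})%:MP_[n]) ^+ (m i - f i) * 'X_i ^+ f i *+ 'C(m i, f i)))@_I
    = ((mbin m (mf f))%:R *: 'X_[m - mf f]) * (mf f == I)%:R.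
  under eq_bigr do rewrite -mulr_natl.
  rewrite !big_split /= -natr_prod.
  have -> : \prod_(i < n) ('X_i : {mpoly {mpoly R[n]}[n]}) ^+ f i = 'X_[mf f].
    by rewrite [RHS]mpolyXE_id; apply: eq_bigr => i _; rewrite mnmE.
  have -> : \prod_(i < n) (('X_i : {mpoly R[n]})%:MP_[n]) ^+ (m i - f i)
    = ('X_[m - mf f] : {mpoly R[n]})%:MP_[n].
    rewrite [in RHS]mpolyXE_id rmorph_prod; apply: eq_bigr => i _.
    by rewrite rmorphXn mnmBE mnmE.
  rewrite mulr_natl mcoeffMn mul_mpolyC mcoeffZ mcoeffX scaler_nat mulrnAl.
  by congr (_ *+ _); rewrite /mbin; apply: eq_bigr => i _; rewrite mnmE.
rewrite (eq_bigr _ (fun f _ => termE f)) /=.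
have ltI (i : 'I_n) : (I i < B)%N.
  by rewrite ltnS (leq_trans (deg_lt I i)) ?leq_addl.
rewrite (bigD1 [ffun i => Ordinal (ltI i)]) //= big1 ?addr0; last first.
  move=> f fI; rewrite (_ : (_ == _) = false) ?mulr0 //.
  apply/negP => /eqP eI; case/eqP: fI; apply/ffunP => i; rewrite ffunE.
  by apply: val_inj => /=; rewrite -eI mnmE.
have -> : mf [ffun i => Ordinal (ltI i)] = I.
  by apply/mnmP => i; rewrite mnmE ffunE.
by rewrite eqxx mulr1.
Qed.

Lemma mcoeff_taylor F I m :
  (taylor F I)@_m = F@_(m + I)%MM *+ mbin (m + I)%MM I.
Proof.
rewrite /taylor /taylor_poly /mmap raddf_sum raddf_sum /=.
have termE k :
    ((((F@_k)%:MP_[n])%:MP_[n] * mmap1 (fun i : 'I_n => ('X_i : {mpoly R[n]})%:MP_[n] + 'X_i) k)@_I)@_m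
    = F@_k *+ mbin k I * ((k - I)%MM == m)%:R.
  rewrite mcoeffCM taylor_polyX mcoeffCM mcoeffZ mcoeffX mulrA.
  by rewrite -[F@_k *+ _]mulr_natr.
rewrite (eq_bigr _ (fun k _ => termE k)) /=.
have zero k : k != (m + I)%MM -> F@_k *+ mbin k I * ((k - I)%MM == m)%:R = 0.
  move=> kmI; have [le|nle] := boolP (I <= k)%MM.
    rewrite (_ : (_ == _) = false) ?mulr0 //; apply/negP => /eqP em.
    by case/eqP: kmI; rewrite -em submK.
  (* If [I] is not below [k], the subtraction [(k - I)%MM] is truncated and may still equal [m]; but
     then one of the binomials vanishes. *)
  suff -> : mbin k I = 0%N by rewrite mulr0n mul0r.
  move: nle; rewrite negb_forall => /existsP[i]; rewrite -ltnNge => lt.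
  by rewrite /mbin (bigD1 i) //= bin_small.
have [mI|nmI] := boolP ((m + I)%MM \in msupp F).
  rewrite (bigD1_seq (m + I)%MM) ?msupp_uniq //= big1 ?addr0.
    by rewrite addmK eqxx mulr1.
  by move=> k /zero.
rewrite (memN_msupp_eq0 nmI) mul0rn big_seq big1 // => k kF.
by apply: zero; apply: contraNneq nmI => <-.
Qed.

Lemma msupp_taylor F I m : m \in msupp (taylor F I) -> (m + I)%MM \in msupp F.
Proof.
rewrite !mcoeff_msupp mcoeff_taylor; apply: contraNneq => ->.
by rewrite mul0rn.
Qed.

Lemma taylor_notin F I : I \notin msupp (taylor_poly F) -> taylor F I = 0.
Proof. by move=> /memN_msupp_eq0. Qed.

Lemma taylor0 F : taylor F 0%MM = F.
Proof.
apply/mpolyP => m; rewrite mcoeff_taylor addm0 (_ : mbin m 0 = 1%N) ?mulr1n //.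
by rewrite /mbin big1 // => i _; rewrite mnm0E bin0.
Qed.

Lemma meval_taylor F (x y : 'I_n -> R) :
  F.@[fun i => x i + y i]
  = \sum_(I <- msupp (taylor_poly F)) (taylor F I).@[x] * \prod_(i < n) y i ^+ I i.
Proof.
transitivity ((taylor_poly F).@[fun i => (y i)%:MP_[n]]).@[x]; last first.
  rewrite (mevalE _ (taylor_poly F)) raddf_sum; apply: eq_bigr => I _ /=.
  rewrite mevalM rmorph_prod; congr (_ * _); apply: eq_bigr => i _.
  by rewrite rmorphXn /= mevalC.
have -> : (taylor_poly F).@[fun i => (y i)%:MP_[n]]
    = \sum_(m <- msupp F) (F@_m)%:MP_[n] * \prod_(i < n) ('X_i + (y i)%:MP_[n]) ^+ m i.
  rewrite /taylor_poly /mmap raddf_sum; apply: eq_bigr => m _.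
  rewrite /= mevalM mevalC; congr (_ * _); rewrite /mmap1 rmorph_prod.
  by apply: eq_bigr => i _; rewrite rmorphXn /= mevalD mevalC mevalXU.
rewrite (mevalE _ F) raddf_sum; apply: eq_bigr => m _.
rewrite /= mevalM mevalC; congr (_ * _); rewrite rmorph_prod.
by apply: eq_bigr => i _; rewrite rmorphXn /= mevalD mevalC mevalXU.
Qed.

End Ring.

(* Otherwise unification unfolds [taylor] and becomes impracticably slow. *)
#[local] Opaque taylor.

Lemma mbin_gt0 m I : (I <= m)%MM -> (0 < mbin m I)%N.
Proof.
move=> /mnm_lepP le; rewrite /mbin; elim/big_ind: _ => //.
  by move=> x y; rewrite muln_gt0 => -> ->.
by move=> i _; rewrite bin_gt0.
Qed.

(** In each variable both sides equal the multinomial [(a + b + c)! / (a! b! c!)]. *)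
Lemma mbinD m I J :
  (mbin (m + J + I) I * mbin (m + J) J = mbin (I + J) I * mbin (m + (I + J)) (I + J))%N.
Proof.
rewrite /mbin -!big_split /=; apply: eq_bigr => i _; rewrite !mnmDE.
move: (m i) (I i) (J i) => a b c.
have fact_gt : (0 < b`! * c`! * a`!)%N by rewrite !muln_gt0 !fact_gt0.
apply/eqP; rewrite -(eqn_pmul2r fact_gt); apply/eqP.
have E1 : ('C(a + c + b, b) * (b`! * (a + c)`!) = (a + c + b)`!)%N.
  by rewrite -[(a + c)%N in X in (_ * (_ * X))%N](addnK b) bin_fact ?leq_addl.
have E2 : ('C(a + c, c) * (c`! * a`!) = (a + c)`!)%N.
  by rewrite -[a in X in (_ * (_ * X))%N](addnK c) bin_fact ?leq_addl.
have E3 : ('C(b + c, b) * (b`! * c`!) = (b + c)`!)%N.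
  by rewrite -[c in X in (_ * (_ * X))%N](addKn b) bin_fact ?leq_addr.
have E4 : ('C(a + (b + c), b + c) * ((b + c)`! * a`!) = (a + (b + c))`!)%N.
  by rewrite -[a in X in (_ * (_ * X))%N](addnK (b + c)%N) bin_fact ?leq_addl.
transitivity ((a + c + b)`!).
  by rewrite -E1 -E2; lia.
by rewrite -[in LHS]addnA [(c + b)%N]addnC -E4 -E3; lia.
Qed.

Lemma taylor_taylor (R : comNzRingType) (F : {mpoly R[n]}) I J :
  taylor (taylor F I) J = taylor F (I + J)%MM *+ mbin (I + J)%MM I.
Proof.
apply/mpolyP => m.
have h0 := mcoeffMn m (mbin (I + J)%MM I) (taylor F (I + J)%MM).
rewrite [RHS]h0.
have h1 := mcoeff_taylor (taylor F I) J m.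
have h2 := mcoeff_taylor F I (m + J)%MM.
have h3 := mcoeff_taylor F (I + J)%MM m.
rewrite [LHS]h1 h2.
rewrite h3.
have E : (m + J + I = m + (I + J))%MM by rewrite -addmA [(J + I)%MM]addmC.
have B := mbinD m I J.
rewrite E in B *.
by rewrite -[LHS]mulrnA -[RHS]mulrnA B mulnC.
Qed.

Lemma map_mpoly_taylor (R S : comNzRingType) (f : {rmorphism R -> S})
    (F : {mpoly R[n]}) I :
  taylor (map_mpoly f F) I = map_mpoly f (taylor F I).
Proof.
apply/mpolyP => m; have h1 := mcoeff_taylor (map_mpoly f F) I m.
have h2 := mcoeff_taylor F I m.
by rewrite h1 !mcoeff_map_mpoly h2 [RHS]raddfMn.
Qed.

Section CharZero.
Variable R : idomainType.
Hypothesis pchar0 : [pchar R] =i pred0.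
Implicit Types F : {mpoly R[n]}.

Lemma mcoeff_taylor_eq0 F I m : ((taylor F I)@_m == 0) = (F@_(m + I)%MM == 0).
Proof.
rewrite mcoeff_taylor -mulr_natr mulf_eq0 (pcharf0P _).1 //.
by rewrite [mbin _ _ == _]eqn0Ngt mbin_gt0 ?lem_addl // orbF.
Qed.

Lemma taylor_eq0 F I J : (I <= J)%MM -> taylor F I = 0 -> taylor F J = 0.
Proof.
move=> le FI; apply/mpolyP => m; rewrite mcoeff0; apply/eqP.
rewrite mcoeff_taylor_eq0 -(submK le) addmA -mcoeff_taylor_eq0.
by rewrite FI mcoeff0.
Qed.

Lemma taylor_const F : (forall i, taylor F U_(i)%MM = 0) -> F = (F@_0%MM)%:MP.
Proof.
move=> F0; apply/mpolyP => m; rewrite mcoeffC.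
have [->|/eqP/mnm_neq0[i le]] := eqVneq m 0%MM; first by rewrite mulr1.
rewrite mulr0 -(submK le); apply/eqP.
by rewrite -mcoeff_taylor_eq0 F0 mcoeff0.
Qed.

End CharZero.

(** This is the measure by which a Taylor coefficient is simpler than its polynomial: the degree in
    one given variable need not drop. *)
Lemma msize_taylor (R : comNzRingType) (F : {mpoly R[n]}) I :
  I <> 0%MM -> taylor F I <> 0 -> (msize (taylor F I) < msize F)%N.
Proof.
move=> I0 FI; have := mlead_supp (introN eqP FI); have := mlead_deg (introN eqP FI).
move=> <- /msupp_taylor /msize_mdeg_lt; rewrite mdegD; apply: leq_trans.
by rewrite ltnS -addn1 leq_add2l lt0n mdeg_eq0; apply/eqP.
Qed.

End Taylor.

Lemma sp_taylorE (K : vdField) n (F : {mpoly K[n.+1]}) I :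
  sp_taylor F I = taylor F I.
Proof. by []. Qed.

#[global] Opaque taylor.

(** * Taylor expansion of difference polynomials *)

Section TaylorValues.
Variables (K : vdField) (n : nat).
Implicit Types (F : {mpoly K[n.+1]}) (x z : K) (g : vf_group K).

Lemma sp_eval_taylor F x z :
  sp_eval F (x + z) = \sum_(I <- msupp (taylor_poly F))
    sp_eval (taylor F I) x * \prod_(i < n.+1) iter i sigma z ^+ I i.
Proof.
rewrite /sp_eval -meval_taylor; apply: meval_eq => i.
by rewrite iter_sigmaD.
Qed.

Lemma sp_eval0 x : sp_eval (0 : {mpoly K[n.+1]}) x = 0.
Proof. exact: meval0. Qed.

Lemma sp_eval_taylor0 F x z :
  sp_eval F (x + z) - sp_eval F x =
    \sum_(I <- msupp (taylor_poly F) | I != 0%MM)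
      sp_eval (taylor F I) x * \prod_(i < n.+1) iter i sigma z ^+ I i.
Proof.
rewrite sp_eval_taylor (bigID (pred1 0%MM)) /= [X in X + _ - _](_ : _ = sp_eval F x).
  by rewrite addrAC subrr add0r.
have [in0|nin0] := boolP (0%MM \in msupp (taylor_poly F)).
  rewrite -big_filter filter_pred1_uniq ?msupp_uniq // big_seq1 taylor0.
  by rewrite big1 ?mulr1 // => i _; rewrite mnm0E expr0.
rewrite -[in RHS](taylor0 F) (taylor_notin nin0) sp_eval0 big_seq_cond big1 //.
by move=> I /andP[inI /eqP I0]; rewrite I0 (negbTE nin0) in inI.
Qed.

Lemma val_taylor_ge F x z g b : ele (Some g) (vval z) ->
  (forall I, I <> 0%MM ->
     ele b (eadd (vval (sp_eval (taylor F I) x)) (Some (mnm_rho I g)))) ->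
  ele b (vval (sp_eval F (x + z) - sp_eval F x)).
Proof.
move=> vz le; rewrite sp_eval_taylor0; apply: val_sum_ge => I _ /eqP I0.
apply: ele_trans (le I I0) _; rewrite vf_valM; apply: ele_add.
  exact: ele_refl.
exact: val_monomial_ge.
Qed.

Lemma val_taylor_gt F x z g b : b <> None -> ele (Some g) (vval z) ->
  (forall I, I <> 0%MM ->
     elt b (eadd (vval (sp_eval (taylor F I) x)) (Some (mnm_rho I g)))) ->
  elt b (vval (sp_eval F (x + z) - sp_eval F x)).
Proof.
move=> b_fin vz lt; rewrite sp_eval_taylor0; apply: val_sum_gt => // I _ /eqP I0.
apply: elt_ele_trans (lt I I0) _; rewrite vf_valM; apply: ele_add.
  exact: ele_refl.
exact: val_monomial_ge.
Qed.

(** The linear part is kept as one sum because its terms may have equal values and cancel; only the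
    terms of degree at least two are estimated. *)
Lemma val_taylor_lin F x z g b : b <> None -> ele (Some g) (vval z) ->
  (forall I, (1 < mdeg I)%N ->
     elt b (eadd (vval (sp_eval (taylor F I) x)) (Some (mnm_rho I g)))) ->
  elt b (vval (sp_eval F (x + z) - sp_eval F x
    - \sum_(j < n.+1) sp_eval (taylor F U_(j)%MM) x * iter j sigma z)).
Proof.
move=> b_fin vz lt; rewrite sp_eval_taylor0.
rewrite (bigID (fun I => (1 < mdeg I)%N)) /=.
set S := (X in _ + X - _); set T := \sum_(j < n.+1) _.
have -> : S = T.
  rewrite /S /T.
  pose t (I : 'X_{1..n.+1}) := sp_eval (taylor F I) x * \prod_(i < n.+1) iter i sigma z ^+ I i.
  rewrite -[LHS]/(\sum_(I <- msupp (taylor_poly F) | (I != 0%MM) && ~~ (1 < mdeg I)%N) t I).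
  have tU (j : 'I_n.+1) : t U_(j)%MM = sp_eval (taylor F U_(j)%MM) x * iter j sigma z.
    rewrite /t (bigD1 j) //= mnm1E eqxx expr1 big1 ?mulr1 // => k kj.
    by rewrite mnm1E eq_sym (negbTE kj) expr0.
  under [RHS]eq_bigr do rewrite -tU.
  rewrite -(big_map (fun j : 'I_n.+1 => U_(j)%MM) predT t) /=.
  rewrite -big_filter.
  (* The degree-one monomials of the support are some of the [U_(j)]; the missing ones have
     coefficient zero, so both sums agree. *)
  pose s1 := [seq I <- msupp (taylor_poly F) | (I != 0%MM) && ~~ (1 < mdeg I)%N].
  pose s2 := [seq U_(j)%MM | j <- index_enum 'I_n.+1] : seq 'X_{1..n.+1}.
  have u2 : uniq s2.
    rewrite map_inj_uniq ?index_enum_uniq // => i j /eqP.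
    by rewrite eq_mnm1 => /eqP.
  rewrite -/s1 -/s2.
  have sub : {subset s1 <= s2}.
    move=> I; rewrite mem_filter -leqNgt => /andP[/andP[I0 I1] _].
    have /mdeg1P[i /eqP ->] : mdeg I == 1%N by rewrite eqn_leq I1 lt0n mdeg_eq0.
    by apply: map_f; rewrite mem_index_enum.
  rewrite [RHS](bigID (mem s1)) /= [X in _ + X]big1_seq ?addr0.
    rewrite -[RHS]big_filter; apply: perm_big; apply: uniq_perm.
    - by rewrite filter_uniq // msupp_uniq.
    - by rewrite filter_uniq.
    - move=> I; rewrite [RHS]mem_filter; apply/idP/andP => [i1|[] //].
      by split=> //; apply: sub.
  move=> I /andP[nI /mapP[j _ eI]].
  rewrite /t taylor_notin ?sp_eval0 ?mul0r //.
  apply: contra nI; rewrite mem_filter => ->.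
  by rewrite eI mdeg1 mnm1_eq0.
rewrite addrK; apply: val_sum_gt => // I _ /andP[_ I1].
apply: elt_ele_trans (lt I I1) _; rewrite vf_valM; apply: ele_add.
  exact: ele_refl.
exact: val_monomial_ge.
Qed.

(** On a cut the values of the Taylor coefficients of nonzero index are constants [v I], so the
    configuration can be checked on these constants instead of at [x]. *)
Lemma hensel_configI F x g (v : 'X_{1..n.+1} -> option (vf_group K)) :
  (forall I, I <> 0%MM -> vval (sp_eval (taylor F I) x) = v I) ->
  (forall c : K, F <> c%:MP) ->
  (exists i : 'I_n.+1, vval (sp_eval F x) = eadd (v U_(i)%MM) (Some (rho_pow i g))
     /\ forall j : 'I_n.+1, ele (eadd (v U_(i)%MM) (Some (rho_pow i g)))
                                (eadd (v U_(j)%MM) (Some (rho_pow j g)))) ->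
  (forall J L : 'X_{1..n.+1}, J <> 0%MM -> (J < L)%MM -> taylor F J <> 0 ->
     elt (eadd (v J) (Some (mnm_rho J g))) (eadd (v L) (Some (mnm_rho L g)))) ->
  hensel_config_at F x g.
Proof.
move=> vE F_nonconst lin dom.
have U0 (j : 'I_n.+1) : U_(j)%MM <> 0%MM :> 'X_{1..n.+1} by move/eqP; rewrite mnm1_eq0.
have {}vE I : I <> 0%MM -> v I = vval (sp_eval (sp_taylor F I) x).
  by move=> I0; rewrite sp_taylorE; apply/esym/vE.
split=> //.
  have [i [e le]] := lin; exists i; rewrite (vE _ (U0 i)) in e le; split=> // j.
  by have := le j; rewrite (vE _ (U0 j)).
move=> J L J0 JL; rewrite sp_taylorE => PJ; have := dom J L J0 JL PJ.
have L0 : L <> 0%MM.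
  move=> L0; apply: J0; move: JL; rewrite L0 => /andP[_ /mnm_lepP le].
  by apply/mnmP => i; have := le i; rewrite mnm0E leqn0 => /eqP.
by rewrite (vE _ J0) (vE _ L0).
Qed.

End TaylorValues.

Lemma meval_map (R S : comNzRingType) (f : {rmorphism R -> S}) n
    (Q : {mpoly R[n]}) (v : 'I_n -> R) :
  (map_mpoly f Q).@[fun i => f (v i)] = f Q.@[v].
Proof.
elim/mpolyind: Q => [|c m Q _ _ IH]; first by rewrite raddf0 !meval0 raddf0.
rewrite raddfD /= map_mpolyZ map_mpolyX !mevalD !mevalZ !mevalX rmorphD IH.
rewrite rmorphM rmorph_prod; congr (_ * _ + _).
by apply: eq_bigr => i _; rewrite rmorphXn.
Qed.

Lemma sp_eval_map (L : vdField) (E : fieldType) (p : {rmorphism E -> L}) n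
    (s : 'I_n.+1 -> E -> E) (Q : {mpoly E[n.+1]}) c :
  (forall i e, p (s i e) = iter i sigma (p e)) ->
  sp_eval (map_mpoly p Q) (p c) = p Q.@[s^~ c].
Proof.
move=> ps; rewrite -meval_map; apply: meval_eq => i.
by rewrite ps.
Qed.

(** * Degrees in one variable *)

Section SupportIn.
Variables (n : nat) (R : idomainType).
Implicit Types (F Q : {mpoly R[n]}) (m : 'X_{1..n}) (A B C : 'X_{1..n} -> Prop).

Definition supp_in A Q : Prop := forall m, m \in msupp Q -> A m.

Lemma supp_in0 A : supp_in A 0.
Proof. by move=> m; rewrite mcoeff_msupp mcoeff0 eqxx. Qed.

Lemma supp_inB A Q F : supp_in A Q -> supp_in A F -> supp_in A (Q - F).
Proof. by move=> QA FA m /msuppB_le; rewrite mem_cat => /orP[/QA|/FA]. Qed.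

Lemma supp_inD A Q F : supp_in A Q -> supp_in A F -> supp_in A (Q + F).
Proof. by move=> QA FA m /msuppD_le; rewrite mem_cat => /orP[/QA|/FA]. Qed.

Lemma supp_inX A m : A m -> supp_in A 'X_[m].
Proof. by move=> Am k /mem_msuppXP <-. Qed.

Lemma supp_inZX A (c : R) m : A m -> supp_in A (c *: 'X_[m]).
Proof. by move=> Am k /msuppZ_le /mem_msuppXP <-. Qed.

Lemma supp_inM A B C Q F : (forall m k, A m -> B k -> C (m + k)%MM) ->
  supp_in A Q -> supp_in B F -> supp_in C (Q * F).
Proof.
by move=> ABC QA FB m /msuppM_le /allpairsP[[m1 m2] /= [/QA ? /FB ? ->]]; apply: ABC.
Qed.

Lemma supp_in_sum A (r : seq 'X_{1..n}) (P : pred 'X_{1..n}) (f : 'X_{1..n} -> {mpoly R[n]}) :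
  (forall m, m \in r -> P m -> supp_in A (f m)) -> supp_in A (\sum_(m <- r | P m) f m).
Proof.
move=> fA; rewrite big_seq_cond; apply: (big_ind (supp_in A)).
- exact: supp_in0.
- exact: supp_inD.
- by move=> m /andP[]; apply: fA.
Qed.

Lemma supp_inW A B Q : (forall m, A m -> B m) -> supp_in A Q -> supp_in B Q.
Proof. by move=> AB QA m /QA /AB. Qed.

Variable k : 'I_n.

(** The coefficient of ['X_k ^+ e] when [Q] is read as a polynomial in ['X_k] over the other
    variables. *)
Definition xcoef Q (e : nat) : {mpoly R[n]} :=
  \sum_(m <- msupp Q | m k == e) Q@_m *: 'X_[m - U_(k) *+ e].

Lemma xcoef_supp A Q e : (forall m, A m -> A (m - U_(k) *+ (m k))%MM) ->
  supp_in A Q -> supp_in (fun m => m k = 0%N /\ A m) (xcoef Q e).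
Proof.
move=> Ak QA; apply: supp_in_sum => m /QA Am /eqP <-; apply: supp_inZX.
by split; [rewrite mnmBE mulmnE mnm1E eqxx mul1n subnn | apply: Ak].
Qed.

Lemma xcoefMX Q e :
  xcoef Q e * 'X_k ^+ e = \sum_(m <- msupp Q | m k == e) Q@_m *: 'X_[m].
Proof.
rewrite mulr_suml; apply: eq_bigr => m /eqP mk.
rewrite -scalerAl mpolyXn -mpolyXD submK //.
apply/mnm_lepP => i; rewrite mulmnE mnm1E.
by case: eqP => [<-|_]; rewrite ?mul1n ?mul0n // mk.
Qed.

Lemma xcoef_rem Q e : supp_in (fun m => m k <= e)%N Q ->
  supp_in (fun m => m k < e)%N (Q - xcoef Q e * 'X_k ^+ e).
Proof.
move=> Qe; rewrite xcoefMX {1}(mpolyE Q) (bigID (fun m : 'X_{1..n} => m k == e)) /=.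
rewrite addrAC subrr add0r; apply: supp_in_sum => m /Qe le ne; apply: supp_inZX.
by rewrite ltn_neqAle ne.
Qed.

Lemma xcoef_neq0 Q e m : m \in msupp Q -> m k = e -> xcoef Q e <> 0.
Proof.
move=> mQ mk Q0; have := xcoefMX Q e; rewrite Q0 mul0r => /esym/(congr1 (mcoeff m)).
rewrite mcoeff0 raddf_sum /= big_mkcond (bigD1_seq m) ?msupp_uniq //= mk eqxx.
rewrite big1 ?addr0 => [|i im]; last case: ifP => // _; rewrite mcoeffZ mcoeffX.
  by rewrite eqxx mulr1 => /eqP; apply/negP; rewrite -mcoeff_msupp.
by rewrite (negbTE im) mulr0.
Qed.

Lemma xcoef_sum Q N : supp_in (fun m => m k < N)%N Q ->
  Q = \sum_(e < N) xcoef Q e * 'X_k ^+ e.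
Proof.
move=> QN; rewrite [LHS](mpolyE Q).
under [RHS]eq_bigr do rewrite xcoefMX big_mkcond.
rewrite exchange_big /=; rewrite big_seq [RHS]big_seq; apply: eq_bigr => m mQ.
rewrite -big_mkcond (big_pred1 (Ordinal (QN m mQ))) //.
Qed.

End SupportIn.

Lemma ex_least (T : eqType) (r : rel T) x0 (s : seq T) : total r -> transitive r ->
  exists2 i, i \in x0 :: s & forall j, j \in x0 :: s -> r i j.
Proof.
move=> rT rtr; elim: s x0 => [|y s IH] x0.
  exists x0; rewrite ?mem_head // => j; rewrite inE => /eqP ->.
  by have := rT x0 x0; rewrite orbb.
have [i iys ile] := IH y; have /orP[x0i|ix0] := rT x0 i.
  exists x0; rewrite ?mem_head // => j; rewrite inE => /predU1P[->|/ile].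
    by have := rT x0 x0; rewrite orbb.
  exact: rtr.
exists i; first by rewrite inE iys orbT.
by move=> j; rewrite inE => /predU1P[->//|/ile].
Qed.

Lemma ex_least_ord n (r : rel 'I_n.+1) : total r -> transitive r ->
  exists i, forall j, r i j.
Proof.
move=> rT rtr; have [i _ ile] := ex_least ord0 (enum 'I_n.+1) rT rtr.
by exists i => j; apply: ile; rewrite inE mem_enum orbT.
Qed.

Lemma ex_least_nat (A : nat -> Prop) : (exists m, A m) ->
  exists m, A m /\ forall k, A k -> (m <= k)%N.
Proof.
move=> [m Am]; have ex : exists m, `[< A m >] by exists m; apply/asboolP.
case: (ex_minnP ex) => k /asboolP Ak kle; exists k; split=> // j Aj.
by apply: kle; apply/asboolP.
Qed.

(** * Difference polynomials on a cut *)

Section Cut.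
Variables (M : vdField) (E : fieldType) (p : {rmorphism E -> M}).
(** [s i] plays the role of sigma^i on [E]. For [n = 0] it can only be the identity, so [E] may then
    be a subfield that sigma does not preserve. *)
Variables (n : nat) (s : 'I_n.+1 -> E -> E).
Hypothesis p_sigma : forall i e, p (s i e) = iter i sigma (p e).
Hypothesis pchar_res : [pchar (vf_residue M)] =i pred0.
Variable b : M.
Hypothesis b_notin : forall e, b <> p e.
(** This amounts to [M] being an immediate extension of [E], valued through [p]. *)
Hypothesis p_dense : forall x : M, x <> 0 ->
  exists e, elt (vval x) (vval (x - p e)).
Implicit Types (Q : {mpoly E[n.+1]}) (c e : E) (I J : 'X_{1..n.+1}).

(* The cut of [b] over [E] is recorded by the function [c |-> v(b - c)]. *)
Definition cut_val c : vf_group M := odflt 0 (vval (b - p c)).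

Lemma cut_valE c : vval (b - p c) = Some (cut_val c).
Proof.
have [|g vg] := @val_neq0 _ (b - p c); last by rewrite /cut_val vg.
by move/eqP; rewrite subr_eq0 => /eqP; apply: b_notin.
Qed.

Lemma cut_val_nomax c : exists c', cut_val c < cut_val c'.
Proof.
have [|e lt] := @p_dense (b - p c).
  by apply/eqP; rewrite subr_eq0; apply/eqP.
exists (c + e); rewrite -elt_Some -!cut_valE.
by rewrite rmorphD opprD addrA.
Qed.

Lemma cut_val_le c c' : cut_val c <= cut_val c' ->
  ele (Some (cut_val c)) (vval (p c' - p c)).
Proof.
move=> le; rewrite (_ : _ - _ = (b - p c) - (b - p c')).
  by apply: valBge; rewrite cut_valE ?ele_refl.
by rewrite opprB [RHS]addrC addrA subrK.
Qed.

Lemma cut_val_lt c c' : cut_val c < cut_val c' ->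
  vval (p c' - p c) = Some (cut_val c).
Proof.
move=> lt; rewrite (_ : _ - _ = (b - p c) - (b - p c')).
  by rewrite valD_lt cut_valE // valN cut_valE elt_Some.
by rewrite opprB [RHS]addrC addrA subrK.
Qed.

Definition poly_val Q c : option (vf_group M) :=
  vval (sp_eval (map_mpoly p Q) (p c)).

(* On the ball [v(x - c) >= v(b - c)] the constant term of the Taylor expansion
   of [Q] at [c] dominates, so [v(Q(x))] is constant there, in any extension. *)
Definition stable_at Q c : Prop := forall I, I <> 0%MM ->
  elt (poly_val Q c) (eadd (poly_val (taylor Q I) c) (Some (mnm_rho I (cut_val c)))).

(* An extension of [E] in which the cut of [b] may be realized; only the
   operators listed in [s] are required to be compatible. *)
Record target := Target {
  tg_field :> vdField;
  tg_emb : {rmorphism E -> tg_field};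
  tg_group : {additive vf_group M -> vf_group tg_field};
  tg_mono : {mono tg_group : g h / g <= h};
  tg_sigma_group : forall g, tg_group (vdf_sigma_group g) = vdf_sigma_group (tg_group g);
  tg_sigma : forall i e, tg_emb (s i e) = iter i sigma (tg_emb e);
  tg_val : forall e, vval (tg_emb e) = omap tg_group (vval (p e))
}.

(** [M] is a target of itself, so that one statement about targets serves on both sides of the
    embedding. The definition is transparent because its projections are simplified away later. *)
Definition self_target : target.
Proof.
exists M p (idfun : {additive vf_group M -> vf_group M}) => // e.
by case: (vval _).
Defined.

Definition realizes (T : target) (x : T) : Prop :=
  forall c, vval (x - tg_emb T c) = Some (tg_group T (cut_val c)).

Lemma realizes_self : @realizes self_target b.
Proof. exact: cut_valE. Qed.

Section InTarget.
Variable T : target.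
Local Notation q := (tg_emb T).
Local Notation h := (tg_group T).

Lemma tg_poly_val Q c : vval (sp_eval (map_mpoly q Q) (q c)) = omap h (poly_val Q c).
Proof.
by rewrite /poly_val (sp_eval_map _ _ (@tg_sigma T)) tg_val (sp_eval_map _ _ p_sigma).
Qed.

Lemma omap_eadd x y : omap h (eadd x y) = eadd (omap h x) (omap h y).
Proof. by case: x y => [a|] [c|] //=; rewrite raddfD. Qed.

Lemma tg_mnm_rho I g : h (mnm_rho I g) = mnm_rho I (h g).
Proof. by apply: mnm_rho_morph; apply: tg_sigma_group. Qed.

Lemma stab_val Q c (x : T) : stable_at Q c ->
  ele (Some (h (cut_val c))) (vval (x - q c)) ->
  vval (sp_eval (map_mpoly q Q) x) = omap h (poly_val Q c).
Proof.
move=> Qc xc; rewrite -tg_poly_val -[x in LHS](subrK (q c)) addrC.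
set z := x - q c in xc *; set F := map_mpoly q Q.
rewrite -[sp_eval F (q c + z)](subrK (sp_eval F (q c))) addrC valD_lt //.
apply: (@val_taylor_gt _ _ _ _ _ (h (cut_val c))) => //.
  (* A strict inequality has a finite left-hand side, so stability at [c] includes that [Q] does not
     vanish there. *)
  have [g vg] := elt_None (Qc U_(ord0)%MM (negP (negbT (mnm1_eq0 ord0)) \o (introT eqP))).
  by rewrite tg_poly_val vg.
move=> I I0; rewrite tg_poly_val map_mpoly_taylor tg_poly_val -tg_mnm_rho.
rewrite -[Some (h _)]/(omap h (Some _)) -omap_eadd omap_elt; last exact: tg_mono.
exact: Qc.
Qed.

End InTarget.

Lemma self_stab_val Q c (x : M) : stable_at Q c ->
  ele (Some (cut_val c)) (vval (x - p c)) ->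
  vval (sp_eval (map_mpoly p Q) x) = poly_val Q c.
Proof.
by move=> Qc xc; rewrite (@stab_val self_target Q c x Qc xc); case: poly_val.
Qed.

Lemma pchar_E : [pchar E] =i pred0.
Proof.
apply/pcharf0P => m; apply/eqP/eqP => [m0|->]; last by rewrite mulr0n.
apply/eqP; rewrite eqn0Ngt; apply/negP => m_gt0.
have := val_natr pchar_res m_gt0.
by rewrite -(rmorph_nat p) m0 rmorph0 val0.
Qed.

Lemma poly_val_taylor2 Q I J c :
  poly_val (taylor (taylor Q I) J) c = poly_val (taylor Q (I + J)%MM) c.
Proof.
rewrite /poly_val taylor_taylor raddfMn /= /sp_eval mevalMn -mulr_natl vf_valM.
rewrite val_natr //; last by rewrite mbin_gt0 // lem_addr.
by rewrite eaddC eadd0.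
Qed.

(** Expand the coefficient of index [I] at [c'] around [c]: up to integer factors of value 0, its
    terms come from the coefficients of index [(I + J)%MM] of [Q], and stability at [c] bounds all
    of these. *)
Lemma stab_persist Q c c' : stable_at Q c -> cut_val c <= cut_val c' -> stable_at Q c'.
Proof.
move=> Qc le I I0; have cc' := cut_val_le le.
have -> : poly_val Q c' = poly_val Q c by apply: self_stab_val.
apply: elt_ele_trans (ele_addl _ (mnm_rho_le I le)).
have [g vg] := elt_None (Qc I I0); rewrite vg.
rewrite -[g](subrK (mnm_rho I (cut_val c))) -[Some (_ + _)]/(eadd (Some _) (Some _)).
rewrite elt_addS; set k := g - _.
have kS (x : option (vf_group M)) : elt (Some k) x = elt (Some g) (eadd x (Some (mnm_rho I (cut_val c)))).
  by case: x => [y|] //=; rewrite !elt_Some -(oag_ltD2r (mnm_rho I (cut_val c))) subrK.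
rewrite /poly_val; set F := map_mpoly p (taylor Q I).
rewrite -[p c'](subrK (p c)) addrC -[sp_eval F _](subrK (sp_eval F (p c))).
apply: valDgt; last by rewrite kS -vg; apply: Qc.
apply: (@val_taylor_gt _ _ _ _ _ (cut_val c)) => // J J0.
rewrite kS map_mpoly_taylor -/(poly_val _ _) poly_val_taylor2 -eaddA /= -vg [_ + mnm_rho I _]addrC -mnm_rhoD.
apply: Qc => /eqP; rewrite mnmD_eq0 => /andP[/eqP IJ _]; exact: I0.
Qed.

Lemma stab_const Q c : Q <> 0 -> (forall j : 'I_n.+1, taylor Q U_(j)%MM = 0) -> stable_at Q c.
Proof.
move=> Q0 QU I I0; have [j leI] := mnm_neq0 I0.
have -> : poly_val (taylor Q I) c = None.
  by rewrite /poly_val (taylor_eq0 pchar_E leI (QU j)) raddf0 sp_eval0 val0.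
have QC := taylor_const pchar_E QU.
rewrite /poly_val QC map_mpolyC /sp_eval mevalC.
have [|g -> //] := @val_neq0 _ (p Q@_0%MM).
move/eqP; rewrite fmorph_eq0 => /eqP Q00; apply: Q0.
by rewrite QC Q00 mpolyC0.
Qed.

(** * Taylor terms and roots of a nowhere stable polynomial *)

Section Unstable.
Variables (P : {mpoly E[n.+1]}) (c0 : E).
Hypothesis P_neq0 : P <> 0.
Hypothesis P_unstab : forall c, ~ stable_at P c.
Hypothesis P_taylor : forall I, I <> 0%MM -> taylor P I <> 0 -> stable_at (taylor P I) c0.

(** For [I] nonzero this is the value of the coefficient of index [I] at every point close enough to
    the cut, by stability at [c0]. *)
Definition tcoef I : option (vf_group M) := poly_val (taylor P I) c0.

Lemma tcoef0 I : taylor P I = 0 -> tcoef I = None.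
Proof. by move=> PI; rewrite /tcoef /poly_val PI raddf0 sp_eval0 val0. Qed.

Lemma mnmU_neq0 (j : 'I_n.+1) : U_(j)%MM <> 0%MM :> 'X_{1..n.+1}.
Proof. by move/eqP; rewrite mnm1_eq0. Qed.

Lemma tcoef_fin I : I <> 0%MM -> taylor P I <> 0 -> exists g, tcoef I = Some g.
Proof.
move=> I0 PI; have [g ] := elt_None (P_taylor I0 PI (@mnmU_neq0 ord0)).
by exists g.
Qed.

Lemma tcoef_val (T : target) I (x : T) : I <> 0%MM ->
  ele (Some (tg_group T (cut_val c0))) (vval (x - tg_emb T c0)) ->
  vval (sp_eval (taylor (map_mpoly (tg_emb T) P) I) x) = omap (tg_group T) (tcoef I).
Proof.
move=> I0 xc; rewrite map_mpoly_taylor.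
have [PI|PI] := pselect (taylor P I = 0).
  by rewrite (tcoef0 PI) PI raddf0 sp_eval0 val0.
by rewrite (stab_val (P_taylor I0 PI) xc).
Qed.

Lemma self_tcoef_val I c : I <> 0%MM -> cut_val c0 <= cut_val c ->
  poly_val (taylor P I) c = tcoef I.
Proof.
move=> I0 le; have := @tcoef_val self_target I (p c) I0 (cut_val_le le).
by rewrite /poly_val -map_mpoly_taylor /= => ->; case: tcoef.
Qed.

Lemma unstable_nonconst : exists j : 'I_n.+1, taylor P U_(j)%MM <> 0.
Proof.
apply: contra_notP (@P_unstab c0) => nex; apply: stab_const => // j.
by apply: contra_notP nex; exists j.
Qed.

Section InTarget.
Variable T : target.
Local Notation q := (tg_emb T).
Local Notation h := (tg_group T).
Implicit Type g : vf_group T.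

(** The value of the Taylor term of index [I] for a displacement of value [g]. *)
Definition tterm I g := eadd (omap h (tcoef I)) (Some (mnm_rho I g)).

(** Stability of the coefficient of index [I] compares its constant Taylor term with its [J]-th one;
    adding the weight of [I] on both sides turns this into a comparison of terms of [P]. *)
Lemma tterm_dominated I J g : I <> 0%MM -> J <> 0%MM -> taylor P I <> 0 ->
  h (cut_val c0) <= g -> elt (tterm I g) (tterm (I + J)%MM g).
Proof.
move=> I0 J0 PI le; have -> : tterm (I + J)%MM g =
    eadd (eadd (omap h (tcoef (I + J)%MM)) (Some (mnm_rho J g))) (Some (mnm_rho I g)).
  by rewrite -eaddA /tterm mnm_rhoD addrC.
rewrite /tterm elt_addS.
have : elt (tcoef I) (eadd (tcoef (I + J)%MM) (Some (mnm_rho J (cut_val c0)))).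
  by rewrite /tcoef -poly_val_taylor2; apply: P_taylor.
rewrite -(omap_elt (@tg_mono T)) omap_eadd /= => /elt_ele_trans; apply.
by apply: ele_addl; rewrite tg_mnm_rho mnm_rho_le.
Qed.

(** A monomial of degree at least two lies above some [U_(i)]; its term vanishes with the [i]-th
    linear coefficient or is dominated by the [i]-th linear term. So the least linear term wins. *)
Lemma tterm_lead g : h (cut_val c0) <= g ->
  exists j : 'I_n.+1, [/\ exists a, tcoef U_(j)%MM = Some a,
    forall I, I <> 0%MM -> ele (tterm U_(j)%MM g) (tterm I g)
  & forall I, (1 < mdeg I)%N -> elt (tterm U_(j)%MM g) (tterm I g)].
Proof.
move=> le; have [||j jle] := @ex_least_ord n
    (fun i j => ele (tterm U_(i)%MM g) (tterm U_(j)%MM g)).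
- by move=> i j; apply: ele_total.
- by move=> i j k; apply: ele_trans.
have [j1 /(tcoef_fin (@mnmU_neq0 j1))[a1 e1]] := unstable_nonconst.
have [a ea] : exists a, tcoef U_(j)%MM = Some a.
  by have := jle j1; rewrite /tterm e1; case: (tcoef U_(j)%MM) => // a; exists a.
have lt I : (1 < mdeg I)%N -> elt (tterm U_(j)%MM g) (tterm I g).
  move=> I1; have I0 : I <> 0%MM by move=> I0; rewrite I0 mdeg0 in I1.
  have [i leI] := mnm_neq0 I0.
  have [PI|PI] := pselect (taylor P U_(i)%MM = 0).
    by rewrite /tterm ea (tcoef0 (taylor_eq0 pchar_E leI PI)).
  apply: (ele_elt_trans (jle i)); rewrite -(submK leI) addmC.
  apply: tterm_dominated => //; first exact: mnmU_neq0.
  by move=> I_U; rewrite -(submK leI) I_U add0m mdeg1 in I1.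
exists j; split=> // [|I I0]; first by exists a.
have [I1|] := ltnP 1 (mdeg I); first exact/eltW/lt.
move=> I1; have /mdeg1P[i /eqP -> //] : mdeg I == 1%N.
by rewrite eqn_leq I1 lt0n mdeg_eq0; apply/eqP.
Qed.

(** If [P(c)] had smaller value than the least linear term, its constant term would dominate and [P]
    would be stable at [c]. *)
Lemma tterm_lead_le c j : cut_val c0 <= cut_val c ->
  (forall I, I <> 0%MM ->
    ele (tterm U_(j)%MM (h (cut_val c))) (tterm I (h (cut_val c)))) ->
  ele (tterm U_(j)%MM (h (cut_val c))) (omap h (poly_val P c)).
Proof.
move=> le jle; apply: contra_notT (@P_unstab c) => /negP jlt I I0.
have /ele_elt_trans lt := jle I I0; have {}jlt : elt (omap h (poly_val P c)) (tterm U_(j)%MM (h (cut_val c))).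
  by apply/negP.
have := elt_ele_trans jlt (jle I I0).
rewrite /tterm -tg_mnm_rho -[Some (h _)]/(omap h (Some _)) -omap_eadd omap_elt.
  by rewrite self_tcoef_val.
exact: tg_mono.
Qed.

Lemma unstable_root (x : T) : sigma_henselian T -> realizes x ->
  exists2 x' : T, realizes x' & sp_eval (map_mpoly q P) x' = 0.
Proof.
move=> hensT xcut; set F := map_mpoly q P.
have xball c : ele (Some (h (cut_val c))) (vval (x - q c)) by rewrite xcut ele_refl.
have tv I : I <> 0%MM -> vval (sp_eval (taylor F I) x) = omap h (tcoef I).
  by move=> I0; apply: tcoef_val.
case vFx : (vval (sp_eval F x)) => [y|]; last by exists x => //; apply/vf_val_eq0.
(* Solvable because [rho^j] is onto. A vanishing coefficient gets the dummy 0 and is filtered out of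
   [S]. *)
have solve (j : 'I_n.+1) : exists g, tcoef U_(j)%MM <> None -> tterm U_(j)%MM g = Some y.
  case ej : (tcoef U_(j)%MM) => [a|]; last by exists 0.
  have [g eg] := rho_pow_surj j (y - h a); exists g => _.
  by rewrite /tterm ej /= mnm_rhoU eg addrC subrK.
have [gs gsE] := boolp.choice solve.
have [j0 /(tcoef_fin (@mnmU_neq0 j0))[a0 ea0]] := unstable_nonconst.
pose S := [seq j <- enum 'I_n.+1 | tcoef U_(j)%MM != None].
(* The largest [gs j] is the gamma of the configuration: there the [i]-th linear term has value [y]
   and the others at least [y]. Putting [j0] in front keeps the list nonempty. *)
have [||i iS gmax] := @ex_least _ (fun i j => gs j <= gs i) j0 S.
- by move=> i j; apply: oag_le_total.
- by move=> i j k ij jk; apply: le_trans jk ij.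
have finS j : j \in j0 :: S -> tcoef U_(j)%MM <> None.
  rewrite inE => /predU1P[->|]; first by rewrite ea0.
  by rewrite mem_filter => /andP[/eqP].
have gE : tterm U_(i)%MM (gs i) = Some y by apply: gsE; apply: finS.
(* Gamma lies beyond the cut: instability bounds the least linear term at [c] by the value of
   [P(c)], hence by [y], and linear terms increase with the displacement. *)
have g_ge c : cut_val c0 <= cut_val c -> h (cut_val c) <= gs i.
  move=> le; have [|j [[a ea] jle _]] := @tterm_lead (h (cut_val c)).
    by rewrite tg_mono.
  have jS : j \in j0 :: S by rewrite inE mem_filter ea /= mem_enum orbT.
  apply: le_trans (gmax j jS).
  have jley : ele (tterm U_(j)%MM (h (cut_val c))) (Some y).
    rewrite -vFx -[sp_eval F x](subrK (sp_eval F (q c))); apply: valDge.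
      have -> : sp_eval F x = sp_eval F (q c + (x - q c)) by rewrite addrC subrK.
      apply: (@val_taylor_ge _ _ _ _ _ (h (cut_val c))) => // I I0.
      have := @tcoef_val T I (q c) I0; rewrite -/F => ->; first exact: jle.
      have : ele (omap h (Some (cut_val c0))) (omap h (vval (p c - p c0))).
        by rewrite omap_ele; [apply: cut_val_le | apply: tg_mono].
      by rewrite -(rmorphB p) -tg_val rmorphB.
    by rewrite tg_poly_val; apply: tterm_lead_le.
  have: ele (tterm U_(j)%MM (h (cut_val c))) (tterm U_(j)%MM (gs j)).
    by rewrite gsE // ea.
  by rewrite /tterm ea /= oag_leD2l !mnm_rhoU rho_pow_mono.
have FP J : taylor F J <> 0 -> taylor P J <> 0.
  by rewrite /F map_mpoly_taylor => FJ PJ; apply: FJ; rewrite PJ raddf0.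
have [|x' [vx' Fx']] := hensT n F x (gs i).
  apply: (hensel_configI tv).
  - move=> c Fc; have := tv _ (@mnmU_neq0 j0); rewrite ea0 Fc.
    have -> : taylor (c%:MP_[n.+1] : {mpoly T[n.+1]}) U_(j0)%MM = 0.
      apply/mpolyP => m; have hm := mcoeff_taylor (c%:MP_[n.+1] : {mpoly T[n.+1]}) U_(j0)%MM m.
      rewrite hm mcoeffC mnmD_eq0 mnm1_eq0 andbF mulr0 mul0rn.
      by rewrite mcoeff0.
    by rewrite sp_eval0 val0.
  - exists i; split=> [|j]; first by rewrite vFx -gE /tterm mnm_rhoU.
    suff: ele (tterm U_(i)%MM (gs i)) (tterm U_(j)%MM (gs i)).
      by rewrite /tterm !mnm_rhoU.
    rewrite gE; have [jnone|jfin] := pselect (tcoef U_(j)%MM = None).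
      by rewrite /tterm jnone.
    have jS : j \in j0 :: S.
      by rewrite inE mem_filter mem_enum andbT; apply/orP; right; apply/eqP.
    rewrite -(gsE j jfin) /tterm !mnm_rhoU; apply: ele_addl.
    by rewrite rho_pow_mono; apply: gmax.
  - move=> J L J0 /andP[JL /submK LJ] /FP PJ.
    have LJ0 : (L - J)%MM <> 0%MM.
      by move=> LJ0; rewrite LJ0 add0m in LJ; rewrite LJ eqxx in JL.
    suff: elt (tterm J (gs i)) (tterm L (gs i)) by [].
    rewrite -LJ addmC.
    by apply: tterm_dominated => //; apply: g_ge.
exists x' => // c; have [c' cc'] := cut_val_nomax c.
have [c1 [c1c c1c0]] : exists c1, cut_val c < cut_val c1 /\ cut_val c0 <= cut_val c1.
  have /orP[le|le] := oag_le_total (cut_val c') (cut_val c0).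
    by exists c0; split=> //; apply: lt_le_trans le.
  by exists c'.
rewrite -[x'](subrK x) -addrA addrC valD_lt xcut // vx' elt_Some.
by apply: lt_le_trans (g_ge _ c1c0); rewrite (oag_mono_lt (@tg_mono T)).
Qed.

(** In order 0 there is a single linear term, which has nothing to cancel with, so the difference of
    the values of [P] at two distinct points of the cut has the finite value of that term. *)
Lemma unstable_root_unique (x y : T) : n = 0%N -> realizes x -> realizes y ->
  sp_eval (map_mpoly q P) x = 0 -> sp_eval (map_mpoly q P) y = 0 -> x = y.
Proof.
move=> n0 xcut ycut; set F := map_mpoly q P => Fx Fy.
apply: contrapT => xy; have [|g vg] := @val_neq0 _ (y - x).
  by move/eqP; rewrite subr_eq0 => /eqP yx; apply: xy.
have le : h (cut_val c0) <= g.
  suff: ele (Some (h (cut_val c0))) (Some g) by [].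
  rewrite -vg -[y](subrK (q c0)) -addrA; apply: valDge.
    by rewrite ycut ele_refl.
  by rewrite valBC xcut ele_refl.
have tv I : I <> 0%MM -> vval (sp_eval (taylor F I) x) = omap h (tcoef I).
  by move=> I0; apply: tcoef_val => //; rewrite xcut ele_refl.
have [j [[a ea] _ jlt]] := tterm_lead le.
have fin : tterm U_(j)%MM g <> None by rewrite /tterm ea.
have := @val_taylor_lin _ _ F x (y - x) g (tterm U_(j)%MM g) fin.
rewrite vg ele_refl [x + _]addrC subrK Fx Fy subrr sub0r valN => /(_ isT) lt.
have: elt (tterm U_(j)%MM g) (tterm U_(j)%MM g); last by rewrite elt_irr.
have vsum : vval (\sum_(k < n.+1) sp_eval (taylor F U_(k)%MM) x * iter k sigma (y - x))
    = tterm U_(j)%MM g.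
  rewrite (bigD1 j) //= big1 ?addr0.
    by rewrite vf_valM val_iter_sigma vg tv /tterm ?mnm_rhoU //; apply: mnmU_neq0.
  move=> k /negP[]; apply/eqP; apply: val_inj => /=.
  have ord_0 (m : 'I_n.+1) : m = 0%N :> nat.
    apply/eqP; rewrite -leqn0; have := ltn_ord m; rewrite ltnS => /leq_trans; apply.
    by rewrite n0.
  by rewrite !ord_0.
rewrite vsum in lt; apply: lt => I I1; have I0 : I <> 0%MM by move=> I0; rewrite I0 mdeg0 in I1.
by rewrite tv //; apply: jlt.
Qed.

End InTarget.
Local Notation sterm := (@tterm self_target).

Lemma self_tterm I g : sterm I g = eadd (tcoef I) (Some (mnm_rho I g)).
Proof. by rewrite /tterm /=; case: tcoef. Qed.

(* The linear terms of the Taylor expansion of [P] do not cancel at [e]. *)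
Definition approx_root e : Prop := exists j : 'I_n.+1,
  [/\ exists a, tcoef U_(j)%MM = Some a, poly_val P e = sterm U_(j)%MM (cut_val e)
    & forall k : 'I_n.+1, ele (sterm U_(j)%MM (cut_val e)) (sterm U_(k)%MM (cut_val e))].

(** The index attached to [e'] serves for both points: its term bounds the least term at [e] from
    above and increases strictly from [e] to [e']. *)
Lemma approx_root_lt e e' : approx_root e -> approx_root e' ->
  cut_val e < cut_val e' -> elt (poly_val P e) (poly_val P e').
Proof.
move=> [j [_ -> jle]] [k [[a ea] -> _]] lt; apply: ele_elt_trans (jle k) _.
rewrite /tterm ea !mnm_rhoU; apply: elt_addl => //.
by rewrite rho_pow_lt.
Qed.

Hypothesis res_independent : forall u : 'I_n.+1 -> vf_residue M,
  (exists j, u j <> 0) ->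
  exists r, \sum_(j < n.+1) u j * iter j (@vdf_sigma_residue M) r <> 0.

Lemma approx_root_exists (x : M) : @realizes self_target x ->
  sp_eval (map_mpoly p P) x = 0 -> forall c, cut_val c0 <= cut_val c ->
  exists2 e, cut_val e = cut_val c & approx_root e.
Proof.
move=> xcut; set F := map_mpoly p P => Fx c le; set g := cut_val c.
have [j [[a ea] jle jlt]] := @tterm_lead self_target g le.
have [th vth] := vf_val_surj g.
pose w (k : 'I_n.+1) := sp_eval (taylor F U_(k)%MM) x * iter k sigma th.
have tv I : I <> 0%MM -> vval (sp_eval (taylor F I) x) = tcoef I.
  move=> I0; have := @tcoef_val self_target I x I0; rewrite xcut ele_refl => /(_ isT).
  by rewrite /= => ->; case: tcoef.
have tvU (k : 'I_n.+1) (z : M) gz : vval z = Some gz ->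
    vval (sp_eval (taylor F U_(k)%MM) x * iter k sigma z) = sterm U_(k)%MM gz.
  move=> vz; rewrite vf_valM tv; last exact: mnmU_neq0.
  by rewrite val_iter_sigma vz self_tterm mnm_rhoU.
have vw k : vval (w k) = sterm U_(k)%MM g by apply: tvU.
have [m em] : exists m, sterm U_(j)%MM g = Some m.
  by rewrite self_tterm ea; exists (a + mnm_rho U_(j)%MM g).
have wj0 : w j != 0 by apply: (@val_neq0_Some _ _ m); rewrite vw.
pose u k := w k / w j.
have Ou k : in_valring (u k).
  by apply: val_div_ge => //; rewrite !vw; apply: jle; apply: mnmU_neq0.
(* Since [u j = 1], the residues are not all zero; [r] is chosen so that the leading parts of the
   linear terms do not cancel at [th * rh]. *)
have [|r sum_r] := res_independent (u := fun k => vres (u k)).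
  by exists j; rewrite /u divff // vf_res1; apply/eqP/oner_neq0.
have [rh Orh rhE] := vf_res_surj r.
have Oiter k : in_valring (iter k sigma rh) by have [] := iter_sigma_res k Orh.
have [Oy ry] := vres_sum (fun k : 'I_n.+1 => valringM (Ou k) (Oiter k)).
set y := \sum_(i < n.+1) _ in Oy ry.
have vy : vval y = Some 0.
  apply: val_res_neq0 => //; rewrite ry => e; apply: sum_r; rewrite -[RHS]e.
  apply: eq_bigr => k _; rewrite vf_resM //; last exact: Oiter.
    by have [_ ->] := iter_sigma_res k Orh; rewrite rhE.
  exact: Ou.
have vrh : vval rh = Some 0.
  apply: val_res_neq0 => //; rewrite rhE => r0; apply: sum_r.
  by rewrite big1 // => k _; rewrite r0 iter_residue0 mulr0.
pose z0 := th * rh; have vz0 : vval z0 = Some g.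
  by rewrite vf_valM vth vrh /= addr0.
have [c1 cc1] := cut_val_nomax c.
have z0_neq0 : z0 <> 0 by move=> z00; rewrite z00 val0 in vz0.
(* [c1] is closer to [x] than [g] and [e1] approximates [z0], so [p e - x] agrees with [z0] up to
   larger value. *)
have [e1 lt1] := p_dense z0_neq0; pose e := c1 + e1; pose z := p e - x.
have vzz0 : elt (Some g) (vval (z - z0)).
  have -> : z - z0 = - (x - p c1) - (z0 - p e1) by rewrite /z /e rmorphD; ring.
  apply: valBgt; last by rewrite -vz0.
  by rewrite valN xcut elt_Some.
have vz : vval z = Some g.
  by rewrite -[z](subrK z0) addrC valD_lt // vz0.
have ge : cut_val e = g.
  have : vval (x - p e) = Some g by rewrite valBC.
  by have := xcut e; rewrite /= => -> [].
exists e => //; exists j; rewrite ge; split=> [||k]; first by exists a.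
  2: by apply: jle; apply: mnmU_neq0.
have Fpe : sp_eval F (p e) = sp_eval F (x + z) by rewrite /z addrC subrK.
have mu_fin : Some m <> None :> option (vf_group M) by [].
have := @val_taylor_lin _ _ F x z g (Some m) mu_fin.
rewrite vz ele_refl -Fpe Fx subr0 => /(_ isT).
set L := \sum_(k < n.+1) _ => high.
have {}high : elt (Some m) (vval (sp_eval F (p e) - L)).
  apply: high => I I1; have I0 : I <> 0%MM by move=> I0; rewrite I0 mdeg0 in I1.
  by rewrite tv // -self_tterm -em; apply: jlt.
(* The first summand has value exactly [m] by the choice of [r]; the second, linear in [z - z0], has
   a larger value. *)
have LE : L = w j * y + \sum_(k < n.+1) sp_eval (taylor F U_(k)%MM) x * iter k sigma (z - z0).
  rewrite /L /y mulr_sumr -big_split; apply: eq_bigr => k _ /=.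
  have -> : w j * (u k * iter k sigma rh) = w k * iter k sigma rh.
    by rewrite mulrA /u [w j * _]mulrC divfK.
  by rewrite /w -mulrA -iter_sigmaM -mulrDr -iter_sigmaD [X in iter k sigma X]addrC subrK.
have vL : vval L = Some m.
  rewrite LE valD_lt vf_valM vw em vy /= addr0 //.
  apply: val_sum_gt => // k _ _; rewrite vf_valM tv; last exact: mnmU_neq0.
  rewrite val_iter_sigma; have := jle _ (@mnmU_neq0 k).
  rewrite em self_tterm mnm_rhoU; case: (tcoef U_(k)%MM) => [a'|] // /ele_elt_trans; apply.
  rewrite eaddC [X in elt _ X]eaddC; apply: elt_add => //; last exact: ele_refl.
  rewrite -[Some (rho_pow k g)]/(omap (@rho_pow M k) (Some g)) omap_elt //.
  exact: rho_pow_mono.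
rewrite em -vL /poly_val -/F -[sp_eval F (p e)](subrK L) addrC valD_lt //.
by rewrite vL.
Qed.

End Unstable.

Lemma stab_common (P : {mpoly E[n.+1]}) :
  (forall I, I <> 0%MM -> taylor P I <> 0 -> exists c, stable_at (taylor P I) c) ->
  exists c0, forall I, I <> 0%MM -> taylor P I <> 0 -> stable_at (taylor P I) c0.
Proof.
move=> P_stab; suff [c0 H] : exists c0, forall I, I \in msupp (taylor_poly P) ->
    I <> 0%MM -> taylor P I <> 0 -> stable_at (taylor P I) c0.
  exists c0 => I I0 PI; apply: H => //; apply: contra_notT PI.
  exact: taylor_notin.
elim: (msupp _) => [|J r [c H]]; first by exists 0.
have [[J0 PJ]|nJ] := pselect (J <> 0%MM /\ taylor P J <> 0); last first.
  by exists c => I /predU1P[-> J0 PJ|/H //]; case: nJ.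
have [c' cJ] := P_stab J J0 PJ; have /orP[le|le] := oag_le_total (cut_val c) (cut_val c').
  exists c' => I /predU1P[->//|/H cI] I0 PI.
  exact: stab_persist (cI I0 PI) le.
exists c => I /predU1P[-> _ _|/H //].
exact: stab_persist cJ le.
Qed.

(** * Nowhere stable polynomials of least complexity *)

Definition vars_lt (k : nat) (m : 'X_{1..n.+1}) : Prop :=
  forall j : 'I_n.+1, (k <= j)%N -> m j = 0%N.

(* [P] has least complexity (variables, degree in the last variable ['X_k],
   total degree) among the polynomials that are nowhere stable. *)
Record min_unstable (k : 'I_n.+1) (d : nat) (P : {mpoly E[n.+1]}) (c0 : E) : Prop :=
  MinUnstable {
    mu_neq0 : P <> 0;
    mu_unstab : forall c, ~ stable_at P c;
    mu_taylor : forall I, I <> 0%MM -> taylor P I <> 0 -> stable_at (taylor P I) c0;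
    mu_vars : supp_in (vars_lt k.+1) P;
    mu_deg : supp_in (fun m => m k <= d)%N P;
    mu_lead : xcoef k P d <> 0;
    mu_pos : (0 < d)%N;
    mu_low : forall Q, Q <> 0 -> supp_in (vars_lt k.+1) Q ->
      supp_in (fun m => m k < d)%N Q -> exists c, stable_at Q c
  }.

Lemma min_unstable_exists : (exists Q, Q <> 0 /\ forall c, ~ stable_at Q c) ->
  exists k d P c0, min_unstable k d P c0.
Proof.
pose U Q := Q <> 0 /\ forall c, ~ stable_at Q c; move=> [Q0 UQ0].
have UI Q : Q <> 0 -> ~ (exists c, stable_at Q c) -> U Q.
  by move=> Qn0 nst; split; [exact: Qn0 | move=> c cQ; apply: nst; exists c].
have [|k1 [[Q1 [UQ1 Q1k]] k1_min]] :=
  @ex_least_nat (fun k => exists Q, U Q /\ supp_in (vars_lt k) Q).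
  exists n.+1, Q0; split; first exact: UQ0.
  by move=> m _ j; rewrite leqNgt ltn_ord.
case: k1 => [|k] in Q1k k1_min *.
  (* Without variables the polynomial is a nonzero constant, which is stable. *)
  case: (UQ1) => Q1_neq0 /(_ 0)[]; apply: stab_const => // j; apply/mpolyP => m.
  apply/eqP; rewrite mcoeff0 mcoeff_taylor_eq0; last exact: pchar_E.
  rewrite mcoeff_eq0; apply/negP => /Q1k/(_ j isT).
  by rewrite mnmDE mnm1E eqxx addn1.
have kn : (k < n.+1)%N.
  apply: (k1_min n.+1); exists Q0; split; first exact: UQ0.
  by move=> m _ j; rewrite leqNgt ltn_ord.
pose ko := Ordinal kn.
have [|d [[Q2 [UQ2 Q2k Q2d]] d_min]] := @ex_least_nat (fun d => exists Q,
    [/\ U Q, supp_in (vars_lt k.+1) Q & supp_in (fun m => m ko <= d)%N Q]).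
  exists (msize Q1), Q1; split; [exact: UQ1 | exact: Q1k | move=> m /msize_mdeg_lt lt].
  by rewrite (leq_trans _ (ltnW lt)) // mdegE (bigD1 ko) //= leq_addr.
(* A Taylor coefficient taken in a lower variable may keep degree [d] in ['X_ko], so the total
   degree has to be minimized as well for the Taylor coefficients to be stable. *)
have [|t [[P [UP Pk Pd Pt]] t_min]] := @ex_least_nat (fun t => exists Q,
    [/\ U Q, supp_in (vars_lt k.+1) Q, supp_in (fun m => m ko <= d)%N Q
      & (msize Q <= t)%N]).
  by exists (msize Q2), Q2; split; [exact: UQ2 | exact: Q2k | exact: Q2d | exact: leqnn].
have low Q : Q <> 0 -> supp_in (vars_lt k.+1) Q ->
    supp_in (fun m => m ko <= d)%N Q -> (msize Q < msize P)%N -> exists c, stable_at Q c.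
  move=> Qn0 Qk Qd Qt; apply: contrapT => nst.
  have : (t <= msize Q)%N.
    by apply: t_min; exists Q; split; [exact: UI | exact: Qk | exact: Qd | exact: leqnn].
  by rewrite leqNgt (leq_trans Qt Pt).
have [c0 c0P] : exists c0, forall I, I <> 0%MM -> taylor P I <> 0 -> stable_at (taylor P I) c0.
  apply: stab_common => I I0 PI; apply: low => //; last exact: msize_taylor.
    by move=> m /msupp_taylor/Pk mI j /mI; rewrite mnmDE => /eqP; rewrite addn_eq0 => /andP[/eqP].
  by move=> m /msupp_taylor/Pd; rewrite mnmDE; apply: leq_trans; rewrite leq_addr.
(* For [d = 0] the variable ['X_ko] would not occur, against the choice of [k]. *)
have d_gt0 : (0 < d)%N.
  rewrite lt0n; apply/negP => /eqP d0; have := k1_min k; rewrite ltnn => H.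
  apply: (notF (H _)); exists P; split; [exact: UP | move=> m mP j]; rewrite leq_eqVlt => /predU1P[kj|].
    by have := Pd m mP; rewrite d0 leqn0 (_ : ko = j) => [/eqP //|]; apply: val_inj.
  exact: Pk.
have [P_neq0 P_unst] := UP; exists ko, d, P, c0.
apply: (@MinUnstable ko d P c0 P_neq0 P_unst c0P Pk Pd _ d_gt0).
  have [|] := pselect (exists2 m, m \in msupp P & m ko = d).
    by move=> [m mP mk]; apply: xcoef_neq0 mP mk.
  move=> nex; have : (d <= d.-1)%N.
    apply: d_min; exists P; split; [exact: UP | exact: Pk | move=> m mP]; have := Pd m mP.
    rewrite leq_eqVlt => /predU1P[mk|]; first by case: nex; exists m.
    by rewrite -[in X in X -> _](prednK d_gt0) ltnS.
  by rewrite -[X in (X <= _)%N](prednK d_gt0) ltnn.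
move=> Q Qn0 Qk Qd; apply: contrapT => nst; have : (d <= d.-1)%N.
  apply: d_min; exists Q; split; [exact: UI | exact: Qk | move=> m /Qd].
  by rewrite -[in X in X -> _](prednK d_gt0) ltnS.
by rewrite -[X in (X <= _)%N](prednK d_gt0) ltnn.
Qed.

(** Pseudo-division by [P] in ['X_k]: since [P] vanishes at [x] and [y], multiplying [Q] by the
    leading coefficient [L] lowers its degree without losing information, as [L] is stable and so
    has finite, matching values. Below degree [d] everything nonzero is stable. *)
Lemma min_unstable_compat k d P c0 (T : target) (x : M) (y : T) :
  min_unstable k d P c0 -> @realizes self_target x -> realizes y ->
  sp_eval (map_mpoly p P) x = 0 -> sp_eval (map_mpoly (tg_emb T) P) y = 0 ->
  forall Q, supp_in (vars_lt k.+1) Q ->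
    vval (sp_eval (map_mpoly (tg_emb T) Q) y)
    = omap (tg_group T) (vval (sp_eval (map_mpoly p Q) x)).
Proof.
case=> _ _ _ Pk Pd Plead d_gt0 low xcut ycut Px Py Q.
have stabE c Q' : stable_at Q' c -> vval (sp_eval (map_mpoly p Q') x) = poly_val Q' c /\
    vval (sp_eval (map_mpoly (tg_emb T) Q') y) = omap (tg_group T) (poly_val Q' c).
  move=> Qc; split; last by apply: stab_val => //; rewrite ycut ele_refl.
  by apply: self_stab_val => //; rewrite [vval _]xcut ele_refl.
have [N] : exists N : nat, supp_in (fun m => m k < N)%N Q.
  exists (msize Q) => m /msize_mdeg_lt; apply: leq_ltn_trans.
  by rewrite mdegE (bigD1 k) //= leq_addr.
elim: N Q => [|e IH] Q Qe Qk.
  have -> : Q = 0.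
    apply/eqP; rewrite -msupp_eq0; case eQ : (msupp Q) => [|m r] //.
    by have := Qe m; rewrite eQ mem_head => /(_ isT).
  by rewrite !raddf0 !sp_eval0 !val0.
have [->|/eqP Q0] := eqVneq Q 0; first by rewrite !raddf0 !sp_eval0 !val0.
have [ed|de] := ltnP e d.
  have [|c Qc] := low Q Q0 Qk; first by move=> m /Qe; rewrite ltnS => /leq_ltn_trans; apply.
  by have [-> ->] := stabE c Q Qc.
pose L := xcoef k P d; pose C := xcoef k Q e.
pose Rm := L * Q - C * 'X_k ^+ (e - d) * P.
have vars_sub m : vars_lt k.+1 m -> vars_lt k.+1 (m - U_(k) *+ m k)%MM.
  by move=> mk j /mk mj; rewrite mnmBE mj.
have [Lk Ck] : supp_in (fun m => m k = 0%N /\ vars_lt k.+1 m) L /\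
    supp_in (fun m => m k = 0%N /\ vars_lt k.+1 m) C.
  by split; apply: xcoef_supp.
have varsD m m' : vars_lt k.+1 m -> vars_lt k.+1 m' -> vars_lt k.+1 (m + m')%MM.
  by move=> mk mk' j kj; rewrite mnmDE mk ?mk'.
have Xk : supp_in (vars_lt k.+1) ('X_k ^+ (e - d) : {mpoly E[n.+1]}).
  rewrite mpolyXn; apply: supp_inX => j kj; rewrite mulmnE mnm1E.
  by case: eqP => // kj'; rewrite -kj' ltnn in kj.
have sub1 A B Q' : supp_in (fun m => A m /\ B m) Q' -> supp_in B Q'.
  by apply: supp_inW => m [].
have Rk : supp_in (vars_lt k.+1) Rm.
  apply: supp_inB; first by apply: supp_inM varsD _ Qk; apply: sub1 Lk.
  apply: (supp_inM varsD) => //; apply: (supp_inM varsD) => //.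
  exact: sub1 Ck.
have Re : supp_in (fun m => m k < e)%N Rm.
  have -> : Rm = L * (Q - C * 'X_k ^+ e) - C * 'X_k ^+ (e - d) * (P - L * 'X_k ^+ d).
    rewrite /Rm -{2}(subnK de) exprD; ring.
  apply: supp_inB.
    apply: (supp_inM _ Lk); last by apply: xcoef_rem => m /Qe.
    by move=> m m' [mk _]; rewrite mnmDE mk.
  apply: (@supp_inM _ _ (fun m => m k <= e - d)%N); last exact: xcoef_rem Pd.
    by move=> m m' mk mk'; rewrite mnmDE -(subnK de) -addnS leq_add.
  apply: (@supp_inM _ _ (fun m => m k = 0%N) (fun m => m k <= e - d)%N).
  - by move=> m m' mk mk'; rewrite mnmDE mk.
  - by apply: supp_inW Ck => m [].
  - by rewrite mpolyXn; apply: supp_inX; rewrite mulmnE mnm1E eqxx mul1n.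
have [|c Lc] := low L Plead (sub1 _ _ _ Lk).
  by apply: supp_inW Lk => m [->].
have [Lx Ly] := stabE c L Lc.
have [a ea] := elt_None (Lc _ (@mnmU_neq0 ord0)).
have mulE (S : vdField) (f : {rmorphism E -> S}) (z : S) :
    sp_eval (map_mpoly f P) z = 0 ->
    sp_eval (map_mpoly f L) z * sp_eval (map_mpoly f Q) z = sp_eval (map_mpoly f Rm) z.
  rewrite /sp_eval => Pz; rewrite /Rm rmorphB !rmorphM /= mevalB !mevalM Pz mulr0 subr0.
  by [].
have := IH Rm Re Rk; rewrite -(mulE _ _ _ Px) -(mulE _ _ _ Py) !vf_valM Lx Ly ea.
case: (vval (sp_eval (map_mpoly _ Q) x)) => [g|]; case: (vval _) => [g'|] //=.
by rewrite raddfD => -[/addrI ->].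
Qed.

End Cut.

(** * Well-orders and cofinal sequences *)

Section WellOrder.
Variables (T : Type) (R : rel T).
Hypothesis wR : well_order R.

Lemma wo_least (A : T -> Prop) : (exists x, A x) ->
  exists z, A z /\ forall x, A x -> R z x.
Proof.
move=> [x Ax]; have [|z [[/asboolP Az zle] _]] := wR (A := fun y => `[< A y >]).
  by exists x; apply/asboolP.
by exists z; split=> // y Ay; apply: zle; apply/asboolP.
Qed.

Lemma wo_refl x : R x x.
Proof.
by have [|z [-> zle]] := @wo_least (fun y => y = x); [exists x | apply: zle].
Qed.

Lemma wo_anti x y : R x y -> R y x -> x = y.
Proof.
move=> xy yx; have [|z [_ zU]] := wR (A := fun w => `[< w = x \/ w = y >]).
  by exists x; apply/asboolP; left.
rewrite -[x]zU.
  rewrite -[y]zU //; split; first by apply/asboolP; right.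
  by move=> w /asboolP[] ->; rewrite ?wo_refl.
split; first by apply/asboolP; left.
by move=> w /asboolP[] ->; rewrite ?wo_refl.
Qed.

Lemma wo_total x y : R x y || R y x.
Proof.
have [|z [[] -> zle]] := @wo_least (fun w => w = x \/ w = y); first by exists x; left.
  by rewrite zle //; right.
by rewrite (zle x) ?orbT //; left.
Qed.

Lemma wo_strictW x y : strict R x y -> R x y.
Proof. by rewrite /strict => /negbTE nyx; have := wo_total x y; rewrite nyx orbF. Qed.

Lemma wo_trans y x z : R x y -> R y z -> R x z.
Proof.
move=> xy yz; have [|w [wxyz wle]] := @wo_least (fun w => [\/ w = x, w = y | w = z]).
  by exists x; constructor 1.
have wx : R w x by apply: wle; constructor 1.
have wy : R w y by apply: wle; constructor 2.
have wz : R w z by apply: wle; constructor 3.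
case: wxyz => e; rewrite e in wx wy wz => //.
  by rewrite (wo_anti xy wx).
by rewrite -(wo_anti yz wy).
Qed.

Lemma wo_strict_trans y x z : strict R x y -> strict R y z -> strict R x z.
Proof.
rewrite /strict => xy; apply: contra => zx; apply: wo_trans zx _.
exact: wo_strictW.
Qed.

Lemma wo_well_founded : well_founded (fun x y => strict R x y).
Proof.
move=> x; apply: contrapT => nacc.
have [|z [nz zle]] := @wo_least (fun y => ~ Acc (fun x y => strict R x y) y).
  by exists x.
apply: nz; constructor => y yz; apply: contrapT => /zle zy.
by rewrite /strict zy in yz.
Qed.

End WellOrder.

(* Such an [R] has the order type of the cardinal of [T]. *)
Definition initial_order (T : Type) (R : rel T) : Prop :=
  forall (z : T) (i : T -> T), injective i -> ~ forall t, strict R (i t) z.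

(** If a well-order is not initial, take the least [x] below which [T] injects and pull the order
    back along the injection; an injection below some [i z] would contradict the minimality of
    [x]. *)
Lemma initial_order_exists (T : eqType) :
  exists2 R : rel T, well_order R & initial_order R.
Proof.
have [R wR] := well_ordering_principle T.
have [init|ninit] := pselect (initial_order R); first by exists R.
have [|x [[i [i_inj ix]] xle]] := wo_least wR
   (A := fun z => exists i : T -> T, injective i /\ forall t, strict R (i t) z).
  apply: contrapT => nex; apply: ninit => z i i_inj ilt; apply: nex.
  by exists z, i.
exists (fun a b => R (i a) (i b)).
  move=> A [a Aa]; have [|z [[c [Ac <-]] cle]] := wo_least wR
      (A := fun w => exists c, c \in A /\ i c = w); first by exists (i a), a.
  exists c; split.
    by split=> // d Ad; apply: cle; exists d.
  move=> d [Ad dle]; apply: i_inj; apply: (wo_anti wR); last exact: dle.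
  by apply: cle; exists d.
move=> z j j_inj jlt; have /xle : exists k : T -> T, injective k /\ forall t, strict R (k t) (i z).
  by exists (i \o j); split; [apply: inj_comp | exact: jlt].
by apply/negP; apply: ix.
Qed.

(** By well-founded recursion, [f z] is the [R]-least element not yet taken. One is always left: if
    the earlier values exhausted [T], a choice of preimages would inject [T] below [z]. *)
Lemma initial_order_embeds (T : Type) (R0 R : rel T) : well_order R0 ->
  initial_order R0 -> well_order R ->
  exists f : T -> T, forall x y, strict R0 x y -> strict R (f x) (f y).
Proof.
move=> w0 init wR; pose wf := wo_well_founded w0.
pose free z (rec : forall w, strict R0 w z -> T) t := forall w (lt : strict R0 w z), rec w lt <> t.
(* The default [z] covers the case where nothing is free, which [fP] excludes. *)
have step_ex z rec : exists t, (exists u, free z rec u) ->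
    free z rec t /\ forall u, free z rec u -> R t u.
  have [ex|nex] := pselect (exists u, free z rec u); last by exists z.
  by have [t tP] := wo_least wR ex; exists t.
pose step z rec := projT1 (cid (step_ex z rec)).
have stepP z rec := projT2 (cid (step_ex z rec)) : _ -> _.
pose f := Fix wf (fun _ => T) step.
have fE z : f z = step z (fun w _ => f w).
  rewrite /f Fix_eq // => w r1 r2 e; congr step.
  by apply: functional_extensionality_dep => u; apply: functional_extensionality_dep => lt.
have fP z : (forall w, strict R0 w z -> f w <> f z) /\
    forall u, (forall w, strict R0 w z -> f w <> u) -> R (f z) u.
  rewrite (fE z); apply: (stepP z (fun w _ => f w)).
  apply: contrapT => nfree; have pre u : exists w, strict R0 w z /\ f w = u.
    apply: contrapT => nw; apply: nfree; exists u => w lt wu; apply: nw.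
    by exists w.
  have [j jP] := boolp.choice pre; apply: (init z j) => [a c jac|a].
    by have [_ <-] := jP a; have [_ <-] := jP c; rewrite jac.
  by have [] := jP a.
exists f => x y xy; apply/negP => fyx; have [fy _] := fP y; have [_ fx] := fP x.
apply: (fy x xy); apply: (wo_anti wR) => //; apply: fx => w wx.
by apply: fy; apply: (wo_strict_trans w0) xy.
Qed.

(** The index set consists of elements of [G] under an initial order of [G]; this is what bounds the
    length by the cardinal of [G]. *)
Lemma cofinal_sequence (G : oagType) (D : G -> Prop) : (exists g, D g) ->
  (forall g, D g -> exists2 g', D g' & g < g') ->
  exists (I : limit_ordinal) (u : I -> G),
    [/\ forall i, D (u i), forall i j, lo_lt i j -> u i < u j,
        forall g, D g -> exists i, g <= u i & length_le_card I G].
Proof.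
move=> [g0 Dg0] nomax; have [R wR init] := initial_order_exists G.
(* The elements of [D] on which [R] and [<=] agree with respect to their
   [R]-predecessors in [D] form a cofinal set. *)
pose rec g := D g /\ forall d, D d -> strict R d g -> d < g.
have cof g : D g -> exists2 r, rec r & g <= r.
  move=> Dg; have [|r [[Dr gr] rle]] := wo_least wR (A := fun d => D d /\ g <= d).
    by exists g.
  exists r => //; split=> // d Dd lt; rewrite oag_ltNge; apply/negP => rd.
  have := rle d; move: lt; rewrite /strict => /negP lt H; apply: lt; apply: H.
  by split=> //; apply: le_trans rd.
pose I := {g : G | `[< rec g >]}; pose le (i j : I) := R (val i) (val j).
have recP (i : I) : rec (val i) by case: i => g /= /asboolP.
have wle : well_order le.
  move=> A [a Aa]; have [|z [[c [Ac <-]] cle]] := wo_least wR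
      (A := fun w => exists c, c \in A /\ val c = w); first by exists (val a), a.
  exists c; split; first by split=> // d Ad; apply: cle; exists d.
  move=> d [Ad dle]; apply: val_inj; apply: (wo_anti wR); last exact: dle.
  by apply: cle; exists d.
have mkI r : rec r -> exists i : I, val i = r.
  by move=> rr; exists (exist _ r (asboolT rr)).
have inh : inhabited I.
  by have [r /mkI[i _] _] := cof g0 Dg0; constructor.
have lim i : exists j, ~~ le j i.
  have [Di reci] := recP i; have [d Dd id_] := nomax _ Di; have [r rr dr] := cof d Dd.
  have [j ej] := mkI r rr; exists j; apply/negP; rewrite /le ej => ri.
  have lt : val i < r by apply: lt_le_trans dr.
  have [ir|nir] := pselect (R (val i) r).
    by move: lt; rewrite (wo_anti wR ir ri) ltxx.
  have [Dr _] := rr; have := reci r Dr; rewrite /strict => /(_ (introN idP nir)).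
  by rewrite oag_ltNge (ltW lt).
exists (LimitOrdinal wle inh lim), val; split=> [i|i j lt|g Dg|R' wR'].
- by have [] := recP i.
- by have [Di _] := recP i; have [_ recj] := recP j; apply: recj.
- by have [r /mkI[i <-] gr] := cof g Dg; exists i.
- have [f fP] := initial_order_embeds wR init wR'.
  by exists (f \o val) => i j lt; apply: fP.
Qed.

(** * Partial embeddings, as relations *)

Lemma zorn_relation (A B : Type) (C : (A -> B -> Prop) -> Prop) (S0 : A -> B -> Prop) :
  C S0 ->
  (forall F : (A -> B -> Prop) -> Prop, (exists S, F S) -> (forall S, F S -> C S) ->
     (forall S S', F S -> F S' -> (forall x y, S x y -> S' x y) \/
                                  (forall x y, S' x y -> S x y)) ->
     C (fun x y => exists2 S, F S & S x y)) ->
  exists S, [/\ C S, forall x y, S0 x y -> S x y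
    & forall S', C S' -> (forall x y, S x y -> S' x y) -> forall x y, S' x y -> S x y].
Proof.
move=> CS0 Cunion; pose rl (P : {pred A * B}) : A -> B -> Prop := fun x y => (x, y) \in P.
have relE (S : A -> B -> Prop) : rl (fun xy => `[< S xy.1 xy.2 >]) = S.
  by apply/funext => x; apply/funext => y; apply/propext; split=> /asboolP.
pose dom := [pred P : {pred A * B} | `[< C (rl P) /\ forall x y, S0 x y -> rl P x y >]].
pose R (P Q : {pred A * B}) := `[< {subset P <= Q} >].
have [|||P /asboolP[CP S0P] maxP] := @Zorn's_lemma {pred A * B} R dom.
- by move=> P _; apply/asboolP.
- by move=> P Q U _ _ _ /asboolP PQ /asboolP QU; apply/asboolP => x /PQ/QU.
- move=> Ch chdom /(@wo_chainW {pred A * B}) Cchain.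
  (* Only nonempty chains have a union satisfying [C]; the empty one is bounded by [S0]. *)
  have [[P0 CP0]|nex] := pselect (exists P, P \in Ch); last first.
    exists (fun xy => `[< S0 xy.1 xy.2 >]).
      by apply/asboolP; rewrite (relE S0).
    by move=> P CP; case: nex; exists P.
  pose F S := exists2 P, P \in Ch & S = rl P.
  exists (fun xy => `[< exists2 S, F S & S xy.1 xy.2 >]).
    apply/asboolP; rewrite (relE (fun x y => exists2 S, F S & S x y)); split.
      apply: Cunion; first by exists (rl P0), P0.
        by move=> _ [P /chdom/asboolP[CP _] ->].
      move=> _ _ [P CP ->] [Q CQ ->].
      by have /orP[/asboolP PQ|/asboolP PQ] := Cchain P Q CP CQ; [left|right] => x y /PQ.
    move=> x y S0xy; exists (rl P0); first by exists P0.
    by have /asboolP[_] := chdom P0 CP0; apply.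
  move=> P CP; apply/asboolP => -[x y] Pxy; apply/asboolP => /=.
  by exists (rl P) => //; exists P.
exists (rl P); split=> // S' CS' PS' x y S'xy.
have := maxP (fun xy => `[< S' xy.1 xy.2 >]); rewrite inE relE => H.
have /asboolP sub : R (fun xy => `[< S' xy.1 xy.2 >]) P.
  apply: H; first by apply/asboolP; split=> // x' y' /S0P/PS'.
  by apply/asboolP => -[x' y'] Pxy; apply/asboolP; apply: PS'.
by apply: (sub (x, y)); apply/asboolP.
Qed.

Section PartialField.
Variables (M L : vdField) (h : {additive vf_group M -> vf_group L}).
Hypothesis h_mono : {mono h : a b / a <= b}.
Hypothesis h_sigma : forall g, h (vdf_sigma_group g) = vdf_sigma_group (h g).
Implicit Types S Phi : M -> L -> Prop.

(* A partial embedding of [M] in [L] is given by its graph, a subfield of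
   [M * L]; being compatible with the valuations makes it functional. *)
Definition compatible S : Prop := forall x y, S x y -> vval y = omap h (vval x).

Record is_pfield Phi : Prop := IsPField {
  pf_1 : Phi 1 1;
  pf_B : forall x y x' y', Phi x y -> Phi x' y' -> Phi (x - x') (y - y');
  pf_M : forall x y x' y', Phi x y -> Phi x' y' -> Phi (x * x') (y * y');
  pf_V : forall x y, Phi x y -> Phi x^-1 y^-1;
  pf_val : compatible Phi
}.

Section PField.
Variable Phi : M -> L -> Prop.
Hypothesis pf : is_pfield Phi.

Lemma pf_fun x y y' : Phi x y -> Phi x y' -> y = y'.
Proof.
move=> xy xy'; have := pf_val pf (pf_B pf xy xy'); rewrite subrr val0 /=.
by move/vf_val_eq0/eqP; rewrite subr_eq0 => /eqP.
Qed.

End PField.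

Lemma pfield_union (F : (M -> L -> Prop) -> Prop) : (exists S, F S) ->
  (forall S, F S -> is_pfield S) ->
  (forall S S', F S -> F S' -> (forall x y, S x y -> S' x y) \/
                               (forall x y, S' x y -> S x y)) ->
  is_pfield (fun x y => exists2 S, F S & S x y).
Proof.
move=> [S0 FS0] Fpf Fch.
have common x y x' y' : (exists2 S, F S & S x y) -> (exists2 S, F S & S x' y') ->
    exists S, [/\ F S, S x y & S x' y'].
  move=> [S FS Sxy] [S' FS' Sxy'].
  by have [/(_ _ _ Sxy)|/(_ _ _ Sxy')] := Fch S S' FS FS'; [exists S'|exists S].
split.
- by exists S0 => //; apply: pf_1; apply: Fpf.
- move=> x y x' y' xy xy'; have [S [FS Sxy Sxy']] := common _ _ _ _ xy xy'.
  by exists S => //; apply: pf_B => //; apply: Fpf.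
- move=> x y x' y' xy xy'; have [S [FS Sxy Sxy']] := common _ _ _ _ xy xy'.
  by exists S => //; apply: pf_M => //; apply: Fpf.
- by move=> x y [S FS Sxy]; exists S => //; apply: pf_V => //; apply: Fpf.
- by move=> x y [S FS Sxy]; apply: (pf_val (Fpf S FS)).
Qed.

Lemma pfield_maximal Phi : is_pfield Phi ->
  exists Psi, [/\ is_pfield Psi, forall x y, Phi x y -> Psi x y
    & forall Psi', is_pfield Psi' -> (forall x y, Psi x y -> Psi' x y) ->
        forall x y, Psi' x y -> Psi x y].
Proof. by move=> pf; apply: zorn_relation pf _; apply: pfield_union. Qed.

(** The graph is bundled with its proof so that the field structure of [pf_type P] can be inferred
    from the type alone. *)
Record pfield_sig := PFieldSig { pfs_rel : M -> L -> Prop; pfs_ok : is_pfield pfs_rel }.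

Section PFieldType.
Variable P : pfield_sig.
Local Notation Phi := (pfs_rel P).
Let pf : is_pfield Phi := pfs_ok P.

Definition pf_dom : {pred M} := fun x => `[< exists y, Phi x y >].

Lemma pf_domP x : reflect (exists y, Phi x y) (x \in pf_dom).
Proof. exact: asboolP. Qed.

Lemma pf_dom_closed : GRing.divring_closed pf_dom.
Proof.
split=> [|x x' /pf_domP[y xy] /pf_domP[y' xy']|x x' /pf_domP[y xy] /pf_domP[y' xy']];
  apply/pf_domP.
- by exists 1; apply: pf_1.
- by exists (y - y'); apply: pf_B.
- by exists (y / y'); apply: pf_M => //; apply: pf_V.
Qed.

HB.instance Definition _ := GRing.isDivringClosed.Build M pf_dom pf_dom_closed.

Record pf_type := PfType { pf_type_val : M; _ : pf_type_val \in pf_dom }.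
HB.instance Definition _ := [isSub for pf_type_val].
HB.instance Definition _ := [Choice of pf_type by <:].
HB.instance Definition _ := [SubChoice_isSubIntegralDomain of pf_type by <:].
HB.instance Definition _ := [SubIntegralDomain_isSubField of pf_type by <:].

Lemma pf_image_ex (x : pf_type) : exists y, Phi (pf_type_val x) y.
Proof. by case: x => x /= /pf_domP. Qed.
Definition pf_image (x : pf_type) : L := projT1 (cid (pf_image_ex x)).
Lemma pf_imageP x : Phi (pf_type_val x) (pf_image x).
Proof. exact: projT2 (cid (pf_image_ex x)). Qed.

Lemma pf_image_zmod : zmod_morphism pf_image.
Proof.
move=> x y; apply: (pf_fun pf); first exact: pf_imageP.
by apply: (pf_B pf); apply: pf_imageP.
Qed.
Lemma pf_image_monoid : monoid_morphism pf_image.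
Proof.
split=> [|x y]; apply: (pf_fun pf); try exact: pf_imageP; first exact: pf_1.
by apply: (pf_M pf); apply: pf_imageP.
Qed.
HB.instance Definition _ :=
  GRing.isZmodMorphism.Build pf_type L pf_image pf_image_zmod.
HB.instance Definition _ :=
  GRing.isMonoidMorphism.Build pf_type L pf_image pf_image_monoid.

Lemma pfield_type_sig : exists (E : fieldType) (p : {rmorphism E -> M})
  (q : {rmorphism E -> L}), forall x y, Phi x y <-> exists2 e, p e = x & q e = y.
Proof.
exists pf_type, (\val : pf_type -> M), pf_image => x y; split=> [xy|[e <- <-]].
  have xd : x \in pf_dom by apply/pf_domP; exists y.
  exists (PfType xd) => //; apply: (pf_fun pf) xy.
  exact: (pf_imageP (PfType xd)).
exact: pf_imageP.
Qed.

End PFieldType.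

Lemma pfield_type Phi : is_pfield Phi -> exists (E : fieldType) (p : {rmorphism E -> M})
  (q : {rmorphism E -> L}), forall x y, Phi x y <-> exists2 e, p e = x & q e = y.
Proof. by move=> pf; apply: (pfield_type_sig (PFieldSig pf)). Qed.

(** * The ring and the field generated by a graph *)

Inductive gen S : M -> L -> Prop :=
| gen_in x y : S x y -> gen S x y
| gen_B x y x' y' : gen S x y -> gen S x' y' -> gen S (x - x') (y - y')
| gen_M x y x' y' : gen S x y -> gen S x' y' -> gen S (x * x') (y * y').

Lemma gen_sub S S' : (forall x y, S x y -> S' x y) -> forall x y, gen S x y -> gen S' x y.
Proof.
move=> SS' x y; elim=> {x y} [x y /SS'|x y x' y' _ IH _ IH'|x y x' y' _ IH _ IH'].
- exact: gen_in.
- exact: gen_B.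
- exact: gen_M.
Qed.

Definition rel_frac (S : M -> L -> Prop) x y : Prop := exists u w u' w',
  [/\ gen S u w, gen S u' w', u' <> 0, x = u / u' & y = w / w'].

Lemma compatible_neq0 S x y : compatible S -> S x y -> x <> 0 -> y <> 0.
Proof.
move=> cS xy /val_neq0[g vx] y0; have := cS _ _ xy.
by rewrite y0 val0 vx.
Qed.

Lemma rel_frac_in S x y : S 1 1 -> S x y -> rel_frac S x y.
Proof.
move=> S1 Sxy; exists x, y, 1, 1; split; rewrite ?divr1 //; try exact: gen_in.
exact/eqP/oner_neq0.
Qed.

(** Compatibility on the generated ring is enough: it keeps denominators nonzero on both sides and
    determines the values of quotients. *)
Lemma rel_frac_pfield S : S 1 1 -> compatible (gen S) -> is_pfield (rel_frac S).
Proof.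
move=> S1 cS; have neq0 u w : gen S u w -> u <> 0 -> w <> 0.
  exact: compatible_neq0.
have g1 : gen S 1 1 by apply: gen_in.
have g0 : gen S 0 0 by have := gen_B g1 g1; rewrite !subrr.
split.
- exact: rel_frac_in.
- move=> _ _ _ _ [u [w [u' [w' [uw uw' u'0 -> ->]]]]] [v [z [v' [z' [vz vz' v'0 -> ->]]]]].
  have w'0 := neq0 _ _ uw' u'0; have z'0 := neq0 _ _ vz' v'0.
  exists (u * v' - v * u'), (w * z' - z * w'), (u' * v'), (w' * z'); split.
  + by apply: gen_B; apply: gen_M.
  + exact: gen_M.
  + by apply/eqP; rewrite mulf_neq0 //; apply/eqP.
  + by rewrite -mulNr addf_div ?mulNr //; apply/eqP.
  + by rewrite -mulNr addf_div ?mulNr //; apply/eqP.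
- move=> _ _ _ _ [u [w [u' [w' [uw uw' u'0 -> ->]]]]] [v [z [v' [z' [vz vz' v'0 -> ->]]]]].
  exists (u * v), (w * z), (u' * v'), (w' * z'); rewrite !mulf_div; split=> //.
  + exact: gen_M.
  + exact: gen_M.
  + by apply/eqP; rewrite mulf_neq0 //; apply/eqP.
- move=> _ _ [u [w [u' [w' [uw uw' u'0 -> ->]]]]]; rewrite !invf_div.
  have [u0|u0] := pselect (u = 0).
    have w0 : w = 0 by apply/vf_val_eq0; rewrite (cS _ _ uw) u0 val0.
    exists 0, 0, 1, 1; rewrite u0 w0 !invr0 !mulr0 !mul0r; split=> //.
    exact/eqP/oner_neq0.
  by exists u', w', u, w.
- move=> _ _ [u [w [u' [w' [uw uw' u'0 -> ->]]]]].
  rewrite !vf_valM !valV (cS _ _ uw) (cS _ _ uw').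
  by case: (vval u) => [a|] //; case: (vval u') => [b|] //=; rewrite raddfD raddfN.
Qed.

End PartialField.

(** * Realizing a cut by a pseudo-limit *)

Section Realize.
Variables (M : vdField) (E : fieldType) (p : {rmorphism E -> M}).
Variables (n : nat) (s : 'I_n.+1 -> E -> E).
Hypothesis p_sigma : forall i e, p (s i e) = iter i sigma (p e).
Hypothesis pchar_res : [pchar (vf_residue M)] =i pred0.
Variable b : M.
Hypothesis b_notin : forall e, b <> p e.
Hypothesis p_dense : forall x : M, x <> 0 ->
  exists e, elt (vval x) (vval (x - p e)).
(** [G0] is meant to be the value group of the base field: lengths are bounded by its cardinal,
    while cuts have values in the isomorphic group of [M]. *)
Variables (G0 : oagType) (phi : G0 -> vf_group M).
Hypothesis phi_mono : {mono phi : a c / a <= c}.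
Hypothesis phi_surj : forall g, exists a, phi a = g.
Variable T : target p s.
Local Notation q := (tg_emb T).
Local Notation h := (tg_group T).
Local Notation cv := (cut_val p b).

Lemma cofinal_selection (A : E -> Prop) :
  (forall c, exists2 e, A e & cv c <= cv e) ->
  exists (I : limit_ordinal) (sel : I -> E),
    [/\ forall i, A (sel i), forall i j, lo_lt i j -> cv (sel i) < cv (sel j),
        forall c, exists i, cv c <= cv (sel i) & length_le_card I G0].
Proof.
move=> Acof; have [||I [u [uD u_lt u_cof I_len]]] :=
    @cofinal_sequence G0 (fun g => exists2 e, A e & cv e = phi g).
- have [e Ae _] := Acof 0; have [g eg] := phi_surj (cv e).
  by exists g, e.
- move=> g [e Ae eg]; have [c ec] := cut_val_nomax b_notin p_dense e.
  have [e' Ae' ce'] := Acof c; have [g' eg'] := phi_surj (cv e').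
  exists g'; first by exists e'.
  by rewrite -(oag_mono_lt phi_mono) -eg eg'; apply: lt_le_trans ec ce'.
have pre i : exists e, A e /\ cv e = phi (u i) by have [e Ae ee] := uD i; exists e.
have [sel selP] := boolp.choice pre.
exists I, sel; split=> // [i|i j ij|c].
- by have [] := selP i.
- have [_ ->] := selP i; have [_ ->] := selP j.
  by rewrite (oag_mono_lt phi_mono); apply: u_lt.
- have [e Ae ce] := Acof c; have [g eg] := phi_surj (cv e).
  have [|i gi] := u_cof g; first by exists e.
  by exists i; have [_ ->] := selP i; rewrite (le_trans ce) // -eg phi_mono.
Qed.

Section Selection.
Variables (I : limit_ordinal) (sel : I -> E).
Hypothesis sel_lt : forall i j, lo_lt i j -> cv (sel i) < cv (sel j).
Hypothesis sel_cof : forall c, exists i, cv c <= cv (sel i).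

Lemma sel_val i j : lo_lt i j -> vval (q (sel j) - q (sel i)) = Some (h (cv (sel i))).
Proof.
move=> ij; rewrite -rmorphB tg_val rmorphB.
by rewrite (cut_val_lt b_notin (sel_lt ij)).
Qed.

Lemma sel_pc : pc_seq (fun i => q (sel i)).
Proof.
have [i0] := lo_inh I; exists i0 => i j k _ ij jk.
by rewrite !sel_val // elt_Some (oag_mono_lt (@tg_mono _ _ _ _ _ T)) sel_lt.
Qed.

Lemma sel_realizes (y : T) : pseudo_limit (fun i => q (sel i)) y -> realizes b y.
Proof.
move=> [i0 lim] c; have next (i : I) : exists j, lo_lt i j by have [j ij] := lo_lim i; exists j.
have yi i : lo_le i0 i -> vval (y - q (sel i)) = Some (h (cv (sel i))).
  move=> i0i; have [j ij] := next i; have := lim i j i0i ij.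
  have -> : y - q (sel j) = (y - q (sel i)) - (q (sel j) - q (sel i)) by ring.
  by move/valB_lt; rewrite sel_val.
have [c' cc'] := cut_val_nomax b_notin p_dense c; have [i1 c'i1] := sel_cof c'.
have [i [i0i ci]] : exists i, lo_le i0 i /\ cv c < cv (sel i).
  have [i10|ni10] := pselect (lo_lt i1 i0).
    exists i0; split; first exact: (wo_refl (@lo_wo I)).
    by apply: lt_trans (sel_lt i10); apply: lt_le_trans c'i1.
  exists i1; split; last by apply: lt_le_trans c'i1.
  by apply: contrapT => ni01; apply: ni10; apply/negP.
rewrite -[y](subrK (q (sel i))) -addrA addrC valD_lt -(rmorphB q) tg_val rmorphB.
  by rewrite (cut_val_lt b_notin ci).
rewrite (cut_val_lt b_notin ci) yi //= elt_Some.
by rewrite (oag_mono_lt (@tg_mono _ _ _ _ _ T)).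
Qed.

End Selection.

Lemma realizes_complete :
  (forall (I : limit_ordinal) (t : I -> T), pc_seq t -> length_le_card I G0 ->
     exists y, pseudo_limit t y) ->
  exists y : T, realizes b y.
Proof.
move=> compl; have [|I [sel [_ sel_lt sel_cof I_len]]] := @cofinal_selection (fun _ => True).
  by move=> c; exists c.
have [y lim] := compl I _ (sel_pc sel_lt) I_len.
by exists y; apply: sel_realizes lim.
Qed.

(** The sequence is drawn from approximate roots, along which the value of [P] increases strictly;
    it is then its own witness for being of sigma-algebraic type. *)
Lemma realizes_algebraic (P : {mpoly E[n.+1]}) (c0 : E) (x : M) :
  (forall (I : limit_ordinal) (t : I -> T), pc_seq t -> sigma_alg_type t ->
     length_le_card I G0 -> exists y, pseudo_limit t y) ->
  axiom2 M -> P <> 0 -> (forall c, ~ stable_at p b P c) ->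
  (forall I, I <> 0%MM -> taylor P I <> 0 -> stable_at p b (taylor P I) c0) ->
  @realizes M E p n s b (self_target p_sigma) x -> sp_eval (map_mpoly p P) x = 0 ->
  exists y : T, realizes b y.
Proof.
move=> compl ax2 P_neq0 P_unstab P_taylor xcut Px.
have indep (u : 'I_n.+1 -> vf_residue M) : (exists j, u j <> 0) ->
    exists r, \sum_(j < n.+1) u j * iter j (@vdf_sigma_residue M) r <> 0.
  move=> [j uj]; apply: contrapT => nex; apply: uj.
  have := @residue_independent M n.+1 (fun k => u (inord k)) ax2 _ j (ltn_ord j).
  rewrite inord_val; apply => r; apply: contrapT => r0; apply: nex; exists r.
  by under eq_bigr do rewrite -[u _](congr1 u (inord_val _)).
have ex := approx_root_exists pchar_res b_notin p_dense P_neq0 P_unstab P_taylor indep xcut Px.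
have [|I [sel [selA sel_lt sel_cof I_len]]] :=
    @cofinal_selection (approx_root p_sigma b P c0).
  move=> c; have /orP[le|le] := oag_le_total (cv c) (cv c0).
    by have [e ee Ae] := ex c0 (lexx _); exists e; rewrite ?ee.
  by have [e ee Ae] := ex c le; exists e; rewrite ?ee.
have [|y lim] := compl I _ (sel_pc sel_lt) _ I_len; last first.
  by exists y; apply: sel_realizes lim.
exists n, (map_mpoly q P), (fun i => q (sel i)); split; first exact: sel_pc.
  by move=> K' f y.
have [i0] := lo_inh I; exists i0 => i j _ ij; rewrite !sub0r !valN !(tg_poly_val p_sigma).
rewrite omap_elt; last exact: tg_mono.
exact: approx_root_lt (selA i) (selA j) (sel_lt i j ij).
Qed.

End Realize.

(** * One-step extensions of a partial embedding *)

Lemma meval_map_sum (R S : comNzRingType) (f : {rmorphism R -> S}) n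
    (Q : {mpoly R[n]}) (v : 'I_n -> S) :
  (map_mpoly f Q).@[v] = \sum_(m <- msupp Q) f Q@_m * \prod_(i < n) v i ^+ m i.
Proof.
have -> : map_mpoly f Q = \sum_(m <- msupp Q) f Q@_m *: 'X_[m].
  rewrite [in LHS](mpolyE Q) raddf_sum; apply: eq_bigr => m _ /=.
  by rewrite map_mpolyZ map_mpolyX.
rewrite raddf_sum; apply: eq_bigr => m _ /=.
by rewrite mevalZ mevalX.
Qed.

Section Step.
Variables (M L : vdField) (h : {additive vf_group M -> vf_group L}).
Hypothesis h_mono : {mono h : a b / a <= b}.
Hypothesis h_sigma : forall g, h (vdf_sigma_group g) = vdf_sigma_group (h g).
Implicit Types S Phi Psi : M -> L -> Prop.

Definition in_dom Phi x := exists y, Phi x y.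

Definition dense Phi := forall x : M, x <> 0 ->
  exists u w, Phi u w /\ elt (vval x) (vval (x - u)).

Definition nclosed n Phi := forall x y, Phi x y ->
  forall i : 'I_n.+1, Phi (iter i sigma x) (iter i sigma y).

Definition adjS Phi k (x : M) (y : L) : M -> L -> Prop := fun u w =>
  Phi u w \/ exists i, [/\ (i < k)%N, u = iter i sigma x & w = iter i sigma y].

Definition cut_of Phi b y := forall u w, Phi u w -> vval (y - w) = omap h (vval (b - u)).

Lemma gen_sum S (I : Type) (r : seq I) (u : I -> M) (w : I -> L) : S 1 1 ->
  (forall i, gen S (u i) (w i)) -> gen S (\sum_(i <- r) u i) (\sum_(i <- r) w i).
Proof.
move=> S1 Suw; have g0 : gen S 0 0.
  by have := gen_B (gen_in S1) (gen_in S1); rewrite !subrr.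
elim/big_rec2: _ => // i a c _ ac.
have := gen_B (Suw i) (gen_B g0 ac).
by rewrite !sub0r !opprK.
Qed.

Lemma gen_prod S (I : finType) (u : I -> M) (w : I -> L) : S 1 1 ->
  (forall i, gen S (u i) (w i)) -> gen S (\prod_i u i) (\prod_i w i).
Proof.
move=> S1 Suw; elim/big_rec2: _ => [|i a c _ ac]; first exact: gen_in.
exact: gen_M.
Qed.

Lemma gen_exp S u w m : S 1 1 -> gen S u w -> gen S (u ^+ m) (w ^+ m).
Proof.
move=> S1 Suw; elim: m => [|m IH]; first by rewrite !expr0; apply: gen_in.
by rewrite !exprS; apply: gen_M.
Qed.

Lemma gen_pfield Phi : is_pfield h Phi -> forall u w, gen Phi u w -> Phi u w.
Proof.
move=> pf u w; elim=> {u w} // [u w u' w' _ IH _ IH'|u w u' w' _ IH _ IH'].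
  exact: (pf_B pf).
exact: (pf_M pf).
Qed.

Section Polynomials.
Variables (Phi : M -> L -> Prop) (E : fieldType).
Variables (p : {rmorphism E -> M}) (q : {rmorphism E -> L}).
Hypothesis PhiE : forall x y, Phi x y <-> exists2 e, p e = x & q e = y.
Variables (n : nat) (x : M) (y : L).

Lemma Phi_pq e : Phi (p e) (q e). Proof. by apply/PhiE; exists e. Qed.

Lemma poly_gen_adj k (Q : {mpoly E[n.+1]}) : supp_in (vars_lt k) Q ->
  gen (adjS Phi k x y) (sp_eval (map_mpoly p Q) x) (sp_eval (map_mpoly q Q) y).
Proof.
move=> Qk; have S1 : adjS Phi k x y 1 1.
  by left; rewrite -(rmorph1 p) -(rmorph1 q); apply: Phi_pq.
rewrite /sp_eval !meval_map_sum big_seq [X in gen _ _ X]big_seq.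
rewrite big_mkcond [X in gen _ _ X]big_mkcond; apply: gen_sum => // m.
case: ifP => [/Qk mk|_]; last first.
  by have := gen_B (gen_in S1) (gen_in S1); rewrite !subrr.
apply: gen_M; first by apply: gen_in; left; apply: Phi_pq.
apply: gen_prod => // i; have [ki|ik] := leqP k i.
  by rewrite mk // !expr0; apply: gen_in.
by apply: gen_exp => //; apply: gen_in; right; exists i.
Qed.

Lemma gen_adj_poly k u w : (k <= n.+1)%N -> gen (adjS Phi k x y) u w ->
  exists Q : {mpoly E[n.+1]}, [/\ supp_in (vars_lt k) Q,
    u = sp_eval (map_mpoly p Q) x & w = sp_eval (map_mpoly q Q) y].
Proof.
move=> kn; elim=> {u w} [u w|u w u' w' _ [Q [Qk -> ->]] _ [Q' [Qk' -> ->]]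
    |u w u' w' _ [Q [Qk -> ->]] _ [Q' [Qk' -> ->]]].
- case=> [/PhiE[e <- <-]|[i [ik -> ->]]].
    exists e%:MP; split; rewrite ?map_mpolyC /sp_eval ?mevalC //.
    move=> m; rewrite msuppC; case: eqP => // _; rewrite inE => /eqP -> j _.
    by rewrite mnm0E.
  have i_n : (i < n.+1)%N by apply: leq_trans kn.
  exists 'X_(Ordinal i_n); split; rewrite ?map_mpolyX /sp_eval ?mevalXU //.
  apply: supp_inX => j kj; rewrite mnm1E; case: eqP => // /(congr1 val) /= ij.
  by move: ik; rewrite ij ltnNge kj.
- exists (Q - Q'); split; first exact: supp_inB.
    by rewrite raddfB /sp_eval /= mevalB.
  by rewrite raddfB /sp_eval /= mevalB.
- exists (Q * Q'); split.
  + by apply: (supp_inM _ Qk Qk') => m m' mk mk' j kj; rewrite mnmDE mk ?mk'.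
  + by rewrite rmorphM /sp_eval /= mevalM.
  + by rewrite rmorphM /sp_eval /= mevalM.
Qed.

Lemma lift_mpoly (F : {mpoly M[n.+1]}) : (forall m, in_dom Phi F@_m) ->
  exists Q : {mpoly E[n.+1]}, map_mpoly p Q = F.
Proof.
move=> Fdom; have pre m : exists e, p e = F@_m.
  by have [w /PhiE[e pe _]] := Fdom m; exists e.
have [e eP] := boolp.choice pre.
exists (\sum_(m <- msupp F) e m *: 'X_[m]); rewrite raddf_sum /= [RHS](mpolyE F).
by apply: eq_bigr => m _; rewrite map_mpolyZ map_mpolyX eP.
Qed.

End Polynomials.

Lemma pfield_context Phi n : is_pfield h Phi -> nclosed n Phi ->
  exists (E : fieldType) (p : {rmorphism E -> M}) (q : {rmorphism E -> L})
    (s : 'I_n.+1 -> E -> E),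
  [/\ forall x y, Phi x y <-> exists2 e, p e = x & q e = y,
      forall i e, p (s i e) = iter i sigma (p e),
      forall i e, q (s i e) = iter i sigma (q e)
    & forall e, vval (q e) = omap h (vval (p e))].
Proof.
move=> pf ncl; have [E [p [q PhiE]]] := pfield_type pf.
have pre (ie : 'I_n.+1 * E) : exists e', p e' = iter ie.1 sigma (p ie.2) /\
    q e' = iter ie.1 sigma (q ie.2).
  have /PhiE[e' pe' qe'] := ncl _ _ (Phi_pq PhiE ie.2) ie.1.
  by exists e'.
have [s sP] := boolp.choice pre.
exists E, p, q, (fun i e => s (i, e)); split=> // [i e|i e|e].
- by have [] := sP (i, e).
- by have [] := sP (i, e).
- by apply: (pf_val pf); apply: (Phi_pq PhiE).
Qed.

(** A polynomial in one variable is encoded as a sigma-polynomial of order 0, so that the order-0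
    results on cuts apply to it directly. *)
Definition root_over (D : M -> Prop) (z : M) : Prop := exists F : {mpoly M[1]},
  [/\ F <> 0, forall m, D F@_m & sp_eval F z = 0].

Hypothesis pchar_res : [pchar (vf_residue M)] =i pred0.
Hypothesis ax2 : axiom2 M.
Hypothesis hensM : sigma_henselian M.
Hypothesis hensL : sigma_henselian L.
Variables (G0 : oagType) (phi : G0 -> vf_group M).
Hypothesis phi_mono : {mono phi : a c / a <= c}.
Hypothesis phi_surj : forall g, exists a, phi a = g.
Hypothesis alg_complete : forall (I : limit_ordinal) (t : I -> L),
  pc_seq t -> sigma_alg_type t -> length_le_card I G0 -> exists y, pseudo_limit t y.

Lemma cut_exists Phi b : is_pfield h Phi -> dense Phi -> ~ in_dom Phi b ->
  (forall (I : limit_ordinal) (t : I -> L), pc_seq t -> length_le_card I G0 ->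
     exists y, pseudo_limit t y) ->
  exists y, cut_of Phi b y.
Proof.
move=> pf dns b_notin compl.
(* Filling a cut involves no compatibility with sigma, so order 0 suffices. *)
have [|E [p [q [s [PhiE ps qs qv]]]]] := @pfield_context Phi 0 pf.
  by move=> x y xy i; rewrite (ord1 i).
have b_notinE e : b <> p e.
  by move=> be; apply: b_notin; exists (q e); apply/PhiE; exists e.
have dnsE (x : M) : x <> 0 -> exists e, elt (vval x) (vval (x - p e)).
  by move=> /dns[u [w [/PhiE[e <- _] lt]]]; exists e.
pose T : target p s := @Target M E p 0 s L q h h_mono h_sigma qs qv.
have [y ycut] := realizes_complete b_notinE dnsE phi_mono phi_surj (T := T) compl.
exists y => u w /PhiE[e <- <-]; rewrite (ycut e).
by rewrite (cut_valE b_notinE).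
Qed.

(** The cases are whether or not some polynomial over the domain is nowhere stable on the cut of
    [b]. In the first, [x] is a root of such a polynomial in that cut, usually different from
    [b]. *)
Lemma extension_dichotomy Phi n b : is_pfield h Phi -> dense Phi -> nclosed n Phi -> ~ in_dom Phi b ->
  (exists k x y, [/\ (k <= n)%N, ~ in_dom Phi x,
      compatible h (gen (adjS Phi k.+1 x y)),
      root_over (fun z => exists w, gen (adjS Phi k x y) z w) (iter k sigma x)
    & n = 0%N -> forall Psi y', is_pfield h Psi -> (forall u w, Phi u w -> Psi u w) ->
        Psi x y' -> y' = y])
  \/ ((forall y, cut_of Phi b y -> compatible h (gen (adjS Phi n.+1 b y))) /\
      forall F : {mpoly M[n.+1]}, F <> 0 -> (forall m, in_dom Phi F@_m) ->
        sp_eval F b <> 0).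
Proof.
move=> pf dns ncl b_notin.
have [E [p [q [s [PhiE ps qs qv]]]]] := pfield_context pf ncl.
have b_notinE e : b <> p e.
  by move=> be; apply: b_notin; exists (q e); apply/PhiE; exists e.
have dnsE (x : M) : x <> 0 -> exists e, elt (vval x) (vval (x - p e)).
  by move=> /dns[u [w [/PhiE[e <- _] lt]]]; exists e.
pose T : target p s := @Target M E p n s L q h h_mono h_sigma qs qv.
pose sT := self_target ps.
have [[Q UQ]|nQ] := pselect (exists Q : {mpoly E[n.+1]}, Q <> 0 /\ forall c, ~ stable_at p b Q c).
- left; have [k [d [P [c0 mu]]]] := min_unstable_exists ps pchar_res b_notinE (ex_intro _ Q UQ).
  have [P_neq0 P_unstab P_taylor Pk Pd Plead d_gt0 low] := mu.
  have bcut : @realizes M E p n s b sT b by apply: realizes_self.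
  (* The root in [M] comes first: approximate roots near it give the pc-sequence that puts a point
     [y0] of [L] in the cut, and only then can a root be found in [L]. *)
  have [x xcut Px] := unstable_root ps pchar_res b_notinE dnsE P_neq0 P_unstab P_taylor
     (T := sT) hensM bcut.
  have [y0 ycut0] := realizes_algebraic pchar_res b_notinE dnsE phi_mono phi_surj (T := T)
     alg_complete ax2 P_neq0 P_unstab P_taylor xcut Px.
  have [y ycut Py] := unstable_root ps pchar_res b_notinE dnsE P_neq0 P_unstab P_taylor
     (T := T) hensL ycut0.
  have compat := min_unstable_compat mu xcut ycut Px Py.
  exists k, x, y; split.
  + by rewrite -ltnS.
  + move=> [w /PhiE[e pe _]]; have := xcut e; rewrite /= pe subrr val0.
    by [].
  + move=> u w /(gen_adj_poly PhiE (ltn_ord k))[Q' [Qk' -> ->]].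
    exact: compat.
  + have vars_k e : supp_in (fun m => m k = 0%N /\ vars_lt k.+1 m) (xcoef k P e).
      by apply: xcoef_supp Pk => m mk j /mk mj; rewrite mnmBE mj.
    pose c e := sp_eval (map_mpoly p (xcoef k P e)) x.
    pose c' e := sp_eval (map_mpoly q (xcoef k P e)) y.
    have cgen e : gen (adjS Phi k x y) (c e) (c' e).
      apply: (poly_gen_adj PhiE); apply: supp_inW (vars_k e) => m [mk mvars] j.
      rewrite leq_eqVlt => /predU1P[kj|/mvars //].
      by rewrite -(_ : k = j) //; apply: val_inj.
    have S1 : adjS Phi k x y 1 1 by left; apply: (pf_1 pf).
    have gnat (t : bool) : gen (adjS Phi k x y) t%:R t%:R.
      case: t; first exact: gen_in.
      by have := gen_B (gen_in S1) (gen_in S1); rewrite !subrr.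
    (* This is [P] as a polynomial in ['X_k], with the lower iterates of [x] substituted for the
       other variables. Its leading coefficient is stable, hence nonzero at [x]. *)
    exists (\sum_(e < d.+1) c e *: 'X_[U_(ord0) *+ e]).
    have Fcoef (m : 'X_{1..1}) : (\sum_(e < d.+1) c e *: 'X_[U_(ord0) *+ e])@_m
        = \sum_(e < d.+1) c e * ((U_(ord0) *+ e)%MM == m)%:R.
      by rewrite raddf_sum; apply: eq_bigr => e _; rewrite /= mcoeffZ mcoeffX.
    split=> [F0|m|].
    * have := Fcoef (U_(ord0) *+ d)%MM; rewrite F0 mcoeff0 big_ord_recr /= eqxx mulr1.
      rewrite big1 ?add0r => [cd0|e _]; last first.
        case: eqP => [/mnmP/(_ ord0)|_]; last by rewrite mulr0.
        rewrite !mulmnE mnm1E eqxx !mul1n => ed.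
        by have := ltn_ord e; rewrite ed ltnn.
      have [||g stab_lead] := low _ Plead.
      - by apply: supp_inW (vars_k d) => m [].
      - by apply: supp_inW (vars_k d) => m [->].
      have := self_stab_val ps stab_lead (x := x); rewrite [vval (x - _)]xcut ele_refl.
      rewrite -/(c d) -cd0 val0 => /(_ isT) e0.
      by have [a] := elt_None (stab_lead _ (@mnmU_neq0 _ ord0)); rewrite -e0.
    * rewrite Fcoef; exists (\sum_(e < d.+1) c' e * ((U_(ord0) *+ e)%MM == m)%:R).
      by apply: gen_sum => // e; apply: gen_M.
    * rewrite -[RHS]Px; rewrite [in RHS](@xcoef_sum _ _ k P d.+1 Pd).
      rewrite /sp_eval [LHS]raddf_sum [X in _ = X.@[_]]raddf_sum [RHS]raddf_sum.
      apply: eq_bigr => e _.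
      rewrite /= mevalZ mevalX big_ord1 mulmnE mnm1E eqxx mul1n.
      by rewrite rmorphM mevalM !rmorphXn /= map_mpolyX mevalXU.
  (* Values under [Psi] force [y'] into the image cut and make it a root of the image of [P]. *)
  + move=> n0 Psi y' pfPsi PhiPsi Psixy'.
    have y'cut : @realizes M E p n s b T y'.
      move=> e; have Pe : Psi (p e) (q e) by apply: PhiPsi; apply: (Phi_pq PhiE).
      have := pf_val pfPsi (pf_B pfPsi Psixy' Pe) => /= ->.
      by have := xcut e; rewrite /= => ->.
    apply: (unstable_root_unique ps pchar_res P_neq0 P_unstab P_taylor (T := T) n0 y'cut ycut _ Py).
    have : Psi (sp_eval (map_mpoly p P) x) (sp_eval (map_mpoly q P) y').
      apply: (gen_pfield pfPsi).
      have := @poly_gen_adj Phi E p q PhiE n x y' n.+1 P; move=> gP.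
      apply: gen_sub (gP _); last by move=> m _ j; rewrite leqNgt ltn_ord.
      move=> u w [/PhiPsi //|[i [i_n -> ->]]].
      by move: i_n; rewrite n0 ltnS leqn0 => /eqP ->.
    rewrite Px => /(pf_val pfPsi); rewrite val0.
    by move/vf_val_eq0.
right; have stabE (Q : {mpoly E[n.+1]}) : Q <> 0 -> exists c, stable_at p b Q c.
  move=> Q0; apply: contrapT => nst; apply: nQ; exists Q; split=> // c cQ.
  by apply: nst; exists c.
split=> [y ycut u w /(gen_adj_poly PhiE (leqnn _))[Q [_ -> ->]]|F F0 Fdom Fb].
  have [->|/eqP/stabE[c Qc]] := eqVneq Q 0; first by rewrite !raddf0 !sp_eval0 !val0.
  rewrite (self_stab_val ps Qc); last by rewrite (cut_valE b_notinE) ele_refl.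
  have := @stab_val _ _ _ _ _ ps b T Q c y Qc => ->//.
  by rewrite (ycut _ _ (Phi_pq PhiE c)) (cut_valE b_notinE) ele_refl.
have [Q QF] := lift_mpoly PhiE Fdom.
have Q0 : Q <> 0 by move=> Q0; apply: F0; rewrite -QF Q0 raddf0.
have [c Qc] := stabE Q Q0; have := self_stab_val ps Qc (x := b).
rewrite (cut_valE b_notinE) ele_refl QF Fb val0 => /(_ isT) e.
by have [g] := elt_None (Qc _ (@mnmU_neq0 _ ord0)); rewrite -e.
Qed.

End Step.

(** * Relative algebraic closure and maximal partial embeddings *)

(** The relative algebraic closure of [D] in [M], generated by its closure properties so that facts
    about it are proved by induction on them. *)
Inductive aclos (M : vdField) (D : M -> Prop) : M -> Prop :=
| ac_in x : D x -> aclos D x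
| ac_B x y : aclos D x -> aclos D y -> aclos D (x - y)
| ac_M x y : aclos D x -> aclos D y -> aclos D (x * y)
| ac_V x : aclos D x -> aclos D x^-1
| ac_root (F : {mpoly M[1]}) x : F <> 0 -> (forall m, aclos D F@_m) ->
    sp_eval F x = 0 -> aclos D x.

Lemma aclos_sigma (M : vdField) (D : M -> Prop) :
  (forall x, D x -> aclos D (sigma x)) -> forall x, aclos D x -> aclos D (sigma x).
Proof.
move=> Dsig x; elim=> {x} [x /Dsig //|x y _ IHx _ IHy|x y _ IHx _ IHy|x _ IH|F x F0 _ IH Fx].
- by rewrite rmorphB; apply: ac_B.
- by rewrite rmorphM; apply: ac_M.
- by rewrite fmorphV; apply: ac_V.
- apply: (@ac_root _ _ (map_mpoly sigma F)).
  + move=> sF0; apply: F0; apply/mpolyP => m; rewrite mcoeff0.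
    have := congr1 (mcoeff m) sF0; rewrite mcoeff_map_mpoly mcoeff0.
    by move/eqP; rewrite fmorph_eq0 => /eqP.
  + move=> m; rewrite mcoeff_map_mpoly; exact: IH.
  + have : sigma (sp_eval F x) = 0 by rewrite Fx rmorph0.
    rewrite /sp_eval -meval_map => e; rewrite -[RHS]e; apply: meval_eq => i.
    by rewrite -iterSr.
Qed.

Section Extend.
Variables (M L : vdField) (h : {additive vf_group M -> vf_group L}).
Hypothesis h_mono : {mono h : a b / a <= b}.
Hypothesis h_sigma : forall g, h (vdf_sigma_group g) = vdf_sigma_group (h g).
Hypothesis pchar_res : [pchar (vf_residue M)] =i pred0.
Hypothesis ax2 : axiom2 M.
Hypothesis hensM : sigma_henselian M.
Hypothesis hensL : sigma_henselian L.
Variables (G0 : oagType) (phi : G0 -> vf_group M).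
Hypothesis phi_mono : {mono phi : a c / a <= c}.
Hypothesis phi_surj : forall g, exists a, phi a = g.
Hypothesis alg_complete : forall (I : limit_ordinal) (t : I -> L),
  pc_seq t -> sigma_alg_type t -> length_le_card I G0 -> exists y, pseudo_limit t y.
Implicit Types S Phi Psi : M -> L -> Prop.

Let dichotomy := extension_dichotomy h_mono h_sigma pchar_res ax2 hensM hensL phi_mono phi_surj alg_complete.

Lemma nclosed0 Phi : nclosed 0 Phi.
Proof. by move=> x y xy i; rewrite (ord1 i). Qed.

Lemma dense_sub Phi Psi : dense Phi -> (forall u w, Phi u w -> Psi u w) -> dense Psi.
Proof. by move=> dns sub x /dns[u [w [/sub uw lt]]]; exists u, w. Qed.

(** If a root were missing from the domain, the order-0 dichotomy would either adjoin a new element,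
    against maximality, or deny that it is a root. *)
Lemma maximal_aclos Psi (D : M -> Prop) : is_pfield h Psi -> dense Psi ->
  (forall Psi', is_pfield h Psi' -> (forall x y, Psi x y -> Psi' x y) ->
     forall x y, Psi' x y -> Psi x y) ->
  (forall x, D x -> in_dom Psi x) -> forall x, aclos D x -> in_dom Psi x.
Proof.
move=> pf dns max DPsi x; elim=> {x} [x /DPsi //|x y _ [x' xx'] _ [y' yy']
  |x y _ [x' xx'] _ [y' yy']|x _ [x' xx']|F x F0 _ Fdom Fx].
- by exists (x' - y'); apply: (pf_B pf).
- by exists (x' * y'); apply: (pf_M pf).
- by exists x'^-1; apply: (pf_V pf).
apply: contrapT => xn; have [[k [z [y [_ zn cmp _ _]]]]|[_ noroot]] :=
    dichotomy pf dns (@nclosed0 Psi) xn; last exact: noroot F F0 Fdom Fx.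
apply: zn; exists y; have S1 : adjS Psi k.+1 z y 1 1 by left; apply: (pf_1 pf).
apply: (max _ (rel_frac_pfield S1 cmp)).
  by move=> u w uw; apply: rel_frac_in => //; left.
by apply: rel_frac_in => //; right; exists 0%N.
Qed.

(** Consider the graph [Om] on which both extensions agree. If it missed an algebraic element, the
    dichotomy would give some [z] outside its domain with only one possible image; [z] is algebraic,
    so both extensions are defined at [z] and agree there. *)
Lemma aclos_unique Theta Psi1 Psi2 : is_pfield h Theta -> dense Theta ->
  is_pfield h Psi1 -> is_pfield h Psi2 ->
  (forall x y, Theta x y -> Psi1 x y) -> (forall x y, Theta x y -> Psi2 x y) ->
  (forall x, aclos (in_dom Theta) x -> in_dom Psi1 x) ->
  (forall x, aclos (in_dom Theta) x -> in_dom Psi2 x) ->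
  forall x y1 y2, aclos (in_dom Theta) x -> Psi1 x y1 -> Psi2 x y2 -> y1 = y2.
Proof.
move=> pfT dns pf1 pf2 T1 T2 ac1 ac2; set D := in_dom Theta.
pose Om x y := [/\ aclos D x, Psi1 x y & Psi2 x y].
have TOm x y : Theta x y -> Om x y.
  by move=> xy; split; [apply: ac_in; exists y | apply: T1 | apply: T2].
have pfO : is_pfield h Om.
  split.
  - by apply: TOm; apply: (pf_1 pfT).
  - by move=> x y x' y' [a b c] [a' b' c']; split; [apply: ac_B | apply: (pf_B pf1) | apply: (pf_B pf2)].
  - by move=> x y x' y' [a b c] [a' b' c']; split; [apply: ac_M | apply: (pf_M pf1) | apply: (pf_M pf2)].
  - by move=> x y [a b c]; split; [apply: ac_V | apply: (pf_V pf1) | apply: (pf_V pf2)].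
  - by move=> x y [_ b _]; apply: (pf_val pf1).
have all_dom x : aclos D x -> in_dom Om x.
  elim=> {x} [x [y xy]|x y _ [x' xx'] _ [y' yy']|x y _ [x' xx'] _ [y' yy']|x _ [x' xx']
    |F x F0 _ Fdom Fx].
  - by exists y; apply: TOm.
  - by exists (x' - y'); apply: (pf_B pfO).
  - by exists (x' * y'); apply: (pf_M pfO).
  - by exists x'^-1; apply: (pf_V pfO).
  apply: contrapT => xn; have [[k [z [y [k0 zn _ zroot uniq]]]]|[_ noroot]] :=
    dichotomy pfO (dense_sub dns TOm) (@nclosed0 Om) xn; last exact: noroot F F0 Fdom Fx.
  move: k0 zroot; rewrite leqn0 => /eqP -> [F1 [F10 F1dom F1z]].
  have az : aclos D z.
    apply: (@ac_root _ _ F1) => // m; have [w gw] := F1dom m.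
    have : Om F1@_m w.
      by apply: (gen_pfield pfO); apply: gen_sub gw => u v [//|[i []]].
    by case.
  have [y1 zy1] := ac1 z az; have [y2 zy2] := ac2 z az.
  have e1 : y1 = y by apply: (uniq erefl Psi1) => // u w [].
  have e2 : y2 = y by apply: (uniq erefl Psi2) => // u w [].
  by apply: zn; exists y; split; [exact: az | rewrite -e1 | rewrite -e2].
move=> x y1 y2 ax xy1 xy2; have [y [_ xy xy']] := all_dom x ax.
by rewrite (pf_fun pf1 xy1 xy) (pf_fun pf2 xy2 xy').
Qed.

(** * Extensions compatible with sigma *)

Definition sclosed Phi := forall x y, Phi x y -> Phi (sigma x) (sigma y).
Definition sinv_closed Phi := forall x y, Phi (sigma x) (sigma y) -> Phi x y.

Lemma sclosed_iter Phi m : sclosed Phi ->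
  forall x y, Phi x y -> Phi (iter m sigma x) (iter m sigma y).
Proof. by move=> sc x y xy; elim: m => //= m; apply: sc. Qed.

Lemma omap_h_iter m (o : option (vf_group M)) :
  omap (@rho_pow L m) (omap h o) = omap h (omap (@rho_pow M m) o).
Proof.
case: o => //= g; congr Some; elim: m => //= m ->.
by rewrite h_sigma.
Qed.

Lemma pfield_preimage Phi m : is_pfield h Phi ->
  is_pfield h (fun x y => Phi (iter m sigma x) (iter m sigma y)).
Proof.
move=> pf; have i1 (K : vdField) : iter m (@vdf_sigma K) 1 = 1.
  by elim: (m) => //= m' ->; rewrite rmorph1.
have iV (K : vdField) (x : K) : iter m sigma x^-1 = (iter m sigma x)^-1.
  by elim: (m) => //= m' ->; rewrite fmorphV.
split.
- by rewrite !i1; apply: (pf_1 pf).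
- by move=> x y x' y' xy xy'; rewrite !iter_sigmaB; apply: (pf_B pf).
- by move=> x y x' y' xy xy'; rewrite !iter_sigmaM; apply: (pf_M pf).
- by move=> x y xy; rewrite !iV; apply: (pf_V pf).
- move=> x y /(pf_val pf); rewrite !val_iter_sigma -omap_h_iter.
  by apply: inj_omap; apply: oag_mono_inj; apply: rho_pow_mono.
Qed.

(** The union of the pullbacks along all powers of sigma; they form a chain because the graph is
    stable under sigma. *)
Lemma sigma_saturate Psi : is_pfield h Psi -> sclosed Psi ->
  exists Phi, [/\ is_pfield h Phi, sclosed Phi, sinv_closed Phi
    & forall x y, Psi x y -> Phi x y].
Proof.
move=> pf sc; pose F S := exists m, S = fun x y => Psi (iter m sigma x) (iter m sigma y).
exists (fun x y => exists2 S, F S & S x y); split.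
- apply: pfield_union.
  + by exists Psi, 0%N.
  + by move=> _ [m ->]; apply: pfield_preimage.
  + move=> _ _ [m ->] [m' ->]; have [le|le] := leqP m m'; [left|right] => x y xy.
      by rewrite -(subnK le) !iterD; apply: sclosed_iter.
    by rewrite -(subnK (ltnW le)) !iterD; apply: sclosed_iter.
- move=> x y [_ [m ->] xy]; exists (fun x y => Psi (iter m sigma x) (iter m sigma y)).
    by exists m.
  by rewrite -!iterSr !iterS; apply: sc.
- move=> x y [_ [m ->] xy]; exists (fun x y => Psi (iter m.+1 sigma x) (iter m.+1 sigma y)).
    by exists m.+1.
  by rewrite !iterSr.
- by move=> x y xy; exists Psi => //; exists 0%N.
Qed.

(* The pair [(x, y)] generates [P0], which sigma maps beyond itself: [P0] only
   contains the image of [Pm]. But [Pm] extends uniquely to the relative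
   algebraic closure of its domain, which is stable under sigma, and by
   uniqueness this extension commutes with sigma. *)
Lemma algebraic_extension Phi k x y : is_pfield h Phi -> dense Phi -> sclosed Phi ->
  compatible h (gen (adjS Phi k.+1 x y)) ->
  root_over (fun z => exists w, gen (adjS Phi k x y) z w) (iter k sigma x) ->
  exists Psi, [/\ is_pfield h Psi, sclosed Psi, sinv_closed Psi,
    forall u w, Phi u w -> Psi u w & Psi x y].
Proof.
move=> pf dns sc cmp root.
have S1 j : adjS Phi j x y 1 1 by left; apply: (pf_1 pf).
have adjW u w : adjS Phi k x y u w -> adjS Phi k.+1 x y u w.
  by case=> [uw|[i [ik -> ->]]]; [left | right; exists i; split=> //; apply: ltnW].
have cmp' : compatible h (gen (adjS Phi k x y)).
  by move=> u w uw; apply: cmp; apply: gen_sub uw.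
pose Pm := rel_frac (adjS Phi k x y); pose P0 := rel_frac (adjS Phi k.+1 x y).
have pfm : is_pfield h Pm by apply: rel_frac_pfield.
have pf0 : is_pfield h P0 by apply: rel_frac_pfield.
have PhiPm u w : Phi u w -> Pm u w by move=> uw; apply: rel_frac_in => //; left.
have Pm0 u w : Pm u w -> P0 u w.
  move=> [a [b [a' [b' [ab ab' a'0 -> ->]]]]]; exists a, b, a', b'.
  by split=> //; [apply: gen_sub ab | apply: gen_sub ab'].
have Pms u w : Pm u w -> P0 (sigma u) (sigma w).
  have gs c d : gen (adjS Phi k x y) c d -> gen (adjS Phi k.+1 x y) (sigma c) (sigma d).
    elim=> {c d} [c d [cd|[i [ik -> ->]]]|c d c' d' _ IH _ IH'|c d c' d' _ IH _ IH'].
    - by apply: gen_in; left; apply: sc.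
    - by apply: gen_in; right; exists i.+1.
    - by rewrite !rmorphB; apply: gen_B.
    - by rewrite !rmorphM; apply: gen_M.
  move=> [a [b [a' [b' [/gs ab /gs ab' a'0 -> ->]]]]].
  exists (sigma a), (sigma b), (sigma a'), (sigma b'); split=> //.
  - by move/eqP; rewrite fmorph_eq0 => /eqP.
  - by rewrite rmorphM fmorphV.
  - by rewrite rmorphM fmorphV.
(* [Psi] is maximal without any condition on sigma; only its restriction to [aclos D] is kept. *)
have [Psi [pfPsi P0Psi maxPsi]] := pfield_maximal pf0.
pose D := in_dom Pm.
have dnsPsi : dense Psi by apply: dense_sub dns _ => u w /PhiPm/Pm0/P0Psi.
have acPsi u : aclos D u -> in_dom Psi u.
  apply: maximal_aclos => // v [w vw]; exists w; apply: P0Psi; exact: Pm0.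
(* [sigma^k(x)] is the only generator of [P0] not already in [Pm]; its algebraicity keeps the domain
   of [P0] inside [aclos D], which makes [aclos D] stable under sigma. *)
have kroot : aclos D (iter k sigma x).
  have [F [F0 Fdom Fx]] := root; apply: (@ac_root _ _ F) => // m.
  have [w gw] := Fdom m; apply: ac_in; exists w.
  exists F@_m, w, 1, 1; split=> //; try exact: gen_in; rewrite ?divr1 //.
  exact/eqP/oner_neq0.
have gen_ac u w : gen (adjS Phi k.+1 x y) u w -> aclos D u.
  elim=> {u w} [u w [uw|[i [ik -> _]]]|u w u' w' _ IH _ IH'|u w u' w' _ IH _ IH'].
  - by apply: ac_in; exists w; apply: PhiPm.
  - move: ik; rewrite ltnS leq_eqVlt => /predU1P[-> //|ik].
    by apply: ac_in; exists (iter i sigma y); apply: rel_frac_in => //; right; exists i.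
  - exact: ac_B.
  - exact: ac_M.
have P0_ac u w : P0 u w -> aclos D u.
  move=> [a [b [a' [b' [/gen_ac aa /gen_ac aa' _ -> _]]]]].
  by apply: ac_M => //; apply: ac_V.
have ac_s u : aclos D u -> aclos D (sigma u).
  by apply: aclos_sigma => v [w /Pms]; apply: P0_ac.
pose Psi' u w := aclos D u /\ Psi u w.
have pf' : is_pfield h Psi'.
  split.
  - by split; [apply: ac_in; exists 1; apply: (pf_1 pfm) | apply: (pf_1 pfPsi)].
  - by move=> u w u' w' [a b] [a' b']; split; [apply: ac_B | apply: (pf_B pfPsi)].
  - by move=> u w u' w' [a b] [a' b']; split; [apply: ac_M | apply: (pf_M pfPsi)].
  - by move=> u w [a b]; split; [apply: ac_V | apply: (pf_V pfPsi)].
  - by move=> u w [_ b]; apply: (pf_val pfPsi).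
have sPsi_dom u : aclos D u -> exists w, Psi (sigma u) (sigma w).
  move=> /ac_s/acPsi[w uw]; have [tau _ sigK] := vdf_sigma_bij L.
  by exists (tau w); rewrite sigK.
have sc' : sclosed Psi'.
  move=> u w [au uw]; split; first exact: ac_s.
  have [w' uw'] := sPsi_dom u au.
  suff -> : w = w' by [].
  (* [Psi] and its pullback along sigma both extend [Pm], the latter because sigma maps [Pm] into
     [P0]. Their agreement on [aclos D] is the commutation with sigma. *)
  apply: (@aclos_unique Pm Psi (fun u w => Psi (sigma u) (sigma w)) pfm _ pfPsi _ _ _ acPsi _
     u w w') => //.
  - by apply: dense_sub dns _.
  - exact: (pfield_preimage 1 pfPsi).
  - by move=> c d /Pm0/P0Psi.
  - by move=> c d /Pms/P0Psi.
have [Om [pfO scO siO PsiO]] := sigma_saturate pf' sc'.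
have P0' u w : P0 u w -> Psi' u w by move=> uw; split; [apply: P0_ac uw | apply: P0Psi].
exists Om; split=> // [u w uw|]; apply: PsiO; apply: P0'.
  by apply: Pm0; apply: PhiPm.
by apply: rel_frac_in => //; right; exists 0%N.
Qed.

(** An element of the generated ring involves only finitely many iterates, so compatibility in each
    order suffices; negative powers of sigma are supplied by saturation. *)
Lemma transcendental_extension Phi b y : is_pfield h Phi -> sclosed Phi ->
  (forall n, compatible h (gen (adjS Phi n.+1 b y))) ->
  exists Psi, [/\ is_pfield h Psi, sclosed Psi, sinv_closed Psi,
    forall u w, Phi u w -> Psi u w & Psi b y].
Proof.
move=> pf sc cmp; pose S u w := Phi u w \/ exists i, u = iter i sigma b /\ w = iter i sigma y.
have adjW j j' u w : (j <= j')%N -> adjS Phi j b y u w -> adjS Phi j' b y u w.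
  by move=> le [uw|[i [ik -> ->]]]; [left | right; exists i; split=> //; apply: leq_trans le].
have gen_n u w : gen S u w -> exists n, gen (adjS Phi n.+1 b y) u w.
  elim=> {u w} [u w [uw|[i [-> ->]]]|u w u' w' _ [n IH] _ [n' IH']|u w u' w' _ [n IH] _ [n' IH']].
  - by exists 0%N; apply: gen_in; left.
  - by exists i; apply: gen_in; right; exists i.
  - exists (maxn n n'); apply: gen_B.
      by apply: gen_sub IH => c d; apply: adjW; rewrite ltnS leq_maxl.
    by apply: gen_sub IH' => c d; apply: adjW; rewrite ltnS leq_maxr.
  - exists (maxn n n'); apply: gen_M.
      by apply: gen_sub IH => c d; apply: adjW; rewrite ltnS leq_maxl.
    by apply: gen_sub IH' => c d; apply: adjW; rewrite ltnS leq_maxr.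
have S1 : S 1 1 by left; apply: (pf_1 pf).
have cmpS : compatible h (gen S) by move=> u w /gen_n[n]; apply: cmp.
have scF : sclosed (rel_frac S).
  have gs c d : gen S c d -> gen S (sigma c) (sigma d).
    elim=> {c d} [c d [cd|[i [-> ->]]]|c d c' d' _ IH _ IH'|c d c' d' _ IH _ IH'].
    - by apply: gen_in; left; apply: sc.
    - by apply: gen_in; right; exists i.+1.
    - by rewrite !rmorphB; apply: gen_B.
    - by rewrite !rmorphM; apply: gen_M.
  move=> _ _ [a [c [a' [c' [/gs ab /gs ab' a'0 -> ->]]]]].
  exists (sigma a), (sigma c), (sigma a'), (sigma c'); split=> //.
  - by move/eqP; rewrite fmorph_eq0 => /eqP.
  - by rewrite rmorphM fmorphV.
  - by rewrite rmorphM fmorphV.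
have [Om [pfO scO siO FO]] := sigma_saturate (rel_frac_pfield S1 cmpS) scF.
exists Om; split=> // [u w uw|]; apply: FO; apply: rel_frac_in => //; first by left.
by right; exists 0%N.
Qed.

Lemma total_extension Phi0 : is_pfield h Phi0 -> sclosed Phi0 -> sinv_closed Phi0 ->
  dense Phi0 ->
  (forall (I : limit_ordinal) (t : I -> L), pc_seq t -> length_le_card I G0 ->
     exists y, pseudo_limit t y) \/
  (forall b, exists n (F : {mpoly M[n.+1]}),
     [/\ F <> 0, forall m, in_dom Phi0 F@_m & sp_eval F b = 0]) ->
  exists Phi, [/\ is_pfield h Phi, sclosed Phi, forall u w, Phi0 u w -> Phi u w
    & forall b, in_dom Phi b].
Proof.
move=> pf0 sc0 si0 dns0 hyp.
pose C Phi := [/\ is_pfield h Phi, sclosed Phi & sinv_closed Phi].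
have [|F F_ex FC Fch|Phi [[pf sc si] sub max]] := @zorn_relation M L C Phi0.
- by [].
- split.
  + by apply: pfield_union => // S /FC[].
  + by move=> x y [S FS xy]; exists S => //; have [_ scS _] := FC S FS; apply: scS.
  + by move=> x y [S FS xy]; exists S => //; have [_ _ siS] := FC S FS; apply: siS.
exists Phi; split=> // b; apply: contrapT => bn.
have dns : dense Phi by apply: dense_sub dns0 sub.
have ncl n : nclosed n Phi by move=> x y xy i; apply: sclosed_iter.
(* A nowhere stable polynomial in some order gives an extension that contradicts maximality.
   Otherwise [b] is a root of no nonzero polynomial over the domain, and any point of its image cut
   is an admissible image. *)
have [[n [k [x [y [_ xn cmp root _]]]]]|nalg] := pselect (exists n k x y,
    [/\ (k <= n)%N, ~ in_dom Phi x, compatible h (gen (adjS Phi k.+1 x y)),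
      root_over (fun z => exists w, gen (adjS Phi k x y) z w) (iter k sigma x)
    & n = 0%N -> forall Psi y', is_pfield h Psi -> (forall u w, Phi u w -> Psi u w) ->
        Psi x y' -> y' = y]).
  have [Psi [pfP scP siP subP Pxy]] := algebraic_extension pf dns sc cmp root.
  by apply: xn; exists y; apply: (max Psi).
have trans n := dichotomy pf dns (ncl n) bn.
case: hyp => [compl|alg].
  have [y ycut] := cut_exists h_mono h_sigma phi_mono phi_surj pf dns bn compl.
  have [n|Psi [pfP scP siP subP Pxy]] := @transcendental_extension Phi b y pf sc.
    by have [[k ex]|[cmp _]] := trans n; [case: nalg; exists n, k | apply: cmp].
  by apply: bn; exists y; apply: (max Psi).
have [n [F [F0 Fdom Fb]]] := alg b.
have [[k ex]|[_ noroot]] := trans n; first by case: nalg; exists n, k.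
apply: (noroot F F0 _ Fb) => m; have [w uw] := Fdom m; exists w.
exact: sub.
Qed.

End Extend.

(** * From total partial embeddings to embeddings *)

Section TotalPField.
Variables (M L : vdField) (h : {additive vf_group M -> vf_group L}).
Hypothesis h_mono : {mono h : a b / a <= b}.

Record total_pfield := TotalPField {
  tot_rel : M -> L -> Prop;
  tot_pfield : is_pfield h tot_rel;
  tot_sclosed : sclosed tot_rel;
  tot_all : forall x, in_dom tot_rel x
}.

Variable P : total_pfield.

Definition tot_map (x : M) : L := projT1 (cid (tot_all P x)).

Lemma tot_mapP x : tot_rel P x (tot_map x).
Proof. exact: projT2 (cid (tot_all P x)). Qed.

Lemma tot_mapE x y : tot_rel P x y -> tot_map x = y.
Proof. by apply: (pf_fun (tot_pfield P)); apply: tot_mapP. Qed.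

Lemma tot_map_zmod : zmod_morphism tot_map.
Proof.
by move=> x y; apply: tot_mapE; apply: (pf_B (tot_pfield P)); apply: tot_mapP.
Qed.
Lemma tot_map_monoid : monoid_morphism tot_map.
Proof.
split=> [|x y]; apply: tot_mapE; first exact: (pf_1 (tot_pfield P)).
by apply: (pf_M (tot_pfield P)); apply: tot_mapP.
Qed.
HB.instance Definition _ := GRing.isZmodMorphism.Build M L tot_map tot_map_zmod.
HB.instance Definition _ := GRing.isMonoidMorphism.Build M L tot_map tot_map_monoid.

Lemma tot_map_val x : vval (tot_map x) = omap h (vval x).
Proof. by apply: (pf_val (tot_pfield P)); apply: tot_mapP. Qed.

Lemma tot_map_valring x : in_valring (tot_map x) = in_valring x.
Proof.
rewrite /in_valring tot_map_val -(raddf0 h) -[Some (h 0)]/(omap h (Some 0)).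
by rewrite omap_ele.
Qed.

Lemma tot_residue_ex (c : vf_residue M) : exists x : M, in_valring x /\ vres x = c.
Proof. by have [x Ox xc] := vf_res_surj c; exists x. Qed.

Definition tot_residue (c : vf_residue M) : vf_residue L :=
  vres (tot_map (projT1 (cid (tot_residue_ex c)))).

(** Independence of the chosen lift: two lifts differ by an element of positive value, and [h]
    preserves positivity. *)
Lemma tot_map_res x : in_valring x -> vres (tot_map x) = tot_residue (vres x).
Proof.
move=> Ox; rewrite /tot_residue; case: cid => y /= [Oy yx].
have ONy : in_valring (- y) by rewrite valringN.
have Oxy := valringD Ox ONy; have : vres (x - y) = 0.
  by rewrite (vf_resD Ox ONy) resN // yx subrr.
move/(vf_res_eq0 Oxy) => lt; apply/eqP; rewrite -subr_eq0 -resN; last first.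
  by rewrite tot_map_valring.
have ONty : in_valring (- tot_map y) by rewrite valringN tot_map_valring.
have Otx : in_valring (tot_map x) by rewrite tot_map_valring.
rewrite -(vf_resD Otx ONty); apply/eqP/(vf_res_eq0 (valringD Otx ONty)).
rewrite -rmorphB tot_map_val -(raddf0 h) -[Some (h 0)]/(omap h (Some 0)).
by rewrite omap_elt.
Qed.

Lemma tot_residue_zmod : zmod_morphism tot_residue.
Proof.
move=> c d; have [x Ox <-] := vf_res_surj c; have [y Oy <-] := vf_res_surj d.
have ONy : in_valring (- y) by rewrite valringN.
have ONty : in_valring (- tot_map y) by rewrite valringN tot_map_valring.
have Otx : in_valring (tot_map x) by rewrite tot_map_valring.
rewrite -resN // -(vf_resD Ox ONy) -!tot_map_res //; last exact: valringD.
by rewrite rmorphB (vf_resD Otx ONty) resN // tot_map_valring.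
Qed.

Lemma tot_residue_monoid : monoid_morphism tot_residue.
Proof.
split=> [|c d].
  by rewrite -vf_res1 -tot_map_res ?valring1 // rmorph1 vf_res1.
have [x Ox <-] := vf_res_surj c; have [y Oy <-] := vf_res_surj d.
rewrite -vf_resM // -!tot_map_res //; last exact: valringM.
have Otx : in_valring (tot_map x) by rewrite tot_map_valring.
have Oty : in_valring (tot_map y) by rewrite tot_map_valring.
by rewrite rmorphM (vf_resM Otx Oty).
Qed.
HB.instance Definition _ :=
  GRing.isZmodMorphism.Build (vf_residue M) (vf_residue L) tot_residue tot_residue_zmod.
HB.instance Definition _ :=
  GRing.isMonoidMorphism.Build (vf_residue M) (vf_residue L) tot_residue tot_residue_monoid.

Lemma tot_map_sigma x : tot_map (sigma x) = sigma (tot_map x).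
Proof. by apply: tot_mapE; apply: tot_sclosed; apply: tot_mapP. Qed.

Definition tot_embedding : vdf_embedding M L :=
  @VdfEmbedding M L
    (@VfEmbedding M L tot_map h tot_residue h_mono tot_map_val tot_map_res)
    tot_map_sigma.

End TotalPField.

Section Compose.
Variables (A B C : vdField) (e : vdf_embedding B C) (i : vdf_embedding A B).

Lemma compose_group_mono : {mono emb_group e \o emb_group i : a b / a <= b}.
Proof. by move=> a b /=; rewrite !emb_group_mono. Qed.

Lemma compose_val (x : A) :
  vval ((e \o i) x) = omap (emb_group e \o emb_group i) (vval x).
Proof. by rewrite /= !emb_val; case: (vval x). Qed.

Lemma emb_valring (x : A) : in_valring (i x) = in_valring x.
Proof.
rewrite /in_valring emb_val -(raddf0 (emb_group i)).
rewrite -[Some (emb_group i 0)]/(omap (emb_group i) (Some 0)).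
by rewrite omap_ele //; apply: emb_group_mono.
Qed.

Lemma compose_res (x : A) : in_valring x ->
  vres ((e \o i) x) = (emb_residue e \o emb_residue i) (vres x).
Proof. by move=> Ox /=; rewrite !emb_res // emb_valring. Qed.

Lemma compose_sigma (x : A) : (e \o i) (sigma x) = sigma ((e \o i) x).
Proof. by rewrite /= !vde_sigma. Qed.

Definition compose_embedding : vdf_embedding A C :=
  @VdfEmbedding A C
    (@VfEmbedding A C (e \o i) (emb_group e \o emb_group i)
       (emb_residue e \o emb_residue i) compose_group_mono compose_val compose_res)
    compose_sigma.

End Compose.

Lemma emb_group_sigma (A B : vdField) (i : vdf_embedding A B) g :
  emb_group i (vdf_sigma_group g) = vdf_sigma_group (emb_group i g).
Proof.
have [x vx] := vf_val_surj g; have := congr1 (@vval B) (vde_sigma i x).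
by rewrite emb_val !vdf_sigma_val emb_val vx /= => -[].
Qed.

Lemma emb_residue_sigma (A B : vdField) (i : vdf_embedding A B) c :
  emb_residue i (vdf_sigma_residue c) = vdf_sigma_residue (emb_residue i c).
Proof.
have [x Ox <-] := vf_res_surj c.
have OSx : in_valring (sigma x) by rewrite vdf_sigma_valring.
have Oix : in_valring (i x) by rewrite emb_valring.
by rewrite -(vdf_sigma_res Ox) -(emb_res i OSx) -(emb_res i Ox) -(vdf_sigma_res Oix) vde_sigma.
Qed.

Lemma immediate_axiom2 (K M : vdField) (f : vdf_embedding K M) :
  axiom2 K -> axiom2 M.
Proof.
move=> ax2 d d_gt0; have [y yd] := ax2 d d_gt0; exists (emb_residue f y) => e.
apply: yd; apply: (fmorph_inj (emb_residue f)); rewrite -[RHS]e.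
by elim: (d) => //= m; rewrite emb_residue_sigma => ->.
Qed.

(** * The partial embedding given by the base field *)

Section OverBase.
Variables (K M L : vdField) (f : vdf_embedding K M) (g : vdf_embedding K L).
Hypothesis imm : immediate f.

Lemma base_group_ex (d : vf_group M) : exists c, emb_group f c = d.
Proof. exact: (proj1 imm). Qed.

Definition base_group (d : vf_group M) : vf_group L :=
  emb_group g (projT1 (cid (base_group_ex d))).

Lemma base_groupE c : base_group (emb_group f c) = emb_group g c.
Proof.
rewrite /base_group; case: cid => c' /= e; congr (emb_group g _).
exact: oag_mono_inj (@emb_group_mono _ _ f) _ _ e.
Qed.

Lemma base_group_zmod : zmod_morphism base_group.
Proof.
move=> a b; have [c <-] := base_group_ex a; have [d <-] := base_group_ex b.
by rewrite -raddfB !base_groupE raddfB.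
Qed.
HB.instance Definition _ :=
  GRing.isZmodMorphism.Build (vf_group M) (vf_group L) base_group base_group_zmod.

Lemma base_group_mono : {mono base_group : a b / a <= b}.
Proof.
move=> a b; have [c <-] := base_group_ex a; have [d <-] := base_group_ex b.
by rewrite !base_groupE !emb_group_mono.
Qed.

Lemma base_group_sigma d : base_group (vdf_sigma_group d) = vdf_sigma_group (base_group d).
Proof.
have [c <-] := base_group_ex d.
by rewrite -emb_group_sigma !base_groupE emb_group_sigma.
Qed.

Definition base_rel (x : M) (y : L) : Prop := exists u : K, x = f u /\ y = g u.

Lemma base_rel_pfield : is_pfield base_group base_rel.
Proof.
split.
- by exists 1; rewrite !rmorph1.
- by move=> _ _ _ _ [u [-> ->]] [w [-> ->]]; exists (u - w); rewrite !rmorphB.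
- by move=> _ _ _ _ [u [-> ->]] [w [-> ->]]; exists (u * w); rewrite !rmorphM.
- by move=> _ _ [u [-> ->]]; exists u^-1; rewrite !fmorphV.
- move=> _ _ [u [-> ->]]; rewrite !emb_val; case: (vval u) => //= c.
  by rewrite base_groupE.
Qed.

Lemma base_rel_sclosed : sclosed base_rel.
Proof. by move=> _ _ [u [-> ->]]; exists (sigma u); rewrite !vde_sigma. Qed.

Lemma base_rel_sinv_closed : sinv_closed base_rel.
Proof.
move=> x y [u [xu yu]]; have [tau _ sigK] := vdf_sigma_bij K.
exists (tau u); split; apply: (fmorph_inj (@vdf_sigma _)).
  by rewrite xu -vde_sigma sigK.
by rewrite yu -vde_sigma sigK.
Qed.

(** Equality of value groups gives [u] with [f u] of the value of [x]; equality of residue fields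
    gives [w] with [f w] of the residue of [x / f u]. Their product approximates [x]. *)
Lemma base_rel_dense : dense base_rel.
Proof.
move=> x /val_neq0[d vx]; have [c ec] := base_group_ex d; have [u vu] := vf_val_surj c.
have fu0 : f u != 0 by apply: (@val_neq0_Some _ _ d); rewrite emb_val vu /= ec.
pose y := x / f u; have vfu : vval (f u) = Some d by rewrite emb_val vu /= ec.
have Oy : in_valring y by rewrite /in_valring vf_valM valV vx vfu /= subrr lexx.
have [r er] := proj2 imm (vres y); have [w Ow wr] := vf_res_surj r.
have ONw : in_valring (- f w) by rewrite valringN emb_valring.
exists (f (u * w)), (g (u * w)); split; first by exists (u * w).
have -> : x - f (u * w) = f u * (y - f w).
  by rewrite mulrBr rmorphM /y [f u * (x / _)]mulrC divfK.
have : vres (y - f w) = 0.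
  by rewrite (vf_resD Oy ONw) resN ?emb_valring // emb_res // wr er subrr.
move/(vf_res_eq0 (valringD Oy ONw)); rewrite vf_valM vfu vx eaddC.
by case: (vval (y - f w)) => //= a; rewrite !elt_Some -(oag_ltD2r d) add0r.
Qed.

Lemma adjoin_embeds (a : M) (Phi : M -> L -> Prop) : is_pfield base_group Phi ->
  sclosed Phi -> (forall x y, base_rel x y -> Phi x y) -> (forall x, in_dom Phi x) ->
  adjoin_embeds_over f a g.
Proof.
move=> pf sc sub tot.
pose P := TotalPField pf sc tot; pose e := tot_embedding base_group_mono P.
exists (compose_embedding e (adjoin_incl f a)); split=> x y xy.
- rewrite /= [adj_field_val _]xy; apply: (@tot_mapE _ _ _ P).
  by apply: sub; exists x.
- by rewrite /= [adj_group_val _]xy base_groupE.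
- have [u' Ou' u'x] := vf_res_surj x.
  rewrite /= [adj_residue_val _]xy -u'x -emb_res // -[LHS]/(tot_residue P _).
  rewrite -(tot_map_res base_group_mono) ?emb_valring //.
  have -> : tot_map P (f u') = g u' by apply: (@tot_mapE _ _ _ P); apply: sub; exists u'.
  by rewrite emb_res.
Qed.

End OverBase.

(* [GRing.Theory] shadows [multiplicative]. *)
Import Pilot.Defs.

Theorem theorem6p7 (R : rcfType) (rho : R) (K : vdField)
  (multK : multiplicative rho K) (ax2K : axiom2 K) :
  (forall (K' : vdField) (f : vdf_embedding K K') (a : K')
      (K1 : vdField) (g : vdf_embedding K K1),
    multiplicative rho K' ->
    proper_ext f -> immediate f -> sigma_henselian K' ->
    (forall x : K, f x <> a) ->
    multiplicative rho K1 -> sigma_henselian K1 -> axiom2 K1 ->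
    (forall (I : limit_ordinal) (s : I -> K1),
       pc_seq s -> length_le_card I (vf_group K) ->
       exists b : K1, pseudo_limit s b) ->
    adjoin_embeds_over f a g)
  /\
  (forall (K' : vdField) (f : vdf_embedding K K') (a : K')
      (K1 : vdField) (g : vdf_embedding K K1),
    multiplicative rho K' ->
    proper_ext f -> immediate f -> sigma_henselian K' -> sigma_algebraic f ->
    (forall x : K, f x <> a) ->
    multiplicative rho K1 -> sigma_henselian K1 -> axiom2 K1 ->
    (forall (I : limit_ordinal) (s : I -> K1),
       pc_seq s -> sigma_alg_type s -> length_le_card I (vf_group K) ->
       exists b : K1, pseudo_limit s b) ->
    adjoin_embeds_over f a g).
Proof.
(* Common core of both parts: full completeness implies completeness for sequences of
   sigma-algebraic type, so the parts differ only in how an element with no nowhere stable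
   polynomial is handled. All of [K'] is embedded and the result restricted to the subfield
   generated by [a]. *)
have embeds (K' : vdField) (f : vdf_embedding K K') (a : K') (K1 : vdField)
    (g : vdf_embedding K K1) (imm : immediate f) :
    multiplicative rho K' -> sigma_henselian K' -> sigma_henselian K1 ->
    (forall (I : limit_ordinal) (s : I -> K1),
       pc_seq s -> sigma_alg_type s -> length_le_card I (vf_group K) ->
       exists b : K1, pseudo_limit s b) ->
    (forall (I : limit_ordinal) (s : I -> K1),
       pc_seq s -> length_le_card I (vf_group K) ->
       exists b : K1, pseudo_limit s b) \/ sigma_algebraic f ->
    adjoin_embeds_over f a g.
  move=> [_ pchar_res _ _] hens hens1 alg_compl hyp.
  have [|Phi [pf sc sub tot]] := total_extension (base_group_mono g imm)
      (base_group_sigma g imm) pchar_res (immediate_axiom2 f ax2K) hens hens1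
      (@emb_group_mono _ _ f) (proj1 imm) alg_compl (base_rel_pfield g imm)
      (@base_rel_sclosed _ _ _ f g) (@base_rel_sinv_closed _ _ _ f g) (base_rel_dense g imm).
    case: hyp => [compl|alg]; [by left | right=> b].
    have [n [F [F0 Fb]]] := alg b; exists n, (map_mpoly f F); split=> // [fF0|m].
      apply: F0; apply/mpolyP => m; have := congr1 (mcoeff m) fF0.
      by rewrite mcoeff_map_mpoly !mcoeff0 => /eqP; rewrite fmorph_eq0 => /eqP.
    by rewrite mcoeff_map_mpoly; exists (g F@_m); exists F@_m.
  exact: adjoin_embeds pf sc sub tot.
split=> K' f a K1 g mult' _ imm hens.
  move=> _ _ hens1 _ compl; apply: embeds => //; last by left.
  by move=> I s pcs _; apply: compl.
by move=> alg _ _ hens1 _ compl; apply: embeds => //; right.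
Qed.
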